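(* Let $p>2$, $f\ge2$, $q=p^f$, $k=(k_0,\dots,k_{f-1})$ with $r_i=k_i-2\ge q$ for all $i$, and suppose $r=\sum_ir_ip^i\equiv a_0\pmod{q-1}$ with $a_0\in\{1,2,\dots,p-1\}$. Assume $p\nmid r_1$, that $p\mid r_0$ if $a_0=1$, and that $a_p$ lies in a finite extension of $\mathbb{Q}_{p^f}$ with $v(a_p)\in(\frac12,1)$. Then the natural surjection $\mathrm{ind}_{KZ}^G(Q_{f-1}/Q_{f-2})\twoheadrightarrow F_s$ vanishes on $T(\mathrm{ind}_{KZ}^G(Q_{f-1}/Q_{f-2}))$, i.e. it factors through $T$.
   Context: Setting: $\mathbb{Q}_{p^f}$ unramified of degree $f$ over $\mathbb{Q}_p$, ring of integers $\mathbb{Z}_{p^f}$, residue field $\mathbb F_q$, Teichmüller lifts $[\lambda]$; $G=\mathrm{GL}_2(\mathbb{Q}_{p^f})$, $K=\mathrm{GL}_2(\mathbb{Z}_{p^f})$, $Z$ the center, $\Gamma=\mathrm{GL}_2(\mathbb F_q)$, $v(p)=1$. For a ring $R$, $V(R)=\bigotimes_{i=0}^{f-1}\mathrm{Sym}^{r_i}R^2$ is modeled on polynomials homogeneous of degree $r_i$ in $(X_i,Y_i)$; $\begin{pmatrix}a&b\\c&d\end{pmatrix}\in K$ acts by $v\mapsto v(a^{\sigma^i}X_i+c^{\sigma^i}Y_i,b^{\sigma^i}X_i+d^{\sigma^i}Y_i)$ ($\sigma$ Frobenius), $p\in Z$ acts trivially. $[g,v]$ is the function supported on $KZg^{-1}$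 with $g'\mapsto g'g\cdot v$. Hecke operator: $T([g,v])=\sum_{\lambda\in\mathbb F_q}[g\begin{pmatrix}p&[\lambda]\\0&1\end{pmatrix},v(X_i,(-[\lambda])^{p^i}X_i+pY_i)]+[g\begin{pmatrix}1&0\\0&p\end{pmatrix},v(pX_i,Y_i)]$; on the induction of a mod $p$ weight $\bigotimes\mathrm{Sym}^{s_i}\bar{\mathbb F}_p^2\otimes\det^m$ it is $T([g,v])=\sum_\lambda[g\begin{pmatrix}p&[\lambda]\\0&1\end{pmatrix},v(X_i,(-\lambda)^{p^i}X_i)]+[g\begin{pmatrix}1&0\\0&p\end{pmatrix},v(0,Y_i)]$. For $a_p$ in a finite extension $E$ (ring of integers $\mathcal O_E$, residue field $k_E$): $\Theta_{k,a_p}$ is the image of $\mathrm{ind}_{KZ}^GV(\mathcal O_E)$ in $\mathrm{ind}_{KZ}^GV(E)/(T-a_p)$, $\bar\Theta_{k,a_p}=\Theta_{k,a_p}\otimes k_E$, with natural surjection $\mathrm{ind}_{KZ}^GV_r\twoheadrightarrow\bar\Theta_{k,a_p}$, $V_r=V(\bar{\mathbb F}_p)$. Let $\theta_i=X_iY_{i-1}^p-Y_iX_{i-1}^p$ (indices mod $f$), $V_r^*$ the subspace of $V_r$ of elements $\sum_i\theta_iP_i$, $X_r$ the $\Gamma$-submodule generated by $\prod_iX_i^{r_i}$, $Q=V_r/(V_r^*+X_r)$; the surjection factors through $\mathrm{ind}_{KZ}^GQ\twoheadrightarrow\bar\Theta_{k,a_p}$. Let $Q_0=0$, $Q_1=\mathrm{soc}(Q)$,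 $Q_{i+1}/Q_i=\mathrm{soc}(Q/Q_i)$ be the socle filtration (with $Q_f=Q$ as in the paper), $F_i$ the image of $\mathrm{ind}_{KZ}^GQ_i$ in $\bar\Theta_{k,a_p}$, and $F_s=F_{f-1}/F_{f-2}$; the map in the claim is the induced surjection. *)

(* Defs.v *)
From HB Require Import structures.
From mathcomp Require Import all_boot all_order all_algebra all_field.
From mathcomp Require Import boolp classical_sets functions.
From mathcomp Require Import mpoly.

Set Implicit Arguments.
Unset Strict Implicit.
Unset Printing Implicit Defensive.

Import Order.TTheory GRing.Theory Num.Theory.
Import Quotient.
Local Open Scope ring_scope.
Local Open Scope quotient_scope.
Local Open Scope classical_set_scope.

Section LinearQuotient.
Variables (K : pzRingType) (V : lmodType K) (S : set V).

Definition lspan : set V := [set v | exists (n : nat) (c : 'I_n -> K)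
  (u : 'I_n -> V), (forall i, S (u i)) /\ v = \sum_i c i *: u i].

Lemma lspan0 : lspan 0.
Proof.
by exists 0%N, (fun=> 0), (fun=> 0); split; [case|rewrite big_ord0].
Qed.

Lemma lspanD u v : lspan u -> lspan v -> lspan (u + v).
Proof.
move=> [m [c [x [Sx ->]]]] [n [d [y [Sy ->]]]].
exists (m + n)%N, (fun i => match fintype.split i with inl j => c j | inr j => d j end),
  (fun i => match fintype.split i with inl j => x j | inr j => y j end).
split=> [i|]; first by case: fintype.split.
by rewrite big_split_ord /=; congr (_ + _); apply: eq_bigr => i _;
  rewrite -/(unsplit (inl i)) -/(unsplit (inr i)) unsplitK.
Qed.

Lemma lspanZ a v : lspan v -> lspan (a *: v).
Proof.
move=> [n [c [x [Sx ->]]]]; exists n, (fun i => a * c i), x; split=> //.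
by rewrite scaler_sumr; apply: eq_bigr => i _; rewrite scalerA.
Qed.

Definition lspan_pred : V -> bool := fun v => `[< lspan v >].

Lemma lspan_zmod_closed : zmod_closed (lspan_pred : {pred V}).
Proof.
split=> [|u v]; first by apply/asboolP; exact: lspan0.
move=> /asboolP Su /asboolP Sv; apply/asboolP; apply: lspanD => //.
by rewrite -scaleN1r; exact: lspanZ.
Qed.

HB.instance Definition _ :=
  GRing.isZmodClosed.Build V lspan_pred lspan_zmod_closed.

Local Notation lq := (quot (GRing.ZmodClosed.clone V lspan_pred _)).

(* The quotient of V by the submodule spanned by S. *)
Definition lquot : Type := lq.
HB.instance Definition _ := GRing.Zmodule.on lquot.

Definition lpi (v : V) : lquot := \pi_lq v.
Definition lrepr (x : lquot) : V := repr (x : lq).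
Definition lquot_scale (a : K) (x : lquot) : lquot := lpi (a *: lrepr x).

Lemma lreprK x : lpi (lrepr x) = x. Proof. exact: reprK. Qed.

Lemma lpiP u v : (lpi u = lpi v) <-> lspan (u - v).
Proof.
split=> [/eqP|h]; last apply/eqP; rewrite /lpi -idealrBE.
  by move=> /asboolP.
by apply/asboolP.
Qed.

Lemma lpiD u v : lpi (u + v) = lpi u + lpi v.
Proof. by rewrite /lpi raddfD. Qed.

Lemma lpiZ a v : lpi (a *: v) = lquot_scale a (lpi v).
Proof.
apply/lpiP; rewrite -scalerBr; apply: lspanZ; apply/lpiP.
by rewrite lreprK.
Qed.

Lemma lquot_scaleA a b x :
  lquot_scale a (lquot_scale b x) = lquot_scale (a * b) x.
Proof. by rewrite -[x]lreprK -!lpiZ scalerA. Qed.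
Lemma lquot_scale1 : left_id 1 lquot_scale.
Proof. by move=> x; rewrite -[x]lreprK -lpiZ scale1r. Qed.
Lemma lquot_scaleDr : right_distributive lquot_scale +%R.
Proof.
move=> a x y; rewrite -[x]lreprK -[y]lreprK.
by rewrite -lpiD -!lpiZ scalerDr lpiD.
Qed.
Lemma lquot_scaleDl x : {morph lquot_scale^~ x : a b / a + b}.
Proof. by move=> a b; rewrite -[x]lreprK -!lpiZ scalerDl lpiD. Qed.

HB.instance Definition _ := GRing.Zmodule_isLmodule.Build K lquot
  lquot_scaleA lquot_scale1 lquot_scaleDr lquot_scaleDl.

(* The action on the quotient induced by an action that preserves lspan S. *)
Definition lquot_act (T : Type) (act : T -> V -> V) (g : T) (x : lquot)
  : lquot := lpi (act g (lrepr x)).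

End LinearQuotient.

Section Valuations.

(* v 0 is unspecified: all conditions are restricted to nonzero elements. *)
Definition valuation (K : fieldType) (v : K -> rat) : Prop :=
  (forall x y, x != 0 -> y != 0 -> v (x * y) = v x + v y) /\
  (forall x y, x != 0 -> y != 0 -> x + y != 0 ->
     Num.min (v x) (v y) <= v (x + y)).

Variables (K : fieldType) (v : K -> rat).

Definition vint (x : K) : bool := (x == 0) || (0 <= v x).
Definition vmax (x : K) : bool := (x == 0) || (0 < v x).
Definition vclose (N : nat) (x y : K) : bool := (x == y) || (N%:R <= v (x - y)).

(* Q_p as the completion of Q: complete for v, with Q dense; a valuation with
   v(p) = 1 restricts to the p-adic one on Q. *)
Record padic_numbers (p : nat) : Prop := PadicNumbers {
  padic_val : valuation v;
  padic_p : p%:R != 0 :> K /\ v p%:R = 1;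
  padic_dense : forall (x : K) (N : nat), exists r : rat, vclose N x (ratr r);
  padic_complete : forall u : nat -> K,
    (forall N, exists M, forall m n, (M <= m)%N -> (M <= n)%N ->
       vclose N (u m) (u n)) ->
    exists l, forall N, exists M, forall n, (M <= n)%N -> vclose N (u n) l
}.

(* red restricts to a ring morphism on the valuation ring whose kernel is the
   maximal ideal; its values elsewhere are unspecified. *)
Record residue_map (k : fieldType) (red : K -> k) : Prop := ResidueMap {
  red_1 : red 1 = 1;
  red_D : forall x y, vint x -> vint y -> red (x + y) = red x + red y;
  red_M : forall x y, vint x -> vint y -> red (x * y) = red x * red y;
  red_ker : forall x, vint x -> (red x == 0) = vmax x
}.

End Valuations.

(* The field Q_{p^f} (called L) over Q_p with its residue field F_q,
   Teichmueller lifts and Frobenius, a finite extension E of it, and an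
   algebraic closure Fpbar of F_p containing k_E (the image of redE). *)
Record setting (p f : nat) := Setting {
  Qp : fieldType;
  vp : Qp -> rat;
  QpP : padic_numbers vp p;

  L : fieldExtType Qp;
  vL : L -> rat;
  vL_valuation : valuation vL;
  vL_extends : forall x : Qp, x != 0 -> vL x%:A = vp x;
  L_degree : \dim {:L} = f;
  L_unramified : forall x : L, x != 0 -> exists2 y : Qp, y != 0 & vL x = vp y;

  Fq : finFieldType;
  redL : L -> Fq;
  redL_residue : residue_map vL redL;
  redL_surj : forall a : Fq, exists2 x : L, vint vL x & redL x = a;

  teich : Fq -> L;
  teichP : forall a : Fq,
    [/\ vint vL (teich a), redL (teich a) = a & teich a ^+ (p ^ f) = teich a];

  sigma : {lrmorphism L -> L};
  sigmaP : forall x : L, vint vL x ->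
    vint vL (sigma x) /\ redL (sigma x) = redL x ^+ p;

  E : fieldExtType L;
  vE : E -> rat;
  vE_valuation : valuation vE;
  vE_extends : forall x : L, x != 0 -> vE x%:A = vL x;

  Fpbar : closedFieldType;
  Fpbar_char : p \in [pchar Fpbar];
  Fpbar_algebraic : forall x : Fpbar, exists2 P : {poly 'F_p}, P != 0 &
    root (map_poly (fun a : 'F_p => (a : nat)%:R) P) x;
  redE : E -> Fpbar;
  redE_residue : residue_map vE redE;
  iota : {rmorphism Fq -> Fpbar};
  iotaP : forall x : L, vint vL x -> iota (redL x) = redE x%:A
}.

Definition mx22 (R : Type) (a b c d : R) : 'M[R]_2 :=
  \matrix_(i < 2, j < 2) if i == ord0 then (if j == ord0 then a else b)
                         else (if j == ord0 then c else d).

Section Polynomials.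
Variables (R : comNzRingType) (f : nat).

Definition pX (i : 'I_f) : {mpoly R[f + f]} := 'X_(lshift f i).
Definition pY (i : 'I_f) : {mpoly R[f + f]} := 'X_(rshift f i).

(* P(x_i, y_i) *)
Definition psubst (x y : 'I_f -> {mpoly R[f + f]}) (P : {mpoly R[f + f]})
    : {mpoly R[f + f]} :=
  P \mPo [tuple match fintype.split j with inl i => x i | inr i => y i end | j < f + f].

(* P(a_i X_i + c_i Y_i, b_i X_i + d_i Y_i) for matrices (a_i b_i; c_i d_i) *)
Definition pact (g : 'I_f -> 'M[R]_2) : {mpoly R[f + f]} -> {mpoly R[f + f]} :=
  psubst (fun i => g i ord0 ord0 *: pX i + g i ord_max ord0 *: pY i)
         (fun i => g i ord0 ord_max *: pX i + g i ord_max ord_max *: pY i).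

(* V(R): homogeneous of degree r_i in (X_i, Y_i) for every i. *)
Definition Vpoly (r : 'I_f -> nat) : set {mpoly R[f + f]} :=
  [set P | forall m, m \in msupp P ->
     forall i : 'I_f, (m (lshift f i) + m (rshift f i) = r i)%N].

End Polynomials.
Arguments pX {R f}.
Arguments pY {R f}.

Section GL2.
Variables (p f : nat) (S : setting p f).
Local Notation L := (L S).
Local Notation E := (E S).
Local Notation Fq := (Fq S).
Local Notation k := (Fpbar S).
Local Notation G := ('M[L]_2).

Definition inK (g : G) : Prop :=
  [/\ forall i j, vint (vL (s:=S)) (g i j), \det g != 0 & vL (\det g) = 0].

Definition inKZ (g : G) : Prop :=
  exists (z : L) (x : G), [/\ z != 0, inK x & g = z *: x].

(* If g = p^n x with x in K then v(det g) = 2n, so this is x. *)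
Definition Kpart (g : G) : G :=
  (p%:R ^ (- Num.floor (vL (\det g) / 2%:R))) *: g.

Section Induction.
Variables (W : zmodType) (act : G -> W -> W).

(* Compact induction from KZ of the representation M of K (M a subspace of W),
   with p acting trivially. Functions on GL_2 are extended by zero to M_2. *)
Record ind (M : set W) (h : G -> W) : Prop := Ind {
  ind_val : forall g, M (h g);
  ind_out : forall g, g \notin unitmx -> h g = 0;
  ind_K : forall x g, inK x -> h (x *m g) = act x (h g);
  ind_p : forall g, h (p%:R *: g) = h g;
  ind_supp : exists s : seq G, forall g, h g != 0 ->
    exists2 y, y \in s & exists2 x, inKZ x & g = x *m y
}.

(* [g, v] *)
Definition bracket (g : G) (v : W) : G -> W :=
  fun g' => if `[< inKZ (g' *m g) >] then act (Kpart (g' *m g)) v else 0.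

Variables (A : Fq -> W -> W) (B : W -> W).

Definition hecke_bracket (g : G) (v : W) : G -> W :=
  \sum_(l : Fq) bracket (g *m mx22 p%:R (teich l) 0 1) (A l v)
  + bracket (g *m mx22 1 0 0 p%:R) (B v).

(* The graph of T on the induction of M: T is the additive extension of
   [g, v] |-> hecke_bracket g v. *)
Definition hecke (M : set W) (h h' : G -> W) : Prop :=
  exists (n : nat) (g : 'I_n -> G) (v : 'I_n -> W),
    [/\ forall i, g i \in unitmx /\ M (v i),
        h = \sum_i bracket (g i) (v i)
      & h' = \sum_i hecke_bracket (g i) (v i)].

End Induction.

Section CharZero.
Local Notation poly := {mpoly E[f + f]}.

Definition actE (g : G) : poly -> poly :=
  pact (fun i => map_mx (fun a : L => (iter i (sigma S) a)%:A) g).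

Definition AE (l : Fq) : poly -> poly :=
  psubst pX (fun i => (- (teich l)%:A) ^+ (p ^ i) *: pX i + p%:R *: pY i).
Definition BE : poly -> poly := psubst (fun i => p%:R *: pX i) pY.

Variables (r : 'I_f -> nat) (ap : E).

Definition VOE : set poly :=
  [set P | Vpoly r P /\ forall m, vint (vE (s:=S)) P@_m].

Definition T_minus_ap : set (G -> poly) :=
  [set u | exists h h', hecke actE AE BE (Vpoly r) h h' /\ u = h' - ap *: h].

(* Theta is a subset of the image of ind V(E) in this quotient. *)
Definition ThetaE : lmodType E := lquot T_minus_ap.
Definition Theta : set ThetaE :=
  [set t | exists h, ind actE VOE h /\ t = lpi T_minus_ap h].

(* Theta (x)_{O_E} Fpbar: the free Fpbar-module on Theta modulo the relations
   (t + u) = (t) + (u) and (a t) = red(a) (t); it sits inside the quotient of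
   the space of all functions ThetaE -> Fpbar, as the span of the tens c t. *)
Definition delta (t : ThetaE) : ThetaE -> k^o := fun u => (u == t)%:R.
Definition tensor_rel : set (ThetaE -> k^o) :=
  [set w | (exists t u, [/\ Theta t, Theta u
                & w = delta (t + u) - delta t - delta u])
        \/ (exists a t, [/\ vint (vE (s:=S)) a, Theta t
                & w = delta (a *: t) - redE a *: delta t])].
Definition ThetaBar : lmodType k := lquot tensor_rel.
Definition tens (c : k) (t : ThetaE) : ThetaBar :=
  lpi tensor_rel (c *: delta t).

End CharZero.

Section CharP.
Local Notation poly := {mpoly k[f + f]}.

Definition gact (g : 'M[Fq]_2) : poly -> poly :=
  pact (fun i => map_mx (fun a : Fq => iota S a ^+ (p ^ i)) g).

(* Action of K through reduction to GL_2(F_q). *)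
Definition Kact (W : Type) (act : 'M[Fq]_2 -> W -> W) (g : G) : W -> W :=
  act (map_mx (@redL _ _ S) g).

Section Socle.
Variables (W : lmodType k) (act : 'M[Fq]_2 -> W -> W).

Definition Gsubmodule (M : set W) : Prop :=
  [/\ M 0, forall (a : k) u v, M u -> M v -> M (a *: u + v)
    & forall g v, g \in unitmx -> M v -> M (act g v)].

Definition Gsimple (M : set W) : Prop :=
  [/\ Gsubmodule M, M <> [set 0]
    & forall N, Gsubmodule N -> N `<=` M -> N = [set 0] \/ N = M].

Definition socle (M : set W) : set W :=
  lspan [set w | exists N, [/\ Gsimple N, N `<=` M & N w]].

End Socle.

Fixpoint socle_filtration (W : lmodType k) (act : 'M[Fq]_2 -> W -> W)
    (M : set W) (i : nat) : set W :=
  if i is j.+1 then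
    let N := socle_filtration act M j in
    [set w | M w /\ socle (lquot_act (S:=N) act) (lpi N @` M) (lpi N w)]
  else [set 0].

(* The weight Sym^{s_0} (x) ... (x) Sym^{s_{f-1}} (x) det^m on Vpoly s, and its
   Hecke operator. *)
Definition wact (m : nat) (g : 'M[Fq]_2) (P : poly) : poly :=
  iota S (\det g) ^+ m *: gact g P.
Definition Aw (l : Fq) : poly -> poly :=
  psubst pX (fun i => (- iota S l) ^+ (p ^ i) *: pX i).
Definition Bw : poly -> poly := psubst (fun=> 0) pY.
Definition hecke_weight (s : 'I_f -> nat) (m : nat) :=
  hecke (Kact (wact m)) Aw Bw (Vpoly s).

Variables (r : 'I_f -> nat) (ap : E).

Definition theta (i : 'I_f) : poly :=
  pX i * pY (ord_pred i) ^+ p - pY i * pX (ord_pred i) ^+ p.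

Definition Vstar : set poly :=
  [set P | Vpoly r P /\ exists Q : 'I_f -> poly, P = \sum_i theta i * Q i].
Definition Xr : set poly :=
  lspan [set P | exists2 g, g \in unitmx & P = gact g (\prod_i pX i ^+ r i)].

(* Q is the image of V_r in the quotient of all polynomials by Vstar + Xr. *)
Definition Qamb : lmodType k := lquot (Vstar `|` Xr).
Definition prQ : poly -> Qamb := lpi (Vstar `|` Xr).
Definition Q : set Qamb := prQ @` Vpoly r.
Definition Qact : 'M[Fq]_2 -> Qamb -> Qamb := lquot_act gact.
Definition Qfil (i : nat) : set Qamb := socle_filtration Qact Q i.

(* The graph of the natural map ind V_r -> ThetaBar, i.e. of
   ind V(O_E) (x) Fpbar -> Theta (x) Fpbar. *)
Definition nat_map (x : G -> poly) (t : ThetaBar r ap) : Prop :=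
  exists (n : nat) (c : 'I_n -> k) (y : 'I_n -> G -> {mpoly E[f + f]}),
    [/\ forall i, ind actE (VOE r) (y i),
        x = \sum_i c i *: (fun g => map_mpoly (@redE _ _ S) (y i g) : poly)
      & t = \sum_i tens (c i) (lpi (T_minus_ap r ap) (y i))].

(* The graph of the map ind Q -> ThetaBar induced by nat_map. *)
Definition nat_mapQ (z : G -> Qamb) (t : ThetaBar r ap) : Prop :=
  exists x, [/\ ind (Kact gact) (Vpoly r) x, z = prQ \o x & nat_map x t].

Definition Ffil (i : nat) : set (ThetaBar r ap) :=
  [set t | exists2 z, ind (Kact Qact) (Qfil i) z & nat_mapQ z t].

(* The subquotients Q_{i+1} / Q_i and F_{i+1} / F_i (the latter inside
   ThetaBar / F_i). *)
Definition Qgr_amb (i : nat) : lmodType k := lquot (Qfil i).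
Definition Qgr (i : nat) : set (Qgr_amb i) := lpi (Qfil i) @` Qfil i.+1.
Definition Qgr_act (i : nat) : 'M[Fq]_2 -> Qgr_amb i -> Qgr_amb i :=
  lquot_act Qact.
Definition Fgr_amb (i : nat) : lmodType k := lquot (Ffil i).

(* The graph of the induced map ind (Q_{i+1} / Q_i) -> F_{i+1} / F_i. *)
Definition gr_map (i : nat) (y : G -> Qgr_amb i) (u : Fgr_amb i) : Prop :=
  exists z t, [/\ ind (Kact Qact) (Qfil i.+1) z, nat_mapQ z t,
    y = lpi (Qfil i) \o z & u = lpi (Ffil i) t].

(* phi restricts to an isomorphism of GL_2(F_q)-representations from the weight
   (s, m) onto Q_{i+1} / Q_i. *)
Definition weight_iso (i : nat) (s : 'I_f -> nat) (m : nat)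
    (phi : {linear {mpoly k[f + f]} -> Qgr_amb i}) : Prop :=
  [/\ forall j, (s j < p)%N,
      forall g P, g \in unitmx -> Vpoly s P ->
        phi (wact m g P) = Qgr_act g (phi P),
      forall P, Vpoly s P -> phi P = 0 -> P = 0
    & phi @` Vpoly s = @Qgr i].

End CharP.
End GL2.

(* Main.v *)
(* Write val a = sum_i a_i p^i and N = q - 1 + a0.  Modulo the theta_i, the class of the
   monomial X^a Y^(r - a) depends only on val a mod q - 1 (theta_i performs a carry), and
   modulo X_r the classes e_n with n < a0 vanish; the functionals l_n, read off from P(x, 1),
   show that the e_n with a0 <= n < q form a basis of Q.  The torus separates the e_n, the
   unipotent matrices move digits down, and w swaps e_n and e_(N - n): hence the submodules
   of Q form the chain M_e = <e_n | n mod p^e < a0>, and Q_i = M_(f - i).  In particular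
   Q_(f-1) / Q_(f-2) is the weight with s = (a0 - 1, p - 2, p - 1, ..., p - 1) twisted by
   det^p, X^s and Y^s going to multiples of e_(N - p) and e_p.

   The map from ind V_r kills theta_i P because T(theta_i P) is divisible by p and
   v(a_p) < 1, and kills Y^r because (T - a_p)[g, Y^r - X^(p-1) Y^(r-p+1)] (these exponents
   for every index i) reduces to
   [g diag(1, p), Y^r].

   For the image of T, let W = sum_c [c]^J n_c Y^r, where n_c is the upper unipotent matrix
   with entry [c] and J = q - 1 - p - val b.  Then T[g, W] is divisible by p, and the
   first-order terms of T[g, W] / p reduce, modulo Q_(f-2), to a nonzero multiple of r_1
   times T[g, X^b Y^(s - b)].  The remaining term a_p W / p is not integral, but adding
   (a_p / p) sum_c [c]^J [g n_c diag(1, p)^(-1), Y^r - X^(p-1) Y^(r-p+1)] replaces it by terms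
   with coefficients a_p and a_p^2 / p, which reduce to zero as v(a_p) > 1/2. *)

Require Import Defs.
From HB Require Import structures.
From mathcomp Require Import all_boot all_order all_algebra all_field.
From mathcomp Require Import boolp classical_sets functions.
From mathcomp Require Import mpoly.
From mathcomp Require Import zify ring lra.

Set Implicit Arguments.
Unset Strict Implicit.
Unset Printing Implicit Defensive.

Import Order.TTheory GRing.Theory Num.Theory.
Local Open Scope ring_scope.

(** * Polynomials *)

(** The exponent J comes from orthogonality of characters: up to sign, the sum over c of c^J (c -
    l)^(val r - p) is the coefficient of c^(val b + p) in the expansion of the power of c - l. It
    contains (-l)^(val s - val b), the factor by which T acts on X^b Y^(s - b). The leading terms
    vanish for the same reason, since J > 0 and J + a0 < q - 1. The first-order term of index i
    carries r_i. For i >= 2 it falls into Q_(f-2), and i = 1 is the term that is wanted. For i = 0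
    the exponent is a0 - 1 modulo q - 1, and orthogonality removes the term when a0 > 1; when a0 = 1
    this fails and p | r_0 removes it.

    Two obstacles shape the proof. E may be ramified over L, so an integer of E that reduces to zero
    need not be divisible by p; the coefficients of W are therefore kept in L, whose valuation is
    integral. The isomorphism of Q_(f-1) / Q_(f-2) with a weight is arbitrary, while T involves both
    X^s and Y^s; it has to be shown that their images are determined up to one common scalar, with
    relative sign -1. *)

Lemma mpoly_rmorph_ext (R S : comNzRingType) n
    (F G : {rmorphism {mpoly R[n]} -> S}) :
  (forall c, F c%:MP = G c%:MP) -> (forall i, F 'X_i = G 'X_i) -> F =1 G.
Proof.
move=> FGC FGX P; rewrite (mpolyE P) !rmorph_sum; apply: eq_bigr => m _.
rewrite -mul_mpolyC !rmorphM /= FGC; congr (_ * _).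
rewrite mpolyXE_id !rmorph_prod; apply: eq_bigr => i _.
by rewrite !rmorphXn /= FGX.
Qed.

Section Psubst.
Variables (R : comNzRingType) (f : nat).
Implicit Types (x y : 'I_f -> {mpoly R[f + f]}) (P : {mpoly R[f + f]}).

HB.instance Definition _ x y := GRing.RMorphism.copy (psubst x y)
  (comp_mpoly [tuple match fintype.split j with inl i => x i | inr i => y i end
     | j < f + f]).
HB.instance Definition _ x y := GRing.Linear.copy (psubst x y)
  (comp_mpoly [tuple match fintype.split j with inl i => x i | inr i => y i end
     | j < f + f]).
HB.instance Definition _ (g : 'I_f -> 'M[R]_2) :=
  GRing.RMorphism.on (pact g).
HB.instance Definition _ (g : 'I_f -> 'M[R]_2) :=
  GRing.Linear.on (pact g).

Lemma psubstC x y c : psubst x y c%:MP = c%:MP.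
Proof. exact: comp_mpolyC. Qed.

Lemma psubstX x y i : psubst x y (pX i) = x i.
Proof.
rewrite /psubst /pX comp_mpolyXU -tnth_nth tnth_mktuple.
by rewrite -/(unsplit (inl i)) unsplitK.
Qed.

Lemma psubstY x y i : psubst x y (pY i) = y i.
Proof.
rewrite /psubst /pY comp_mpolyXU -tnth_nth tnth_mktuple.
by rewrite -/(unsplit (inr i)) unsplitK.
Qed.

Lemma eq_psubst x y x' y' : x =1 x' -> y =1 y' -> psubst x y =1 psubst x' y'.
Proof. by move=> /funext -> /funext ->. Qed.

Lemma ord_split_ind (Pr : 'I_(f + f) -> Prop) :
  (forall i, Pr (lshift f i)) -> (forall i, Pr (rshift f i)) -> forall j, Pr j.
Proof. by move=> Pl Pr' j; rewrite -(splitK j); case: fintype.split => i /=. Qed.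

Lemma psubst_comp x y x' y' P : psubst x y (psubst x' y' P) =
  psubst (psubst x y \o x') (psubst x y \o y') P.
Proof.
pose F : {rmorphism _ -> _} := psubst x y \o psubst x' y'.
rewrite -[LHS]/(F P).
apply: mpoly_rmorph_ext => [c|] /=; first by rewrite !psubstC.
by apply: ord_split_ind => i; rewrite -?/(pX i) -?/(pY i) !(psubstX, psubstY).
Qed.

Definition mono (a b : 'I_f -> nat) : {mpoly R[f + f]} :=
  \prod_i (pX i ^+ a i * pY i ^+ b i).

Lemma psubst_mono x y a b :
  psubst x y (mono a b) = \prod_i (x i ^+ a i * y i ^+ b i).
Proof.
rewrite rmorph_prod; apply: eq_bigr => i _.
by rewrite rmorphM !rmorphXn /= psubstX psubstY.
Qed.

Definition mnm_of (a b : 'I_f -> nat) : 'X_{1..f + f} :=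
  [multinom match fintype.split j with inl i => a i | inr i => b i end
     | j < f + f].

Lemma mnm_of_l a b i : mnm_of a b (lshift f i) = a i.
Proof. by rewrite mnmE -/(unsplit (inl i)) unsplitK. Qed.

Lemma mnm_of_r a b i : mnm_of a b (rshift f i) = b i.
Proof. by rewrite mnmE -/(unsplit (inr i)) unsplitK. Qed.

Lemma monoE a b : mono a b = 'X_[mnm_of a b].
Proof.
rewrite mpolyXE_id big_split_ord /= -big_split /=.
by apply: eq_bigr => i _; rewrite mnm_of_l mnm_of_r.
Qed.

Lemma mnm_ofK (m : 'X_{1..f + f}) :
  mnm_of (fun i => m (lshift f i)) (fun i => m (rshift f i)) = m.
Proof.
by apply/mnmP; apply: ord_split_ind => i; rewrite ?mnm_of_l ?mnm_of_r.
Qed.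

Lemma mnm_of_inj a b a' b' : mnm_of a b = mnm_of a' b' -> a =1 a' /\ b =1 b'.
Proof.
by move=> e; split=> i; [have := mnm_of_l a b i|have := mnm_of_r a b i];
  rewrite e ?mnm_of_l ?mnm_of_r.
Qed.

Lemma monoM a b a' b' : mono a b * mono a' b' =
  mono (fun i => a i + a' i)%N (fun i => b i + b' i)%N.
Proof.
rewrite /mono -big_split /=; apply: eq_bigr => i _.
by rewrite !exprD; ring.
Qed.

Lemma eq_mono a b a' b' : a =1 a' -> b =1 b' -> mono a b = mono a' b'.
Proof. by move=> /funext -> /funext ->. Qed.

Lemma mono0 : mono (fun=> 0%N) (fun=> 0%N) = 1.
Proof. by rewrite /mono big1 // => i _; rewrite !expr0 mulr1. Qed.

Lemma mono_delta i : mono (fun j => (j == i) : nat) (fun=> 0%N) = pX i.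
Proof.
rewrite /mono (bigD1 i) //= eqxx expr0 expr1 mulr1 big1 ?mulr1 // => j /negbTE ->.
by rewrite !expr0 mulr1.
Qed.

Lemma mono_deltaY i : mono (fun=> 0%N) (fun j => (j == i) : nat) = pY i.
Proof.
rewrite /mono (bigD1 i) //= eqxx expr0 expr1 mul1r big1 ?mulr1 // => j /negbTE ->.
by rewrite !expr0 mulr1.
Qed.

Implicit Types (r s : 'I_f -> nat).

Lemma Vpoly0 r : Vpoly r (0 : {mpoly R[f + f]}).
Proof. by move=> m; rewrite msupp0. Qed.

Lemma VpolyD r P Q : Vpoly r P -> Vpoly r Q -> Vpoly r (P + Q).
Proof.
move=> rP rQ m /msuppD_le; rewrite mem_cat => /orP[/rP|/rQ]; exact.
Qed.

Lemma VpolyZ r c P : Vpoly r P -> Vpoly r (c *: P).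
Proof. by move=> rP m /msuppZ_le /rP. Qed.

Lemma VpolyN r P : Vpoly r P -> Vpoly r (- P).
Proof. by rewrite -scaleN1r; exact: VpolyZ. Qed.

Lemma VpolyB r P Q : Vpoly r P -> Vpoly r Q -> Vpoly r (P - Q).
Proof. by move=> rP /VpolyN; exact: VpolyD. Qed.

Lemma Vpoly_sum r (I : Type) (s : seq I) (Pr : pred I) (F : I -> {mpoly R[f + f]}) :
  (forall i, Pr i -> Vpoly r (F i)) -> Vpoly r (\sum_(i <- s | Pr i) F i).
Proof. by move=> rF; elim/big_ind: _; [exact: Vpoly0|exact: VpolyD|]. Qed.

Lemma VpolyM r s P Q : Vpoly r P -> Vpoly s Q ->
  Vpoly (fun i => r i + s i)%N (P * Q).
Proof.
move=> rP sQ m /msuppM_le /allpairsP[[m1 m2] /= [/rP h1 /sQ h2 ->]] i.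
by rewrite !mnmDE -h1 -h2; lia.
Qed.

Lemma eq_Vpoly r s P : r =1 s -> Vpoly r P -> Vpoly s P.
Proof. by move=> /funext ->. Qed.

Lemma Vpoly_mono r a b : (forall i, a i + b i = r i)%N -> Vpoly r (mono a b).
Proof.
move=> abr m; rewrite monoE msuppX mem_seq1 => /eqP -> i.
by rewrite mnm_of_l mnm_of_r.
Qed.

Lemma Vpoly1 : Vpoly (fun=> 0%N) (1 : {mpoly R[f + f]}).
Proof. by rewrite -mono0; apply: Vpoly_mono. Qed.

Lemma Vpoly_exp r P n : Vpoly r P -> Vpoly (fun i => n * r i)%N (P ^+ n).
Proof.
move=> rP; elim: n => [|n IH]; first exact: Vpoly1.
rewrite exprS; apply: eq_Vpoly (VpolyM rP IH) => i; lia.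
Qed.

Lemma Vpoly_prod (d : 'I_f -> 'I_f -> nat) (F : 'I_f -> {mpoly R[f + f]}) :
  (forall j, Vpoly (d j) (F j)) ->
  Vpoly (fun i => \sum_j d j i)%N (\prod_j F j).
Proof.
move=> dF; elim: (index_enum _) => [|j t IH].
  by rewrite big_nil; apply: eq_Vpoly Vpoly1 => i; rewrite big_nil.
rewrite big_cons; apply: eq_Vpoly (VpolyM (dF j) IH) => i.
by rewrite big_cons.
Qed.

Lemma Vpoly_linX (u v : R) (i : 'I_f) :
  Vpoly (fun j => (j == i) : nat) (u *: pX i + v *: pY i).
Proof.
apply: VpolyD; apply: VpolyZ; rewrite -?mono_delta -?mono_deltaY;
  by apply: Vpoly_mono => j; lia.
Qed.

(** Monomials are normalised to the exponents [r i - a i] with [a i <= r i], where truncated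
    subtraction is exact; the classes in Q are indexed by such [a]. *)
Lemma Vpoly_ind r (Pr : {mpoly R[f + f]} -> Prop) :
  Pr 0 -> (forall c P Q, Pr P -> Pr Q -> Pr (c *: P + Q)) ->
  (forall a, (forall i, a i <= r i)%N -> Pr (mono a (fun i => r i - a i)%N)) ->
  forall P, Vpoly r P -> Pr P.
Proof.
move=> Pr0 PrD Prm P rP; rewrite (mpolyE P).
rewrite big_seq; elim/big_rec: _ => // m Q mP IH; apply: PrD => //.
have := rP m mP => rm.
rewrite -[m]mnm_ofK -monoE.
rewrite (@eq_mono _ _ (fun i => m (lshift f i)) (fun i => r i - m (lshift f i))%N) //.
  by apply: Prm => i; rewrite -rm leq_addr.
by move=> i /=; rewrite -rm addKn.
Qed.

Lemma Vpoly_psubst r x y : (forall i, Vpoly (fun j => (j == i) : nat) (x i)) ->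
  (forall i, Vpoly (fun j => (j == i) : nat) (y i)) ->
  forall P, Vpoly r P -> Vpoly r (psubst x y P).
Proof.
move=> hx hy; apply: Vpoly_ind => [|c P Q rP rQ|a ar].
- by rewrite rmorph0; exact: Vpoly0.
- by rewrite linearP; apply: VpolyD => //; exact: VpolyZ.
- rewrite psubst_mono.
  have h i := VpolyM (Vpoly_exp (n := a i) (hx i)) (Vpoly_exp (n := (r i - a i)%N) (hy i)).
  apply: eq_Vpoly (Vpoly_prod h) => i /=.
  rewrite (bigD1 i) //= big1 => [|j /negbTE ji].
    by rewrite eqxx; have := ar i; lia.
  by rewrite eq_sym ji !muln0.
Qed.

Lemma Vpoly_pact r g P : Vpoly r P -> Vpoly r (pact g P).
Proof. by apply: Vpoly_psubst => i; exact: Vpoly_linX. Qed.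

Lemma eq_pact g h P : g =1 h -> pact g P = pact h P.
Proof. by move=> /funext ->. Qed.

Lemma pact_comp g h P :
  pact g (pact h P) = pact (fun i => g i *m h i) P.
Proof.
rewrite /pact psubst_comp; apply: eq_psubst => i /=;
  rewrite linearD !linearZ /= psubstX psubstY !mxE !big_ord_recl !big_ord0 /=
    (_ : lift ord0 ord0 = ord_max); try exact/val_inj;
  by rewrite -!mul_mpolyC !mpolyCD !mpolyCM; ring.
Qed.

Lemma pact_id P : pact (fun=> 1%:M) P = P.
Proof.
rewrite -[RHS]comp_mpoly_id /pact /psubst; congr (comp_mpoly _ P).
apply: eq_from_tnth => j; rewrite !tnth_mktuple.
by rewrite -{2}(splitK j); case: fintype.split => i /=;
  rewrite !mxE /= ?mulr0n ?mulr1n scale1r scale0r ?addr0 ?add0r.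
Qed.

End Psubst.

Lemma map_mono (R S : comNzRingType) f (F : {rmorphism R -> S}) (a b : 'I_f -> nat) :
  map_mpoly F (mono R a b) = mono S a b.
Proof. by rewrite !monoE map_mpolyX. Qed.

Lemma map_pX (R S : comNzRingType) f (F : {rmorphism R -> S}) (i : 'I_f) :
  map_mpoly F (pX i) = pX i.
Proof. exact: map_mpolyX. Qed.

Lemma map_pY (R S : comNzRingType) f (F : {rmorphism R -> S}) (i : 'I_f) :
  map_mpoly F (pY i) = pY i.
Proof. exact: map_mpolyX. Qed.

Lemma map_psubst (R S : comNzRingType) f (F : {rmorphism R -> S})
    (x y : 'I_f -> {mpoly R[f + f]}) P :
  map_mpoly F (psubst x y P) =
  psubst (map_mpoly F \o x) (map_mpoly F \o y) (map_mpoly F P).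
Proof.
pose F1 : {rmorphism _ -> _} := map_mpoly F \o psubst x y.
pose F2 : {rmorphism _ -> _} :=
  psubst (map_mpoly F \o x) (map_mpoly F \o y) \o map_mpoly F.
rewrite -[LHS]/(F1 P) -[RHS]/(F2 P).
apply: mpoly_rmorph_ext => [c|] /=; first by rewrite psubstC !map_mpolyC psubstC.
by apply: ord_split_ind => i; rewrite -?/(pX i) -?/(pY i) ?map_pX ?map_pY
  !(psubstX, psubstY).
Qed.

Lemma map_pact (R S : comNzRingType) f (F : {rmorphism R -> S})
    (g : 'I_f -> 'M[R]_2) P :
  map_mpoly F (pact g P) = pact (fun i => map_mx F (g i)) (map_mpoly F P).
Proof.
rewrite /pact map_psubst; apply: eq_psubst => i /=;
  by rewrite rmorphD /= !map_mpolyZ map_pX map_pY !mxE.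
Qed.

Lemma map_Vpoly (R S : comNzRingType) f (F : {rmorphism R -> S}) (r : 'I_f -> nat) P :
  Vpoly r P -> Vpoly r (map_mpoly F P).
Proof.
move=> rP m; rewrite mcoeff_msupp mcoeff_map_mpoly => h; apply: rP.
by rewrite mcoeff_msupp; apply: contra h => /eqP ->; rewrite raddf0.
Qed.

(** * Valuations and residue fields *)

Section ValuationTheory.
Variables (K : fieldType) (v : K -> rat) (Hv : valuation v).

(** This builds in the convention that zero has infinite value, so that the ultrametric estimates
    need no side conditions. *)
Definition vge (c : rat) (x : K) : bool := (x == 0) || (c <= v x).

Lemma vltM x y : x != 0 -> y != 0 -> v (x * y) = v x + v y.
Proof. exact: Hv.1. Qed.

Lemma vlt1 : v 1 = 0.
Proof. by have := vltM (oner_neq0 K) (oner_neq0 K); rewrite mulr1; lra. Qed.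

Lemma vltN1 : v (-1) = 0.
Proof.
have n1 : -1 != 0 :> K by rewrite oppr_eq0 oner_neq0.
by have := vltM n1 n1; rewrite mulrNN mulr1 vlt1; lra.
Qed.

Lemma vltN x : x != 0 -> v (- x) = v x.
Proof.
by move=> x0; rewrite -mulN1r vltM ?oppr_eq0 ?oner_neq0 // vltN1 add0r.
Qed.

Lemma vltV x : x != 0 -> v x^-1 = - v x.
Proof.
move=> x0; have := vltM x0 (_ : x^-1 != 0); rewrite invr_eq0 mulfV // vlt1.
by move/(_ x0); lra.
Qed.

Lemma vltX x n : x != 0 -> v (x ^+ n) = v x *+ n.
Proof.
move=> x0; elim: n => [|n IH]; first by rewrite vlt1.
by rewrite exprS vltM ?expf_neq0 // IH mulrS.
Qed.

Lemma vltXz x (n : int) : x != 0 -> v (x ^ n) = v x *~ n.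
Proof.
move=> x0; case: n => n; first by rewrite /= vltX.
by rewrite NegzE -exprnN vltV ?expf_neq0 // vltX // mulrNz.
Qed.

Lemma vge0 c : vge c 0. Proof. by rewrite /vge eqxx. Qed.

Lemma vge_val c x : x != 0 -> vge c x = (c <= v x).
Proof. by rewrite /vge => /negbTE ->. Qed.

Lemma vgeD c x y : vge c x -> vge c y -> vge c (x + y).
Proof.
have [->|x0] := eqVneq x 0; first by rewrite add0r.
have [->|y0] := eqVneq y 0; first by rewrite addr0.
have [->|xy0] := eqVneq (x + y) 0; first by rewrite vge0.
rewrite !vge_val // => cx cy; apply: le_trans (Hv.2 _ _ x0 y0 xy0).
by rewrite le_min cx.
Qed.

Lemma vgeN c x : vge c (- x) = vge c x.
Proof. by rewrite /vge oppr_eq0; case: eqVneq => //= x0; rewrite vltN. Qed.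

Lemma vgeB c x y : vge c x -> vge c y -> vge c (x - y).
Proof. by move=> hx hy; apply: vgeD; rewrite ?vgeN. Qed.

Lemma vgeM c d x y : vge c x -> vge d y -> vge (c + d) (x * y).
Proof.
have [->|x0] := eqVneq x 0; first by move=> *; rewrite mul0r; exact: vge0.
have [->|y0] := eqVneq y 0; first by move=> *; rewrite mulr0; exact: vge0.
by rewrite !vge_val ?mulf_neq0 // vltM //; lra.
Qed.

Lemma vgeW c d x : c <= d -> vge d x -> vge c x.
Proof. by rewrite /vge; case: eqVneq => //= _; lra. Qed.

Lemma vge_sum c I (s : seq I) (F : I -> K) :
  (forall i, vge c (F i)) -> vge c (\sum_(i <- s) F i).
Proof. by move=> h; apply: (big_ind (vge c)) => [|x y|i _]; [exact: vge0|exact: vgeD|]. Qed.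

Lemma vge0_nat n : vge 0 n%:R.
Proof.
elim: n => [|n IH]; first exact: vge0.
by rewrite -natr1; apply: vgeD => //; rewrite vge_val ?oner_neq0 // vlt1.
Qed.

(** In an ultrametric triangle the two largest sides are equal. Through this lemma a dense subfield
    determines the value group. *)
Lemma val_close x y : x != 0 -> v x < v (x - y) -> y != 0 /\ v y = v x.
Proof.
move=> x0 xy; have [y0|y0] := eqVneq y 0.
  by move: xy; rewrite y0 subr0 ltxx.
split=> //; have [e|d0] := eqVneq (x - y) 0.
  by have -> : y = x by rewrite -[x]subr0 -e; ring.
have h1 : vge (Num.min (v x) (v (x - y))) (x - (x - y)).
  apply: vgeB; rewrite vge_val // ge_min lexx ?orbT //.
have h2 : vge (Num.min (v y) (v (x - y))) (y + (x - y)).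
  apply: vgeD; rewrite vge_val // ge_min lexx ?orbT //.
move: h1 h2; rewrite subKr addrCA subrr addr0 !vge_val // => h1 h2.
move: h1; rewrite min_l ?(ltW xy) // => h1.
move: h2; rewrite ge_min => /orP[]; lra.
Qed.

Lemma vclose_vge N x y : vclose v N x y = vge N%:R (x - y).
Proof. by rewrite /vclose /vge subr_eq0. Qed.

Lemma vge_eq0 x : (forall N : nat, vge N%:R x) -> x = 0.
Proof.
move=> h; apply/eqP/negPn/negP => x0.
have := h (Num.bound (v x)); rewrite vge_val //.
have := archi_boundP (normr_ge0 (v x)) => h1 h2.
have h3 := ler_norm (v x).
have h4 : Num.bound (v x) = Num.bound `|v x|.
  by rewrite /Num.bound normr_id.
by rewrite h4 in h2; lra.
Qed.

End ValuationTheory.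

Section PadicVal.
Variables (K : fieldType) (v : K -> rat) (p : nat).
Hypotheses (Hv : valuation v) (p_prime : prime p).
Hypotheses (p0 : p%:R != 0 :> K) (vp1 : v p%:R = 1).

(** Write n = n1 p^m with n1 prime to p. A relation a n1 - b p = 1 forces n1 to be nonzero of value
    0, since otherwise 1 would have positive value. *)
Lemma val_nat n : (0 < n)%N -> n%:R != 0 :> K /\ v n%:R \is a Num.int.
Proof.
move=> n_gt0; have [n1 cp ->] := pfactor_coprime p_prime n_gt0.
have [u0 vu] : n1%:R != 0 :> K /\ v n1%:R = 0.
  have n1_gt0 : (0 < n1)%N by case: n1 cp => //; rewrite /coprime gcdn0; case: p p_prime => [|[]].
  case: (egcdnP p n1_gt0) => a b e _.
  have {}e : (a * n1)%:R = (b * p)%:R + 1 :> K.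
    by rewrite e (_ : gcdn n1 p = 1%N) ?natrD //; apply/eqP; rewrite -/(coprime _ _) coprime_sym.
  have h1 : 1 = (a * n1)%:R - (b * p)%:R :> K by rewrite e; ring.
  have h2 : vge v 1 (b * p)%:R.
    rewrite natrM -[1]add0r; apply: vgeM => //; first exact: vge0_nat.
    by rewrite vge_val // vp1.
  have h3 : ~~ vge v 1 1 by rewrite vge_val ?oner_neq0 // vlt1.
  have h4 c : vge v c n1%:R -> vge v c (a * n1)%:R.
    by move=> h; rewrite natrM -[c]add0r; apply: vgeM => //; exact: vge0_nat.
  have u0 : n1%:R != 0 :> K.
    apply: contra h3 => /eqP n10.
    rewrite h1; apply: vgeB => //; apply: h4; rewrite n10; exact: vge0.
  split=> //; apply/eqP; apply: contraTT isT => vn0.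
  have vn : 0 < v n1%:R.
    by have := vge0_nat Hv n1; rewrite vge_val // lt_def vn0.
  have : vge v (Num.min 1 (v n1%:R)) 1.
    rewrite {2}h1; apply: vgeB => //.
      by apply: h4; rewrite vge_val // ge_min lexx orbT.
    by apply: vgeW h2; rewrite ge_min lexx.
  rewrite vge_val ?oner_neq0 // vlt1 // ge_min; lra.
rewrite natrM natrX mulf_neq0 ?expf_neq0 //; split=> //.
rewrite vltM ?expf_neq0 // vu add0r vltX // vp1; exact: rpredMn.
Qed.

Lemma val_ratr (r : rat) : ratr r != 0 :> K -> v (ratr r) \is a Num.int.
Proof.
have natE (z : int) : z != 0 -> z%:~R != 0 :> K /\ v z%:~R \is a Num.int.
  move=> z0; have [n n_gt0 [->|->]] : exists2 n, (0 < n)%N & z = n%:Z \/ z = - n%:Z.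
  - exists `|z|%N; rewrite ?absz_gt0 //.
    by case: z z0 => n _; [left|right]; rewrite ?NegzE.
  - exact: val_nat.
  - have [n0 vn] := val_nat n_gt0.
    by rewrite rmorphN /= oppr_eq0; split=> //; rewrite vltN.
rewrite /ratr => r0.
have [h1 h2] := natE _ (denq_neq0 r).
have n0 : numq r != 0 by apply: contraNneq r0 => ->; rewrite mul0r.
have [h3 h4] := natE _ n0.
by rewrite vltM ?invr_eq0 // vltV // rpredB.
Qed.

End PadicVal.

Section FieldFacts.
Variables (p f : nat) (S : setting p f).
Hypotheses (p_prime : prime p).
Local Notation vL := (vL (s := S)).
Local Notation vE := (vE (s := S)).
Local Notation redL := (redL (s := S)).

(** A rational number whose distance to x has value larger than v(x) has the same value as x, and
    values are integral on the rationals. *)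
Lemma vp_int (x : Qp S) : x != 0 -> vp x \is a Num.int.
Proof.
have P := QpP S; have Hv := padic_val P; have [p0 vp1] := padic_p P.
move=> x0; have [N hN] : exists N : nat, vp x < N%:R.
  exists (Num.bound `|vp x|); have := archi_boundP (normr_ge0 (vp x)).
  by have := ler_norm (vp x); lra.
have [r] := padic_dense P x N; rewrite vclose_vge.
have [e|d0] := eqVneq (x - ratr r) 0.
  have {e} e : x = ratr r by apply/eqP; rewrite -subr_eq0 e.
  by move: x0; rewrite e => x0 _; exact: (val_ratr Hv p_prime).
rewrite vge_val // => h; have [y0 <-] := val_close Hv x0 (lt_le_trans hN h).
exact: (val_ratr Hv p_prime).
Qed.

Lemma vL_int (x : L S) : x != 0 -> vL x \is a Num.int.
Proof. by move=> /L_unramified[y y0 ->]; exact: vp_int. Qed.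

Let Hv : valuation vL := @vL_valuation _ _ S.

Lemma natA (F : fieldType) (A : fieldExtType F) n : (n%:R)%:A = n%:R :> A.
Proof. by rewrite scaler_nat. Qed.

Lemma pL0 : p%:R != 0 :> L S.
Proof.
have [p0 _] := padic_p (QpP S).
by rewrite -natA scaler_eq0 negb_or p0 oner_neq0.
Qed.

Lemma vLp : vL p%:R = 1.
Proof.
have [p0 vp1] := padic_p (QpP S).
by rewrite -natA vL_extends.
Qed.

Lemma pE0 : p%:R != 0 :> E S.
Proof. by rewrite -natA scaler_eq0 negb_or pL0 oner_neq0. Qed.

Lemma vEp : vE p%:R = 1.
Proof. by rewrite -natA vE_extends ?pL0 // vLp. Qed.

(** Unramifiedness enters here: a positive value is an integer, hence at least 1 = v(p). *)
Lemma vmax_div_p (x : L S) : vint vL x -> redL x = 0 ->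
  exists2 y, vint vL y & x = p%:R * y.
Proof.
move=> ix /eqP; rewrite (red_ker (redL_residue S)) // /vmax.
have [->|x0] := eqVneq x 0; first by exists 0; rewrite ?mulr0 // /vint eqxx.
move=> /= vx; exists (p%:R^-1 * x); last by rewrite mulVKf // pL0.
have := vL_int x0 => /intrP[z hz].
rewrite /vint mulf_eq0 invr_eq0 (negbTE pL0) (negbTE x0) /=.
rewrite vltM ?invr_eq0 ?pL0 // vltV ?pL0 // vLp hz.
by move: vx; rewrite hz ltr0z => h; rewrite addrC subr_ge0 (_ : 1 = 1%:~R) // ler_int.
Qed.

Lemma red0 (K k : fieldType) (v : K -> rat) (red : K -> k) :
  residue_map v red -> red 0 = 0.
Proof.
move=> rm; have i0 : vint v 0 by rewrite /vint eqxx.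
have := red_D rm i0 i0; rewrite addr0 => /eqP.
by rewrite -subr_eq subrr eq_sym => /eqP.
Qed.

Lemma redN (K k : fieldType) (v : K -> rat) (red : K -> k) x :
  valuation v -> residue_map v red -> vint v x -> red (- x) = - red x.
Proof.
move=> Hv' rm ix; have iN : vint v (- x) by have := vgeN Hv' 0 x; rewrite /vge -!/(vint _ _) => ->.
apply/eqP; rewrite -addr_eq0; rewrite -(red_D rm) // addNr.
by rewrite (red0 rm).
Qed.

Lemma pcharFq : p \in [pchar (Fq S)].
Proof.
have rm := redL_residue S.
have natR n : redL n%:R = n%:R.
  elim: n => [|n IH]; first by rewrite (red0 rm).
  rewrite -!natr1 (red_D rm) ?IH ?(red_1 rm) //.
  - exact: (vge0_nat Hv n).
  - by have := vge0_nat Hv 1.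
rewrite inE p_prime -natR (red_ker rm); last by have := vge0_nat Hv p.
by rewrite /vmax vLp orbT.
Qed.

Lemma redL_nat n : redL n%:R = n%:R.
Proof.
have rm := redL_residue S.
elim: n => [|n IH]; first by rewrite (red0 rm).
rewrite -!natr1 (red_D rm) ?IH ?(red_1 rm) //.
- exact: (vge0_nat Hv n).
- by have := vge0_nat Hv 1.
Qed.

Lemma redL_sum I (s : seq I) (F : I -> L S) : (forall i, vint vL (F i)) ->
  redL (\sum_(i <- s) F i) = \sum_(i <- s) redL (F i).
Proof.
move=> iF; have rm := redL_residue S.
elim: s => [|i s IH]; first by rewrite !big_nil (red0 rm).
rewrite !big_cons (red_D rm) ?IH //; exact: (vge_sum Hv).
Qed.

(** Teichmueller lifts satisfy t^(p^f) = t, so every residue is a root of X^(p^f) - X. *)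
Lemma card_Fq_le : (#|Fq S| <= p ^ f)%N.
Proof.
have p1 := prime_gt1 p_prime.
have f0 : (0 < f)%N.
  rewrite -(L_degree S) lt0n dimv_eq0; apply/eqP => e.
  by have := memvf (1 : L S); rewrite e memv0 oner_eq0.
have hp : (1 < p ^ f)%N by rewrite -{1}(exp1n f) ltn_exp2r.
pose P : {poly Fq S} := 'X^(p ^ f) - 'X.
have sP : size P = (p ^ f).+1.
  by rewrite /P size_polyDl size_polyXn // size_polyN size_polyX.
have Pn0 : P != 0 by rewrite -size_poly_gt0 sP.
have := max_poly_roots Pn0 (_ : all (root P) (enum (Fq S))) (enum_uniq _).
rewrite sP ltnS -cardE; apply.
apply/allP => a _; rewrite rootE /P !hornerE subr_eq0.
have [ia ra ta] := teichP a.
have redX n : vint vL (teich a ^+ n) /\ redL (teich a ^+ n) = a ^+ n.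
  elim: n => [|n [in' IH]]; first by rewrite !expr0 (red_1 (redL_residue S)); split=> //; have := vge0_nat Hv 1.
  rewrite !exprS (red_M (redL_residue S)) // IH ra; split=> //.
  by have := vgeM Hv (c := 0) (d := 0) ia in'; rewrite addr0.
by rewrite -(redX _).2 ta ra.
Qed.

Lemma vL_alg_vge c (x : Qp S) : vge vL c x%:A = vge (@vp _ _ S) c x.
Proof.
rewrite /vge scaler_eq0 oner_eq0 orbF; case: eqVneq => //= x0.
by rewrite vL_extends.
Qed.

(* Successive approximation: digits with respect to lifts of an F_p-basis of
   the residue field converge in Q_p, so the lifts span L over Q_p. *)
Lemma card_Fq_ge : (p ^ f <= #|Fq S|)%N.
Proof.
pose V : vectType 'F_p := pPrimeCharType pcharFq.
pose d := \dim {:V}.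
have cardV : #|Fq S| = (p ^ d)%N.
  rewrite /d; have -> : #|Fq S| = #|pPrimeCharType pcharFq| by [].
  by rewrite card_pprimeChar pprimeChar_dimf.
rewrite cardV leq_exp2l ?prime_gt1 //.
pose b := vbasis {:V}.
have lift_ex (a : Fq S) : exists x, vint vL x /\ redL x = a.
  by have [x] := redL_surj a; exists x.
have [lft lftP] := choice lift_ex.
pose x (i : 'I_d) := lft (tnth b i : Fq S).
have xi i : vge vL 0 (x i) by have [] := lftP (tnth b i : Fq S).
have coordE (a : Fq S) : exists n : 'I_d -> nat,
    a = \sum_i (n i)%:R * (tnth b i : Fq S).
  exists (fun i => nat_of_ord (coord b i (a : V))).
  have := coord_vbasis (memvf (a : V)) => {1}->.
  apply: eq_bigr => i _; rewrite (tnth_nth 0).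
  by rewrite -[LHS]/(((coord b i (a : V)) : nat)%:R * _).
(* One digit: subtract a lift of the residue of y and divide the rest by p. Off the valuation ring a
   default value is taken, so that [choice] yields a total map that can be iterated. *)
have step (y : L S) : exists t : ('I_d -> nat) * L S, vge vL 0 y ->
    vge vL 0 t.2 /\ y = \sum_i (t.1 i)%:R * x i + p%:R * t.2.
  case: (boolP (vge vL 0 y)) => [iy|]; last by exists (fun=> 0%N, 0).
  have [n nE] := coordE (redL y).
  have in' i : vge vL 0 ((n i)%:R * x i).
    by rewrite -[0]addr0; apply: vgeM => //; exact: vge0_nat.
  have is' : vge vL 0 (\sum_i (n i)%:R * x i) by exact: vge_sum.
  have := @vmax_div_p (y - \sum_i (n i)%:R * x i).
  case=> [||z iz e].
  - exact: vgeB.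
  - rewrite (red_D (redL_residue S)) //; last by have := vgeN Hv 0 (\sum_i (n i)%:R * x i); rewrite /vge /vint => ->.
    rewrite (redN Hv (redL_residue S)) // redL_sum // {1}nE; apply/eqP; rewrite subr_eq0.
    apply/eqP; apply: eq_bigr => i _.
    rewrite (red_M (redL_residue S)) ?redL_nat //; last by have := xi i.
      by rewrite /x (lftP _).2.
    exact: vge0_nat.
  - by exists (n, z) => _; split=> //=; rewrite -e; ring.
have [stp stpP] := choice step.
pose it (y : L S) k := iter k (fun z => (stp z).2) y.
have it_int y k : vge vL 0 y -> vge vL 0 (it y k).
  by move=> iy; elim: k => //= k IH; have [] := stpP _ IH.
pose sq (y : L S) (i : 'I_d) K : Qp S := \sum_(k < K) ((stp (it y k)).1 i)%:R * p%:R ^+ k.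
have sqP y K : vge vL 0 y ->
    y = \sum_i (sq y i K)%:A * x i + p%:R ^+ K * it y K.
  move=> iy; elim: K => [|K IH].
    rewrite big1 ?add0r ?expr0 ?mul1r // => i _.
    by rewrite /sq big_ord0 scale0r mul0r.
  rewrite {1}IH; have [_ e] := stpP _ (it_int y K iy).
  rewrite {1}e mulrDr addrA exprSr -mulrA; congr (_ + _).
  rewrite mulr_sumr -big_split /=; apply: eq_bigr => i _.
  rewrite /sq big_ord_recr /= scalerDl mulrDl; congr (_ + _).
  by rewrite -[in RHS]natrX -[in RHS]natrM natA natrM natrX; ring.
have vpV := padic_val (QpP S); have [pp0 vp1] := padic_p (QpP S).
have geXp K (z : nat) : vge (@vp _ _ S) K%:R (p%:R ^+ K * z%:R).
  rewrite -[K%:R]addr0; apply: vgeM => //; last exact: vge0_nat.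
  by rewrite vge_val ?expf_neq0 // vltX // vp1.
have cauchy y i : exists l, forall N, exists M, forall n, (M <= n)%N ->
    vclose (@vp _ _ S) N (sq y i n) l.
  apply: (padic_complete (QpP S)) => N; exists N.
  have tl n : (N <= n)%N -> vge (@vp _ _ S) N%:R (sq y i n - sq y i N).
    move=> Nn; rewrite -(subnKC Nn) /sq big_split_ord /= [_ + _ - _]addrAC subrr add0r.
    apply: vge_sum => // k; rewrite exprD mulrCA mulrC -natrX -natrM mulrC.
    exact: geXp.
  move=> m n Nm Nn; rewrite vclose_vge.
  have -> : sq y i m - sq y i n = (sq y i m - sq y i N) - (sq y i n - sq y i N) by ring.
  by apply: vgeB => //; exact: tl.
have spn y : vge vL 0 y -> exists l : 'I_d -> Qp S, y = \sum_i (l i) *: x i.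
  move=> iy; have [l lP] := choice (cauchy y); exists l.
  apply/eqP; rewrite -subr_eq0; apply/eqP; apply: (@vge_eq0 _ vL) => N.
  have [M MP] : exists M, forall i n, (M <= n)%N -> vclose (@vp _ _ S) N (sq y i n) (l i).
    have [M MP] := choice (fun i => lP i N).
    exists (\max_i M i)%N => i n Mn; apply: MP.
    by apply: leq_trans Mn; apply: leq_bigmax.
  pose K := maxn M N.
  rewrite {1}(sqP y K iy) addrAC -sumrB; apply: vgeD => //.
    apply: vge_sum => // i; rewrite -[l i *: _]mulr_algl -mulrBl -scalerBl -[N%:R]addr0.
    apply: vgeM => //; rewrite vL_alg_vge -vclose_vge; apply: MP.
    by rewrite leq_max leqnn.
  apply: (@vgeW _ _ _ K%:R); first by rewrite ler_nat leq_max leqnn orbT.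
  rewrite -[K%:R]addr0; apply: vgeM => //; last exact: it_int.
  by rewrite vge_val ?expf_neq0 ?pL0 // vltX ?pL0 // vLp.
have full : ({:L S} <= <<[seq x i | i <- enum 'I_d]>>)%VS.
  apply/subvP => y _.
  have [->|y0] := eqVneq y 0; first exact: mem0v.
  have [N hN] : exists N : nat, - vL y <= N%:R.
    exists (Num.bound `|vL y|); have := archi_boundP (normr_ge0 (vL y)).
    by have := ler_norm (- vL y); rewrite normrN; lra.
  have : vge vL 0 (p%:R ^+ N * y).
    by rewrite vge_val ?mulf_neq0 ?expf_neq0 ?pL0 // vltM ?expf_neq0 ?pL0 // vltX ?pL0 // vLp; lra.
  move=> /spn[l e].
  have -> : y = (p%:R ^- N : Qp S) *: \sum_i l i *: x i.
    rewrite -e -[X in _ *: (X * _)]natrX -natA mulr_algl scalerA natrX mulVf ?scale1r //.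
    by rewrite expf_neq0.
  apply: memvZ; apply: memv_suml => i _; apply: memvZ; apply: memv_span.
  by apply/mapP; exists i; rewrite ?mem_enum.
have := dimvS full; rewrite (L_degree S) => h; apply: (leq_trans h).
by apply: leq_trans (dim_span _) _; rewrite size_map size_enum_ord.
Qed.

Lemma card_Fq : #|Fq S| = (p ^ f)%N.
Proof. by apply/eqP; rewrite eqn_leq card_Fq_le card_Fq_ge. Qed.

End FieldFacts.

(** * The valuation ring of E, its embedding into E and its reduction *)

Section ValuationRing.
Variables (p f : nat) (S : setting p f).

Definition vintE : {pred E S} := fun x => vint (vE (s := S)) x.

Lemma vintE_subring : subring_closed vintE.
Proof.
have Hv := @vE_valuation _ _ S; split=> [|x y|x y] /=; rewrite !unfold_in.
- by have := vge0_nat Hv 1.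
- exact: (@vgeB _ _ Hv 0).
- by move=> ix iy; have := vgeM Hv (c := 0) (d := 0) ix iy; rewrite addr0.
Qed.

HB.instance Definition _ := GRing.isSubringClosed.Build (E S) vintE vintE_subring.

(** [redE] respects sums and products only on integers. Over this ring the inclusion in E and the
    reduction are both ring morphisms, and so are [emb] and [red] on polynomials. *)
Record OE := MkOE { Oval : E S; OvalP : Oval \in vintE }.
HB.instance Definition _ := [isSub for Oval].
HB.instance Definition _ := [Choice of OE by <:].
HB.instance Definition _ := [SubChoice_isSubComNzRing of OE by <:].

Definition redO (x : OE) : Fpbar S := redE (val x).

Lemma redO_zmod : zmod_morphism redO.
Proof.
move=> x y; rewrite /redO rmorphB /=.
have rm := redE_residue S; have Hv := @vE_valuation _ _ S.
rewrite (red_D rm) ?(redN Hv rm) //; try exact: OvalP.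
by have := OvalP y; rewrite -rpredN.
Qed.
HB.instance Definition _ := GRing.isZmodMorphism.Build OE (Fpbar S) redO redO_zmod.

Lemma redO_monoid : monoid_morphism redO.
Proof.
have rm := redE_residue S; split; first by rewrite /redO /= (red_1 rm).
by move=> x y; rewrite /redO rmorphM /= (red_M rm) //; exact: OvalP.
Qed.
HB.instance Definition _ := GRing.isMonoidMorphism.Build OE (Fpbar S) redO redO_monoid.

(** Off the integers of L the value is the default 0, so statements about it assume [vint]. *)
Definition toO (x : L S) : OE := insubd (0 : OE) (x%:A : E S).

Lemma vE_alg (x : L S) : vint (vE (s := S)) x%:A = vint (vL (s := S)) x.
Proof.
rewrite /vint scaler_eq0 oner_eq0 orbF; case: eqVneq => //= x0.
by rewrite vE_extends.
Qed.

Lemma toOK x : vint (vL (s := S)) x -> val (toO x) = x%:A.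
Proof. by move=> ix; rewrite insubdK //; rewrite -[_ \in _]/(vint (vE (s := S)) _) vE_alg. Qed.

Lemma redO_toO x : vint (vL (s := S)) x -> redO (toO x) = Defs.iota S (redL x).
Proof. by move=> ix; rewrite /redO toOK // iotaP. Qed.

Definition emb : {mpoly OE[f + f]} -> {mpoly (E S)[f + f]} := map_mpoly (val : OE -> E S).
Definition red : {mpoly OE[f + f]} -> {mpoly (Fpbar S)[f + f]} := map_mpoly redO.
HB.instance Definition _ := GRing.RMorphism.on emb.
HB.instance Definition _ := GRing.RMorphism.on red.

Lemma embZ c P : emb (c *: P) = val c *: emb P.
Proof. exact: map_mpolyZ. Qed.

Lemma redZ c P : red (c *: P) = redO c *: red P.
Proof. exact: map_mpolyZ. Qed.

Lemma embB P Q : emb (P - Q) = emb P - emb Q. Proof. exact: rmorphB. Qed.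
Lemma redB P Q : red (P - Q) = red P - red Q. Proof. exact: rmorphB. Qed.
Lemma embD P Q : emb (P + Q) = emb P + emb Q. Proof. exact: rmorphD. Qed.
Lemma redD P Q : red (P + Q) = red P + red Q. Proof. exact: rmorphD. Qed.
Lemma redM P Q : red (P * Q) = red P * red Q. Proof. exact: rmorphM. Qed.
Lemma emb0 : emb 0 = 0. Proof. exact: rmorph0. Qed.
Lemma red0p : red 0 = 0. Proof. exact: rmorph0. Qed.
Lemma emb_sum I (s : seq I) (Pr : pred I) F :
  emb (\sum_(i <- s | Pr i) F i) = \sum_(i <- s | Pr i) emb (F i).
Proof. exact: rmorph_sum. Qed.
Lemma red_sum I (s : seq I) (Pr : pred I) F :
  red (\sum_(i <- s | Pr i) F i) = \sum_(i <- s | Pr i) red (F i).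
Proof. exact: rmorph_sum. Qed.

Lemma emb_pX i : emb (pX i) = pX i. Proof. exact: map_mpolyX. Qed.
Lemma emb_pY i : emb (pY i) = pY i. Proof. exact: map_mpolyX. Qed.
Lemma red_mono a b : red (mono OE a b) = mono (Fpbar S) a b.
Proof. exact: map_mono. Qed.
Lemma emb_psubst x y P : emb (psubst x y P) = psubst (emb \o x) (emb \o y) (emb P).
Proof. exact: map_psubst. Qed.
Lemma emb_pact g P :
  emb (pact g P) = pact (fun i => map_mx (val : OE -> E S) (g i)) (emb P).
Proof. exact: map_pact. Qed.
Lemma red_pact g P : red (pact g P) = pact (fun i => map_mx redO (g i)) (red P).
Proof. exact: map_pact. Qed.

Lemma emb_Vpoly r P : Vpoly r P -> Vpoly r (emb P).
Proof. by move=> rP; exact: map_Vpoly. Qed.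
Lemma red_Vpoly r P : Vpoly r P -> Vpoly r (red P).
Proof. by move=> rP; exact: map_Vpoly. Qed.

(** As [redE] is no morphism on E, the left side is only a formal sum over the support of [emb P].
    This support is that of P because [val] is injective. *)
Lemma redE_emb P : map_mpoly (@redE _ _ S) (emb P) = red P.
Proof.
rewrite /map_mpoly /mmap.
rewrite (perm_big _ (msupp_map_mpoly (f := val : {rmorphism OE -> E S}) P val_inj)).
by apply: eq_bigr => m _; rewrite /= /emb mcoeff_map_mpoly.
Qed.

Lemma VOE_emb (r : 'I_f -> nat) P : VOE r P <-> exists2 P', Vpoly r P' & P = emb P'.
Proof.
split=> [[rP iP]|[P' rP' ->]]; last first.
  split; first exact: map_Vpoly.
  by move=> m; rewrite mcoeff_map_mpoly; exact: OvalP.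
exists (\sum_(m <- msupp P) insubd (0 : OE) (P@_m : E S) *: 'X_[m]).
  rewrite big_seq; apply: Vpoly_sum => m mP; apply: VpolyZ.
  by move=> m'; rewrite msuppX mem_seq1 => /eqP ->; exact: rP.
rewrite rmorph_sum {1}(mpolyE P); apply: eq_bigr => m _.
by rewrite /= embZ /emb map_mpolyX insubdK //; exact: iP.
Qed.

End ValuationRing.

(** * Two-by-two matrices and the groups K and KZ *)

Section Matrices.
Variables (p f : nat) (S : setting p f).
Hypotheses (p_prime : prime p).
Local Notation L := (L S).
Local Notation G := ('M[L]_2).
Local Notation vL := (vL (s := S)).
Local Notation redL := (redL (s := S)).
Let Hv : valuation vL := @vL_valuation _ _ S.
Let rm := redL_residue S.

Lemma ord2P (i : 'I_2) : i = ord0 \/ i = ord_max.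
Proof. by case: i => [[|[|//]] h]; [left|right]; exact/val_inj. Qed.

Lemma det2 (R : comNzRingType) (A : 'M[R]_2) :
  \det A = A ord0 ord0 * A ord_max ord_max - A ord0 ord_max * A ord_max ord0.
Proof.
rewrite (expand_det_row _ ord0) !big_ord_recl big_ord0 /cofactor !det_mx11 !mxE /=.
have e1 : lift ord0 ord0 = ord_max :> 'I_2 by exact/val_inj.
have e2 : lift ord_max ord0 = ord0 :> 'I_2 by exact/val_inj.
by rewrite !e1 !e2 /= !addn0 add0n expr0 expr1; ring.
Qed.

Lemma mulmx2 (R : comNzRingType) (A B : 'M[R]_2) i j :
  (A *m B) i j = A i ord0 * B ord0 j + A i ord_max * B ord_max j.
Proof.
rewrite mxE !big_ord_recl big_ord0 addr0.
by have -> : lift ord0 ord0 = ord_max :> 'I_2 by exact/val_inj.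
Qed.

Lemma mx22E (R : Type) (a b c d : R) :
  (mx22 a b c d ord0 ord0 = a) * (mx22 a b c d ord0 ord_max = b) *
  (mx22 a b c d ord_max ord0 = c) * (mx22 a b c d ord_max ord_max = d).
Proof. by rewrite !mxE. Qed.

Lemma mx2P (R : Type) (A B : 'M[R]_2) :
  A ord0 ord0 = B ord0 ord0 -> A ord0 ord_max = B ord0 ord_max ->
  A ord_max ord0 = B ord_max ord0 -> A ord_max ord_max = B ord_max ord_max -> A = B.
Proof.
by move=> *; apply/matrixP => i j; case: (ord2P i) => ->; case: (ord2P j) => ->.
Qed.

Lemma mx22_eta (R : Type) (A : 'M[R]_2) :
  A = mx22 (A ord0 ord0) (A ord0 ord_max) (A ord_max ord0) (A ord_max ord_max).
Proof. by apply: mx2P; rewrite !mx22E. Qed.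

Lemma mul_mx22 (R : comNzRingType) (a b c d a' b' c' d' : R) :
  mx22 a b c d *m mx22 a' b' c' d' =
  mx22 (a * a' + b * c') (a * b' + b * d') (c * a' + d * c') (c * b' + d * d').
Proof. by apply: mx2P; rewrite mulmx2 !mx22E. Qed.

Lemma det_mx22 (R : comNzRingType) (a b c d : R) : \det (mx22 a b c d) = a * d - b * c.
Proof. by rewrite det2 !mx22E. Qed.

Lemma mx22_1 (R : pzRingType) : mx22 1 0 0 1 = 1%:M :> 'M[R]_2.
Proof. by apply: mx2P; rewrite mx22E !mxE. Qed.

Lemma vintD x y : vint vL x -> vint vL y -> vint vL (x + y).
Proof. exact: (@vgeD _ _ Hv 0). Qed.
Lemma vintN x : vint vL x -> vint vL (- x).
Proof. by rewrite -[vint _ (- x)]/(vge vL 0 (- x)) vgeN. Qed.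
Lemma vintM x y : vint vL x -> vint vL y -> vint vL (x * y).
Proof. by move=> ix iy; have := vgeM Hv (c := 0) (d := 0) ix iy; rewrite addr0. Qed.
Lemma vint_nat n : vint vL n%:R. Proof. exact: vge0_nat. Qed.
Lemma vint0 : vint vL 0. Proof. exact: vge0. Qed.
Lemma vint1 : vint vL 1. Proof. exact: (vint_nat 1). Qed.
Lemma vint_iter n x : vint vL x -> vint vL (iter n (sigma S) x).
Proof. by move=> ix; elim: n => //= n IH; have [] := sigmaP IH. Qed.

Lemma redL_iter n x : vint vL x -> redL (iter n (sigma S) x) = redL x ^+ (p ^ n).
Proof.
move=> ix; elim: n => [|n IH] /=; first by rewrite expn0 expr1.
have [_ ->] := sigmaP (vint_iter n ix).
by rewrite IH -exprM expnSr.
Qed.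

Implicit Types (x y g : G).

Lemma inK_unit x : inK x -> x \in unitmx.
Proof. by case=> _ h _; rewrite unitmxE unitfE. Qed.

Lemma redL_mul (x y : G) : (forall i j, vint vL (x i j)) -> (forall i j, vint vL (y i j)) ->
  map_mx redL (x *m y) = map_mx redL x *m map_mx redL y.
Proof.
move=> ix iy; apply/matrixP => i j; rewrite mxE !mulmx2 !mxE.
by rewrite (red_D rm) ?(red_M rm) ?vintM.
Qed.

Lemma redL_det (x : G) : (forall i j, vint vL (x i j)) ->
  \det (map_mx redL x) = redL (\det x).
Proof.
move=> ix; rewrite !det2 !mxE (red_D rm) ?vintN ?vintM //.
by rewrite (redN Hv rm) ?vintM // !(red_M rm).
Qed.

Lemma inK_red x : inK x -> map_mx redL x \in unitmx.
Proof.
case=> ix x0 vx; rewrite unitmxE unitfE redL_det // (red_ker rm).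
  by rewrite /vmax (negbTE x0) vx ltxx.
by rewrite /vint vx lexx orbT.
Qed.

Lemma inK_mul x y : inK x -> inK y -> inK (x *m y).
Proof.
case=> ix x0 vx [iy y0 vy]; split.
- by move=> i j; rewrite mulmx2 vintD ?vintM.
- by rewrite det_mulmx mulf_neq0.
- by rewrite det_mulmx vltM // vx vy addr0.
Qed.

Lemma inK_scale z x : z != 0 -> vL z = 0 -> inK x -> inK (z *: x).
Proof.
move=> z0 vz [ix x0 vx]; split.
- by move=> i j; rewrite mxE vintM // /vint vz lexx orbT.
- by rewrite detZ mulf_neq0 ?expf_neq0.
- by rewrite detZ vltM ?expf_neq0 // vltX // vz vx mul0rn.
Qed.

Lemma inK1 : inK (1%:M : G).
Proof.
split=> [i j||]; rewrite ?det1 ?oner_neq0 ?vlt1 //.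
by rewrite mxE; exact: vint_nat.
Qed.

Lemma inK_inv x : inK x -> exists y, [/\ inK y, x *m y = 1%:M & y *m x = 1%:M].
Proof.
case=> ix x0 vx.
pose a := x ord0 ord0; pose b := x ord0 ord_max.
pose c := x ord_max ord0; pose d := x ord_max ord_max.
have dE : \det x = a * d - b * c by rewrite det2.
pose y := (\det x)^-1 *: mx22 d (- b) (- c) a.
have xy : x *m y = 1%:M.
  rewrite /y -scalemxAr {2}(mx22_eta x) mul_mx22 -/a -/b -/c -/d.
  rewrite -mx22_1; apply: mx2P; rewrite mxE !mx22E; apply: (mulfI x0);
    rewrite mulVKf // dE; ring.
exists y; split=> //; last by rewrite (mulmx1C xy).
have : \det x * \det y = 1 by rewrite -det_mulmx xy det1.
move=> e; have y0 : \det y != 0 by apply: contra_eq_neq e => ->; rewrite mulr0 eq_sym oner_neq0.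
split=> //; last by have := vltM Hv x0 y0; rewrite e vlt1 // vx add0r.
move=> i j; rewrite mxE vintM //; first by rewrite /vint vltV // vx oppr0 lexx orbT.
by case: (ord2P i) => ->; case: (ord2P j) => ->; rewrite mx22E ?vintN //; exact: ix.
Qed.

Lemma inKZ_det g : inKZ g -> \det g != 0.
Proof. by case=> z [x [z0 [_ x0 _] ->]]; rewrite detZ mulf_neq0 ?expf_neq0. Qed.

Lemma inKZ_unit g : inKZ g -> g \in unitmx.
Proof. by move=> /inKZ_det; rewrite unitmxE unitfE. Qed.

Lemma inK_KZ x : inK x -> inKZ x.
Proof. by move=> Kx; exists 1, x; rewrite oner_neq0 scale1r. Qed.

Lemma inKZ_mul x y : inKZ x -> inKZ y -> inKZ (x *m y).
Proof.
case=> z [k [z0 Kk ->]] [z' [k' [z0' Kk' ->]]]; exists (z * z'), (k *m k'); split.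
- exact: mulf_neq0.
- exact: inK_mul.
- by rewrite -scalemxAl -scalemxAr scalerA.
Qed.

Lemma inKZ_invl x y : inKZ x -> inKZ (x *m y) -> inKZ y.
Proof.
case=> z [k [z0 Kk ->]]; have [k' [Kk' kk' k'k]] := inK_inv Kk.
move=> h; have : inKZ ((z^-1 *: k') *m (z *: k *m y)).
  by apply: inKZ_mul => //; exists z^-1, k'; rewrite invr_eq0.
rewrite -!scalemxAl -scalemxAr scalerA mulVf // scale1r.
by rewrite mulmxA k'k mul1mx.
Qed.

Lemma inKZ_invr x y : inKZ y -> inKZ (x *m y) -> inKZ x.
Proof.
case=> z [k [z0 Kk ->]]; have [k' [Kk' kk' k'k]] := inK_inv Kk.
move=> h; have : inKZ ((x *m (z *: k)) *m (z^-1 *: k')).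
  by apply: inKZ_mul => //; exists z^-1, k'; rewrite invr_eq0.
rewrite -!scalemxAr -!scalemxAl scalerA mulVf // scale1r.
by rewrite -mulmxA kk' mulmx1.
Qed.

Lemma inKZ_p : inKZ (p%:R%:M : G).
Proof. by exists p%:R, 1%:M; rewrite scalemx1 (pL0 S); split=> //; exact: inK1. Qed.

(** The determinant of z x has value 2 v(z) with v(z) an integer, so the floor is exactly v(z) and
    [Kpart] leaves a scalar of value 0. *)
Lemma Kpart_scale (z : L) (x : G) : z != 0 -> inK x ->
  exists u, [/\ u != 0, vL u = 0 & Kpart (z *: x) = u *: x].
Proof.
move=> z0 [ix x0 vx]; have [n vz] := intrP (vL_int p_prime z0).
have e : Num.floor (vL (\det (z *: x)) / 2%:R) = n.
  rewrite detZ vltM ?expf_neq0 // vltX // vx addr0 vz.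
  by rewrite -[n%:~R *+ 2]mulr_natr mulfK ?pnatr_eq0 // intrKfloor.
exists (p%:R ^ (- n) * z); rewrite mulf_neq0 ?expfz_neq0 ?(pL0 S) //; split=> //.
  by rewrite vltM ?expfz_neq0 ?(pL0 S) // vltXz ?(pL0 S) // (vLp S) vz mulrNz addNr.
by rewrite /Kpart e scalerA.
Qed.

Lemma Kpart_inK g : inKZ g -> inK (Kpart g).
Proof.
case=> z [x [z0 Kx ->]]; have [u [u0 vu ->]] := Kpart_scale z0 Kx.
exact: inK_scale.
Qed.

Lemma KpartE g : exists n : int, Kpart g = p%:R ^ n *: g.
Proof. by eexists. Qed.

Lemma Kpart_Kl x g : inK x -> Kpart (x *m g) = x *m Kpart g.
Proof.
case=> _ x0 vx; rewrite /Kpart -scalemxAr det_mulmx.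
have [g0|g0] := eqVneq (\det g) 0; first by rewrite g0 mulr0.
by rewrite vltM // vx add0r.
Qed.

Lemma Kpart_Kr x g : inK x -> Kpart (g *m x) = Kpart g *m x.
Proof.
case=> _ x0 vx; rewrite /Kpart -scalemxAl det_mulmx.
have [g0|g0] := eqVneq (\det g) 0; first by rewrite g0 mul0r.
by rewrite vltM // vx addr0.
Qed.

Lemma Kpart_p g : \det g != 0 -> Kpart (p%:R *: g) = Kpart g.
Proof.
move=> g0; rewrite /Kpart detZ vltM ?expf_neq0 ?(pL0 S) //.
rewrite vltX ?(pL0 S) // (vLp S) mulrDl mulfV ?pnatr_eq0 //.
have -> : Num.floor (1 + vL (\det g) / 2%:R) = 1 + Num.floor (vL (\det g) / 2%:R).
  by rewrite floorDzr ?rpred1 // (_ : 1 = 1%:~R :> rat) // intrKfloor.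
rewrite scalerA; congr (_ *: _).
by rewrite -[X in _ * X]expr1z -expfzDr ?(pL0 S) //; congr (_ ^ _); ring.
Qed.

End Matrices.

(** * The structure of Q *)

Section Digits.
Variable p : nat.
Hypothesis p_gt1 : (1 < p)%N.
Implicit Types A B : nat -> nat.

Let p_gt0 : (0 < p)%N := ltnW p_gt1.

Lemma digsum_lt A m : (forall j, A j < p)%N ->
  (\sum_(0 <= j < m) A j * p ^ j < p ^ m)%N.
Proof.
move=> Ap; elim: m => [|m IH]; first by rewrite big_geq.
rewrite big_nat_recr //= expnS; have := Ap m; move: IH; set s := \sum_(_ <= _ < _) _.
by move: (p ^ m)%N (A m) => P a; nia.
Qed.

Lemma digsum_split A e m : (e <= m)%N -> exists c,
  (\sum_(0 <= j < m) A j * p ^ j = \sum_(0 <= j < e) A j * p ^ j + c * p ^ e)%N.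
Proof.
move=> em; rewrite (big_cat_nat (leq0n e) em) /=.
exists (\sum_(e <= j < m) A j * p ^ (j - e))%N; congr addn.
rewrite big_distrl /= !big_nat; apply: eq_bigr => j /andP[ej _].
by rewrite -mulnA -expnD subnK.
Qed.

Lemma digsum_mod A e m : (e <= m)%N -> (forall j, A j < p)%N ->
  ((\sum_(0 <= j < m) A j * p ^ j) %% p ^ e = \sum_(0 <= j < e) A j * p ^ j)%N.
Proof.
move=> em Ap; have [c ->] := digsum_split A em.
by rewrite addnC modnMDl modn_small ?digsum_lt.
Qed.

Lemma digsum_digit A e m : (e < m)%N -> (forall j, A j < p)%N ->
  ((\sum_(0 <= j < m) A j * p ^ j) %/ p ^ e %% p = A e)%N.
Proof.
move=> em Ap; have [c ->] := digsum_split A em.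
rewrite big_nat_recr //= expnS mulnA -addnA -mulnDl addnC.
by rewrite divnMDl ?expn_gt0 ?p_gt0 // (divn_small (digsum_lt _ Ap)) addn0
  addnC modnMDl modn_small.
Qed.

Lemma digsum_dig n m :
  (\sum_(0 <= j < m) (n %/ p ^ j %% p) * p ^ j = n %% p ^ m)%N.
Proof.
elim: m => [|m IH]; first by rewrite big_geq // expn0 modn1.
rewrite big_nat_recr //= IH expnSr.
have h1 := ltn_pmod (n %/ p ^ m) p_gt0.
have h2 : (n %% p ^ m < p ^ m)%N by rewrite ltn_pmod // expn_gt0 p_gt0.
have e : n = (n %/ p ^ m %/ p * (p ^ m * p) +
    (n %% p ^ m + n %/ p ^ m %% p * p ^ m))%N.
  rewrite {1}(divn_eq n (p ^ m)) {1}(divn_eq (n %/ p ^ m) p); ring.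
rewrite [in RHS]e modnMDl; symmetry; apply: modn_small.
have h3 : ((n %/ p ^ m %% p).+1 * p ^ m <= p * p ^ m)%N by rewrite leq_mul2r h1 orbT.
by rewrite [X in (_ < X)%N]mulnC; apply: leq_trans h3; rewrite mulSn ltn_add2r.
Qed.

Variable f : nat.
Implicit Types a b : 'I_f -> nat.

Definition val_of a : nat := (\sum_i a i * p ^ i)%N.
Definition dig (n : nat) (i : 'I_f) : nat := ((n %/ p ^ i) %% p)%N.
(** Extending a digit vector by zero turns sums over 'I_f into sums over intervals, which can be cut
    at any position. *)
Definition ext0 a (j : nat) : nat := if insub j is Some i then a i else 0%N.

Lemma ext0E a (i : 'I_f) : ext0 a i = a i.
Proof. by rewrite /ext0 valK. Qed.

Lemma val_ofE a : val_of a = (\sum_(0 <= j < f) ext0 a j * p ^ j)%N.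
Proof. by rewrite big_mkord; apply: eq_bigr => i _; rewrite ext0E. Qed.

Lemma ext0_lt a : (forall i, a i < p)%N -> forall j, (ext0 a j < p)%N.
Proof. by move=> ap j; rewrite /ext0; case: insubP. Qed.

Lemma val_of_lt a : (forall i, a i < p)%N -> (val_of a < p ^ f)%N.
Proof. by move=> ap; rewrite val_ofE digsum_lt //; exact: ext0_lt. Qed.

Lemma dig_lt n i : (dig n i < p)%N.
Proof. exact: ltn_pmod. Qed.

Lemma dig_val_of a i : (forall i, a i < p)%N -> dig (val_of a) i = a i.
Proof.
by move=> ap; rewrite /dig val_ofE digsum_digit ?ext0E //; exact: ext0_lt.
Qed.

Lemma val_of_dig n : (n < p ^ f)%N -> val_of (dig n) = n.
Proof.
move=> nq; rewrite -[RHS](modn_small nq) -digsum_dig big_mkord.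
exact: eq_bigr.
Qed.

Lemma val_of_inj a b : (forall i, a i < p)%N -> (forall i, b i < p)%N ->
  val_of a = val_of b -> a =1 b.
Proof. by move=> ap bp e i; rewrite -(dig_val_of i ap) e dig_val_of. Qed.

(** Reduction modulo p^e keeps the lowest e digits, so it respects the digitwise order. *)
Lemma val_of_mod_le a b e : (e <= f)%N ->
  (forall i, a i < p)%N -> (forall i, b i <= a i)%N ->
  (val_of b %% p ^ e <= val_of a %% p ^ e)%N.
Proof.
move=> ef ap ba; have bp i : (b i < p)%N by exact: leq_ltn_trans (ap i).
rewrite !val_ofE !digsum_mod //; try exact: ext0_lt.
apply: leq_sum => j _; rewrite leq_mul2r; apply/orP; right.
by rewrite /ext0; case: insubP.
Qed.

Lemma val_of_eq0 a : (val_of a == 0)%N = [forall i, a i == 0%N].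
Proof.
rewrite sum_nat_eq0; apply: eq_forallb => i /=.
by rewrite muln_eq0 expn_eq0 (gtn_eqF p_gt0) /= orbF.
Qed.

Lemma val_of_delta (i : 'I_f) c : val_of (fun j => c * (j == i))%N = (c * p ^ i)%N.
Proof.
rewrite /val_of (bigD1 i) //= eqxx muln1 big1 ?addn0 // => j /negbTE ->.
by rewrite muln0 mul0n.
Qed.

Lemma val_of_add a b : val_of (fun i => a i + b i)%N = (val_of a + val_of b)%N.
Proof. by rewrite /val_of -big_split; apply: eq_bigr => i _; rewrite mulnDl. Qed.

Lemma val_of_sub a b : (forall i, b i <= a i)%N ->
  val_of (fun i => a i - b i)%N = (val_of a - val_of b)%N.
Proof.
move=> ba; suff -> : val_of a = (val_of (fun i => a i - b i)%N + val_of b)%N by rewrite addnK.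
by rewrite -val_of_add; apply: eq_bigr => i _; rewrite subnK.
Qed.

End Digits.

(** * Linear maps and actions on quotients *)

Section Quotients.
Variables (K : pzRingType) (V : lmodType K) (A : set V).

Lemma lpi_is_linear : linear (lpi A).
Proof. by move=> c u v; rewrite lpiD lpiZ. Qed.
HB.instance Definition _ := GRing.isLinear.Build K V (lquot A) *:%R (lpi A)
  lpi_is_linear.

Lemma lpi_eq0 v : lpi A v = 0 <-> lspan A v.
Proof. by rewrite -(linear0 (lpi A)) lpiP subr0. Qed.

Lemma lspan_in v : A v -> lspan A v.
Proof.
move=> Av; exists 1%N, (fun=> 1), (fun=> v); split=> //.
by rewrite big_ord1 scale1r.
Qed.

Lemma lspan_min (N : set V) : N 0 -> (forall c u v, N u -> N v -> N (c *: u + v)) ->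
  (A `<=` N)%classic -> (lspan A `<=` N)%classic.
Proof.
move=> N0 ND AN v [n [c [u [Au ->]]]].
by elim/big_rec: _ => // i w _ Nw; apply: ND => //; exact: AN.
Qed.

(** The quotient action is defined through a chosen representative; stability of the span makes the
    choice irrelevant. *)
Lemma lquot_act_pi (T : Type) (act : T -> V -> V) g v : linear (act g) ->
  (forall v, lspan A v -> lspan A (act g v)) ->
  lquot_act (S := A) act g (lpi A v) = lpi A (act g v).
Proof.
move=> lin stab; apply/lpiP.
have -> : act g (lrepr (lpi A v)) - act g v = act g (lrepr (lpi A v) - v).
  have := lin (-1) v (lrepr (lpi A v)); rewrite !scaleN1r => h.
  by rewrite addrC [in RHS]addrC h.
by apply: stab; apply/lpiP; rewrite lreprK.
Qed.

Lemma lquot_act_linear (T : Type) (act : T -> V -> V) g : linear (act g) ->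
  (forall v, lspan A v -> lspan A (act g v)) ->
  linear (lquot_act (S := A) act g).
Proof.
move=> lin stab c x y; rewrite -[x]lreprK -[y]lreprK -linearP.
by rewrite !lquot_act_pi // lin linearP.
Qed.

End Quotients.

(** * Character sums over F_q and functionals on Q *)

Section Setup.
Variables (p f : nat) (S : setting p f) (r : 'I_f -> nat) (a0 : nat).

Record weight_data : Prop := WeightData {
  wd_prime : prime p;
  wd_gt2 : (2 < p)%N;
  wd_f : (1 < f)%N;
  wd_r : forall i, (p ^ f <= r i)%N;
  wd_a0 : (1 <= a0)%N;
  wd_a0_le : (a0 <= p.-1)%N;
  wd_mod : (\sum_(i < f) r i * p ^ i = a0 %[mod (p ^ f).-1])%N
}.

Hypothesis H : weight_data.
Local Notation q := (p ^ f)%N.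
Local Notation k := (Fpbar S).
Local Notation io := (Defs.iota S).
Let p_prime := wd_prime H.
Let p_gt1 : (1 < p)%N := prime_gt1 p_prime.
Let f_gt1 := wd_f H.
Let f_gt0 : (0 < f)%N := ltnW f_gt1.
Let r_ge := wd_r H.

Lemma q_gt : (p < q)%N.
Proof. by rewrite -{1}(expn1 p) ltn_exp2l. Qed.

Lemma p2_le_q : (p * p <= q)%N.
Proof. by rewrite mulnn leq_exp2l. Qed.

Lemma char_k : p \in [pchar k]. Proof. exact: Fpbar_char. Qed.

Lemma p_eq0 : p%:R = 0 :> k. Proof. exact: (pcharf0 char_k). Qed.

Lemma card_FqE : #|Fq S| = q. Proof. exact: card_Fq. Qed.

Lemma expFq (x : Fq S) : x ^+ q = x.
Proof. by rewrite -card_FqE expf_card. Qed.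

Lemma expFq1 (x : Fq S) : x != 0 -> x ^+ q.-1 = 1.
Proof.
move=> x0; apply: (mulfI x0); rewrite -exprS prednK ?expFq ?mulr1 //.
by rewrite expn_gt0 prime_gt0.
Qed.

(** Positivity of both exponents covers x = 0. *)
Lemma exp_modq (x : Fq S) m n : (0 < m)%N -> (0 < n)%N -> m = n %[mod q.-1] ->
  x ^+ m = x ^+ n.
Proof.
have [-> m0 n0 _|x0 _ _] := eqVneq x 0; first by rewrite !expr0n !gtn_eqF.
have red n' : x ^+ n' = x ^+ (n' %% q.-1).
  by rewrite {1}(divn_eq n' q.-1) exprD mulnC exprM expFq1 // expr1n mul1r.
by move=> e; rewrite red e -red.
Qed.

Lemma frob_k (x y : k) i : (x + y) ^+ (p ^ i) = x ^+ (p ^ i) + y ^+ (p ^ i).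
Proof. by rewrite exprDn_pchar // pnatX pnatE ?char_k. Qed.

Lemma frobB_k (x y : k) i : (x - y) ^+ (p ^ i) = x ^+ (p ^ i) - y ^+ (p ^ i).
Proof.
rewrite frob_k; congr (_ + _); rewrite -mulN1r exprMn -[in LHS]signr_odd oddX.
rewrite (_ : odd p) ?orbT ?expr1 ?mulN1r //.
by case: (boolP (odd p)) => // /(prime_oddPn p_prime) e; have := wd_gt2 H; rewrite e.
Qed.

(** Otherwise all q - 1 nonzero elements would be roots of X^m' - 1, where m' is the remainder of m
    and 0 < m' < q - 1. *)
Lemma exists_expn_neq1 m : ~~ (q.-1 %| m)%N -> exists2 a : Fq S, a != 0 & a ^+ m != 1.
Proof.
move=> qm; case: (pickP (fun a : Fq S => (a != 0) && (a ^+ m != 1))) => [a /andP[]|h].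
  by exists a.
exfalso; set m' := (m %% q.-1)%N.
have q1 : (0 < q.-1)%N by have := q_gt; lia.
have m'0 : (0 < m')%N by rewrite lt0n.
have m'q : (m' < q.-1)%N by rewrite ltn_pmod.
have hP : all (root ('X^m' - 1 : {poly Fq S})) (enum [pred x : Fq S | x != 0]).
  apply/allP => a; rewrite mem_enum inE => a0'; rewrite rootE !hornerE.
  have := h a; rewrite a0' /= => /negbFE/eqP; rewrite {1}(divn_eq m q.-1).
  by rewrite exprD mulnC exprM expFq1 // expr1n mul1r => ->; rewrite subrr.
have := max_poly_roots (monic_neq0 (monicXnsubC 1 m'0)) hP (enum_uniq _).
rewrite size_XnsubC // -cardE.
have := cardC1 (0 : Fq S); rewrite card_FqE => e.
by rewrite (eq_card (B := predC1 (0 : Fq S))) // e ltnS leqNgt m'q.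
Qed.

(** Orthogonality: multiplying the variable by some a with a^m different from 1 rescales the sum by
    a^m without changing it. For m = 0 the convention 0^0 = 1 makes the sum q = 0 instead of -1. *)
Lemma psum m : \sum_(x : Fq S) io x ^+ m =
  if (0 < m)%N && (q.-1 %| m)%N then -1 else 0 :> k.
Proof.
have q1 : (0 < q.-1)%N by have := q_gt; lia.
have q0 : q%:R = 0 :> k by rewrite natrX p_eq0 expr0n gtn_eqF.
case: (posnP m) => [->|m0] /=.
  by rewrite (eq_bigr (fun=> 1)) // sumr_const card_FqE.
case: ifPn => [qm|/exists_expn_neq1[a a0' am]].
  rewrite (bigD1 0) //= rmorph0 expr0n gtn_eqF // add0r.
  rewrite (eq_bigr (fun=> 1)) => [|x x0].
    rewrite sumr_const (eq_card (B := predC1 (0 : Fq S))) // cardC1 card_FqE.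
    rewrite -[LHS](addrK 1) natr1 prednK ?q0 ?sub0r //; lia.
  by have [c ->] := dvdnP qm; rewrite mulnC exprM -rmorphXn expFq1 // rmorph1 expr1n.
set s := \sum__ _; have : io a ^+ m * s = s.
  rewrite {2}/s (reindex_inj (mulfI a0')) mulr_sumr; apply: eq_bigr => x _.
  by rewrite rmorphM exprMn.
move/eqP; rewrite -subr_eq0 -{2}[s]mul1r -mulrBl mulf_eq0 => /orP[|/eqP //].
by rewrite subr_eq0 -rmorphXn fmorph_eq1 (negbTE am).
Qed.

Local Notation val_of := (@val_of p f).
Local Notation mono := (mono k).

(** The Frobenius-twisted point attached to (x, y). At such points X^a Y^b becomes x^(val a) y^(val
    b); for coordinates in F_q the action of g becomes a linear substitution in (x, y), and every
    theta_i vanishes. *)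
Definition evpt (x y : k) (j : 'I_(f + f)) : k :=
  match fintype.split j with
  | inl i => x ^+ (p ^ i) | inr i => y ^+ (p ^ i) end.
Definition ev (x y : k) (P : {mpoly k[f + f]}) : k := P.@[evpt x y].
HB.instance Definition _ x y := GRing.RMorphism.copy (ev x y) (meval (evpt x y)).

Lemma evZ x y c P : ev x y (c *: P) = c * ev x y P.
Proof. exact: mevalZ. Qed.

Lemma ev_pX x y i : ev x y (pX i) = x ^+ (p ^ i).
Proof. by rewrite /ev /pX mevalXU /evpt -/(unsplit (inl i)) unsplitK. Qed.

Lemma ev_pY x y i : ev x y (pY i) = y ^+ (p ^ i).
Proof. by rewrite /ev /pY mevalXU /evpt -/(unsplit (inr i)) unsplitK. Qed.

Lemma ev_mono x y a b : ev x y (mono a b) = x ^+ val_of a * y ^+ val_of b.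
Proof.
rewrite rmorph_prod /val_of !expr_sum -big_split; apply: eq_bigr => i _ /=.
by rewrite rmorphM !rmorphXn /= ev_pX ev_pY -!exprM !(mulnC (p ^ i)%N).
Qed.

Lemma ev_gact (x y : Fq S) (g : 'M[Fq S]_2) P : ev (io x) (io y) (gact g P) =
  ev (io (g ord0 ord0 * x + g ord_max ord0 * y))
     (io (g ord0 ord_max * x + g ord_max ord_max * y)) P.
Proof.
pose F1 : {rmorphism _ -> _} := ev (io x) (io y) \o gact g.
rewrite -[LHS]/(F1 P).
apply: mpoly_rmorph_ext => [c|] /=.
  by rewrite /gact /pact psubstC /ev !mevalC.
by apply: ord_split_ind => i; rewrite -?/(pX i) -?/(pY i) /gact /pact
  ?psubstX ?psubstY rmorphD /= !evZ !ev_pX !ev_pY !mxE rmorphD !rmorphM frob_k !exprMn.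
Qed.

(* The coefficient of P(x, 1), as a function of x in F_q, at x^n for
   1 <= n < q, corrected at n = a0 by the value at infinity so that it kills Xr. *)
Definition ell (n : nat) (P : {mpoly k[f + f]}) : k :=
  - (\sum_(x : Fq S) io x ^+ (q.-1 - n) * ev (io x) 1 P)
  - (n == a0)%:R * ev 1 0 P.

Lemma ell_is_linear n : scalar (ell n).
Proof.
move=> c P Q; rewrite /ell !rmorphD /= !evZ.
rewrite (eq_bigr (fun x => c * (io x ^+ (q.-1 - n) * ev (io x) 1 P) +
   io x ^+ (q.-1 - n) * ev (io x) 1 Q)) => [|x _]; last by rewrite rmorphD /= evZ; ring.
by rewrite big_split -mulr_sumr /=; ring.
Qed.
HB.instance Definition _ n := GRing.isLinear.Build k {mpoly k[f + f]} k^o *:%R (ell n)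
  (ell_is_linear n).

Lemma a0_lt_p : (a0 < p)%N. Proof. by have := wd_a0_le H; lia. Qed.
Lemma a0_lt_q1 : (a0 < q.-1)%N. Proof. by have := a0_lt_p; have := q_gt; lia. Qed.

Lemma val_r_mod : val_of r = a0 %[mod q.-1]. Proof. exact: wd_mod H. Qed.

Lemma val_r_gt0 : (0 < val_of r)%N.
Proof.
rewrite /val_of (bigD1 (Ordinal f_gt0)) //= expn0 muln1.
by have := r_ge (Ordinal f_gt0); have := q_gt; lia.
Qed.

Lemma val_r_ge : (q <= val_of r)%N.
Proof.
rewrite /val_of (bigD1 (Ordinal f_gt0)) //= expn0 muln1.
by have := r_ge (Ordinal f_gt0); lia.
Qed.

Lemma dvd_mod m n : (n <= q.-1)%N -> (q.-1 %| q.-1 - n + m)%N = (m == n %[mod q.-1]).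
Proof.
move=> nq; rewrite -(eqn_modDl (q.-1 - n)) subnK // modnn.
by rewrite /dvdn.
Qed.

Lemma modq_eq m n : (0 < m <= q.-1)%N -> (0 < n <= q.-1)%N ->
  (m == n %[mod q.-1]) = (m == n).
Proof.
move=> /andP[m0 mq] /andP[n0 nq]; apply/idP/idP => [|/eqP -> //].
have [->|mq'] := eqVneq m q.-1; have [->|nq'] := eqVneq n q.-1; rewrite ?modnn ?eqxx //;
  rewrite ?(modn_small (m := m)) ?(modn_small (m := n)); lia.
Qed.

Lemma ell_mono n a b : (0 < n < q)%N -> (forall i, a i + b i = r i)%N ->
  ell n (mono a b) =
  ((0 < val_of a) && (0 < val_of b) && (val_of a == n %[mod q.-1]))%N%:R.
Proof.
move=> /andP[n0 nq] abr; rewrite /ell ev_mono expr1n mul1r.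
rewrite (eq_bigr (fun x => io x ^+ (q.-1 - n + val_of a))) => [|x _]; last first.
  by rewrite ev_mono expr1n mulr1 exprD.
have nq1 : (n <= q.-1)%N by lia.
rewrite psum dvd_mod // expr0n.
have rE : (val_of a + val_of b = val_of r)%N.
  by rewrite -val_of_add; apply: eq_bigr => i _; rewrite abr.
have a0q := a0_lt_q1; have a01 := wd_a0 H.
have r0 := val_r_gt0.
case: (posnP (val_of a)) => [va|va] /=.
  rewrite va addn0 mod0n (_ : val_of b == 0%N = false); last by apply/eqP; lia.
  rewrite /= mulr0n mulr0 subr0.
  (* For n = q - 1, which is congruent to val a = 0, the power sum has exponent 0 and equals q =
     0. *)
  have [->|nq'] := eqVneq n q.-1; first by rewrite subnn /= oppr0.
  by rewrite modn_small 1?eq_sym ?(gtn_eqF n0) ?andbF ?oppr0 //; lia.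
rewrite (_ : (0 < q.-1 - n + val_of a)%N) /=; last by lia.
(* When val b = 0 the monomial is X^r; its coefficient at n = a0 is cancelled by the value at
   infinity. *)
case: (posnP (val_of b)) => [vb|vb] /=.
  have -> : (val_of a == n %[mod q.-1]) = (n == a0).
    rewrite (_ : val_of a = val_of r) 1?val_r_mod; last by lia.
    by rewrite modq_eq 1?eq_sym //; lia.
  by rewrite mulr1; case: (n == a0); rewrite /= ?mulr0n ?mulr1n ?opprK ?subrr ?oppr0 ?addr0.
by rewrite mulr0 subr0; case: ifP; rewrite ?opprK ?oppr0.
Qed.

Lemma ord_predE (i : 'I_f) : (ord_pred i : nat) = if (i == 0 :> nat)%N then f.-1 else i.-1.
Proof.
rewrite /=; case: (posnP i) => [->|i0]; first by rewrite add0n modn_small //; lia.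
have -> : (i + f).-1 = (i.-1 + f)%N by lia.
by rewrite modnDr modn_small; have := ltn_ord i; lia.
Qed.

(** At i = 0 the index wraps around, and x^q = x closes the cycle. *)
Lemma frob_pred (x : Fq S) (i : 'I_f) :
  (io x ^+ (p ^ ord_pred i)) ^+ p = io x ^+ (p ^ i).
Proof.
rewrite -exprM -expnSr ord_predE; case: (posnP i) => [->|i0] /=.
  by rewrite prednK // -rmorphXn expFq expn0 expr1.
by rewrite prednK.
Qed.

Lemma ev_theta (x y : Fq S) i : ev (io x) (io y) (theta S i) = 0.
Proof.
rewrite /theta rmorphB !rmorphM !rmorphXn /= !ev_pX !ev_pY !frob_pred; ring.
Qed.

Lemma ell_Vstar n P : @Vstar p f S r P -> ell n P = 0.
Proof.
move=> [_ [Q ->]]; rewrite linear_sum big1 // => i _.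
have e10 : ev 1 0 (theta S i) = 0.
  by have := ev_theta 1 0 i; rewrite rmorph1 rmorph0.
rewrite /= /ell rmorphM /= e10 mul0r mulr0 subr0 big1 ?oppr0 // => x _.
have ex1 : ev (io x) 1 (theta S i) = 0.
  by have := ev_theta x 1 i; rewrite rmorph1.
by rewrite rmorphM /= ex1 mul0r mulr0.
Qed.

(** At (x, 1) the translate of X^r takes the value (a x + c)^a0, a polynomial of degree at most a0
    in x. Hence for n >= a0 only n = a0 sees a coefficient; it is a^a0, the value at infinity, which
    [ell] subtracts. *)
Lemma ell_gactXr n g : (a0 <= n < q)%N ->
  ell n (gact g (\prod_i pX i ^+ r i)) = 0.
Proof.
move=> /andP[an nq]; have -> : \prod_i pX i ^+ r i = mono r (fun=> 0%N).
  by apply: eq_bigr => i _; rewrite expr0 mulr1.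
have v0 : val_of (fun=> 0%N) = 0%N by rewrite /val_of big1.
have a01 := wd_a0 H; have r0 := val_r_gt0.
have rE (x : Fq S) : io x ^+ val_of r = io x ^+ a0.
  by rewrite -!rmorphXn (exp_modq _ r0 a01 val_r_mod).
rewrite /ell; have -> : ev 1 0 (gact g (mono r (fun=> 0%N))) = io (g ord0 ord0) ^+ a0.
  have := ev_gact 1 0 g (mono r (fun=> 0%N)); rewrite rmorph1 rmorph0 => ->.
  by rewrite ev_mono v0 !mulr1 mulr0 addr0 rE.
set a := g ord0 ord0; set c := g ord_max ord0.
rewrite (eq_bigr (fun x => \sum_(i < a0.+1) (io c ^+ (a0 - i) * io a ^+ i *+ 'C(a0, i)) *
   io x ^+ (q.-1 - n + i))) => [|x _]; last first.
  have := ev_gact x 1 g (mono r (fun=> 0%N)); rewrite rmorph1 => ->.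
  rewrite ev_mono v0 mulr1 rE rmorphD !rmorphM ?rmorph1 ?mulr1 addrC exprDn mulr_sumr.
  by apply: eq_bigr => i _; rewrite exprMn exprD mulrnAr mulrnAl; congr (_ *+ _); ring.
rewrite exchange_big /= (eq_bigr (fun i : 'I_a0.+1 => - ((i == n :> nat)%:R *
   (io c ^+ (a0 - i) * io a ^+ i *+ 'C(a0, i))))) => [|i _]; last first.
  rewrite -mulr_sumr psum.
  have -> : ((0 < q.-1 - n + i) && (q.-1 %| q.-1 - n + i))%N = (i == n :> nat).
    have hi := ltn_ord i; apply/andP/eqP => [[h1 h2]|e].
      have := dvdn_leq h1 h2; lia.
    have h := a0_lt_q1; have nq1 : (n <= q.-1)%N by lia.
    by rewrite e subnK // dvdnn; split=> //; lia.
  by case: eqP; rewrite ?mulrN1 ?mul1r ?mulr0 ?mul0r ?oppr0.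
rewrite sumrN opprK (bigD1 ord_max) //= big1 ?addr0 => [|i].
  rewrite subnn expr0 mul1r binn mulr1n eq_sym; ring.
rewrite -val_eqE /= => ia; rewrite (_ : (i == n :> nat) = false) ?mul0r //.
by have := ltn_ord i; lia.
Qed.

Lemma ell_ker n P : (a0 <= n < q)%N -> lspan (@Vstar p f S r `|` @Xr p f S r)%classic P -> ell n P = 0.
Proof.
move=> hn; apply: (lspan_min (N := [set P | ell n P = 0]%classic)) => /=.
- exact: linear0.
- by move=> c u v hu hv; rewrite linearP /= hu hv scaler0 addr0.
- move=> Q [VQ|]; [exact: ell_Vstar|apply: (lspan_min (N := [set P | ell n P = 0]%classic)) => /=].
  + exact: linear0.
  + by move=> c u v hu hv; rewrite linearP /= hu hv scaler0 addr0.
  + by move=> _ [g _ ->]; exact: ell_gactXr.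
Qed.

End Setup.

(** * Normal forms of monomials in Q *)

Section QBasis.
Variables (p f : nat) (S : setting p f) (r : 'I_f -> nat) (a0 : nat).
Hypothesis H : weight_data p r a0.
Local Notation q := (p ^ f)%N.
Local Notation k := (Fpbar S).
Local Notation io := (Defs.iota S).
Local Notation val_of := (@val_of p f).
Local Notation dig := (@dig p f).
Local Notation mono := (mono k).
Local Notation prQ := (@prQ p f S r).
Local Notation Qamb := (Qamb S r).
Let p_prime := wd_prime H.
Let p_gt1 : (1 < p)%N := prime_gt1 p_prime.
Let p_gt0 : (0 < p)%N := prime_gt0 p_prime.
Let f_gt1 := wd_f H.
Let f_gt0 : (0 < f)%N := ltnW f_gt1.
Let r_ge := wd_r H.

HB.instance Definition _ := GRing.Linear.copy prQ (lpi (@Vstar p f S r `|` @Xr p f S r)%classic).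

Lemma prQ0 : prQ 0 = 0. Proof. exact: linear0. Qed.
Lemma prQZ c P : prQ (c *: P) = c *: prQ P. Proof. exact: linearZ. Qed.
Lemma prQ_lin c P P' : prQ (c *: P + P') = c *: prQ P + prQ P'.
Proof. exact: linearP. Qed.
Lemma prQ_sum I (s : seq I) (Pr : pred I) (F : I -> {mpoly k[f + f]}) :
  prQ (\sum_(i <- s | Pr i) F i) = \sum_(i <- s | Pr i) prQ (F i).
Proof. exact: linear_sum. Qed.

Lemma prQ_Vstar P : @Vstar p f S r P -> prQ P = 0.
Proof. by move=> h; apply/lpi_eq0/lspan_in; left. Qed.

Lemma prQ_Xr P : @Xr p f S r P -> prQ P = 0.
Proof. by move=> h; apply/lpi_eq0/lspan_in; right. Qed.

Definition EQ (a : 'I_f -> nat) : Qamb := prQ (mono a (fun i => r i - a i)%N).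
Definition eQ (n : nat) : Qamb := EQ (dig n).

Lemma eq_EQ a b : a =1 b -> EQ a = EQ b.
Proof. by move=> /funext ->. Qed.

Lemma ord_pred_neq (i : 'I_f) : ord_pred i != i.
Proof.
apply/eqP => /(congr1 (@nat_of_ord f)); rewrite (ord_predE H).
by case: ifPn => [/eqP ->|]; lia.
Qed.

(* theta_i identifies a carry X_(i-1)^p Y_i with X_i Y_(i-1)^p. *)
Lemma EQ_carry a (i : 'I_f) : (forall j, a j <= r j)%N ->
  (p <= a (ord_pred i))%N -> (a i < r i)%N ->
  EQ a = EQ (fun j => a j + (j == i) - p * (j == ord_pred i))%N.
Proof.
move=> ar pa ai; apply/eqP; rewrite -subr_eq0 -linearB; apply/eqP.
have ni := ord_pred_neq i.
have K1 j : j == i -> (a j < r j)%N by move=> /eqP ->.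
have K2 j : j == ord_pred i -> (p <= a j)%N by move=> /eqP ->.
have K3 j : ~~ ((j == i) && (j == ord_pred i)).
  by apply/negP => /andP[/eqP -> /eqP e]; move: ni; rewrite -e eqxx.
pose M : {mpoly k[f + f]} := mono (fun j => a j - p * (j == ord_pred i))%N
  (fun j => r j - a j - (j == i))%N.
have e1 : pY i * pX (ord_pred i) ^+ p =
    mono (fun j => p * (j == ord_pred i))%N (fun j => (j == i) : nat).
  rewrite -mono_deltaY /mono -(mono_delta k (ord_pred i)) /(mono _ _) -prodrXl -big_split /=.
  by apply: eq_bigr => j _; rewrite !expr0 mul1r mulr1 -exprM mulnC [in RHS]mulrC (mulnC p).
have e2 : pX i * pY (ord_pred i) ^+ p =
    mono (fun j => (j == i) : nat) (fun j => p * (j == ord_pred i))%N.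
  rewrite -mono_delta /mono -(mono_deltaY k (ord_pred i)) /(mono _ _) -prodrXl -big_split /=.
  by apply: eq_bigr => j _; rewrite !expr0 mul1r mulr1 -exprM (mulnC p).
have tM : mono a (fun j => r j - a j)%N -
    mono (fun j => a j + (j == i) - p * (j == ord_pred i))%N
         (fun j => r j - (a j + (j == i) - p * (j == ord_pred i)))%N = theta S i * - M.
  rewrite /theta e1 e2 mulrN mulrBl opprB !monoM.
  by congr (_ - _); apply: eq_mono => j; move: (K1 j) (K2 j) (K3 j) (ar j);
    case: (j == i); case: (j == ord_pred i) => /= k1 k2 k3 k4; lia.
apply: prQ_Vstar; split.
  apply: VpolyB; apply: Vpoly_mono => j; first by have := ar j; lia.
  by move: (K1 j) (K2 j) (K3 j) (ar j);
    case: (j == i); case: (j == ord_pred i) => /= k1 k2 k3 k4; lia.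
rewrite tM; exists (fun j => if j == i then - M else 0).
rewrite (bigD1 i) //= eqxx big1 ?addr0 // => j /negbTE ->.
by rewrite mulr0.
Qed.

Lemma ordS_closed (Pr : 'I_f -> Prop) i0 : Pr i0 ->
  (forall i, Pr i -> Pr (ordS i)) -> forall j, Pr j.
Proof.
move=> P0 PS j.
have it n : Pr (iter n (@ordS f) i0) by elim: n => //= n /PS.
have itE n : (iter n (@ordS f) i0 : nat) = ((i0 + n) %% f)%N.
  elim: n => [|n IH] /=; first by rewrite addn0 modn_small.
  by rewrite IH -addn1 modnDml addn1 addnS.
have -> : j = iter (f - i0 + j) (@ordS f) i0.
  apply/val_inj; rewrite /= itE addnA subnKC ?(ltnW (ltn_ord i0)) //.
  by rewrite modnDl modn_small.
exact: it.
Qed.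

(** A carry trades p p^(i-1) for p^i. This changes nothing except at the wrap-around i = 0, where
    p^f is traded for 1 and the value drops by q - 1. *)
Lemma val_carry a (i : 'I_f) : (p <= a (ord_pred i))%N ->
  val_of (fun j => a j + (j == i) - p * (j == ord_pred i))%N = val_of a %[mod q.-1].
Proof.
move=> pa.
rewrite val_of_sub => [|j]; last first.
  by case: eqP => [->|_]; rewrite ?muln1 ?muln0 // (leq_trans pa) // leq_addr.
rewrite val_of_add val_of_delta -[val_of (fun j => (j == i))]/(val_of (fun j => nat_of_bool (j == i))).
have -> : val_of (fun j => nat_of_bool (j == i)) = (p ^ i)%N.
  by rewrite -[RHS]mul1n -val_of_delta; apply: eq_bigr => j _; rewrite mul1n.
have va : (p * p ^ ord_pred i <= val_of a)%N.
  rewrite /(val_of _) (bigD1 (ord_pred i)) //= (leq_trans _ (leq_addr _ _)) //.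
  by rewrite leq_mul2r pa orbT.
have eP := ord_predE H i.
rewrite -expnS eP in va *; case: (posnP i) va => [->|i0] /=.
  rewrite prednK // expn0 => va.
  have q0 : (0 < q)%N by rewrite expn_gt0 p_gt0.
  have e : (val_of a + 1 - q + q.-1 = val_of a)%N by lia.
  by rewrite -[in RHS]e modnDr.
by rewrite prednK // => va; rewrite addnK.
Qed.

(** Every carry lowers the digit sum by p - 1, so carrying stops. A digit at least p can be stuck
    only if the next position is full, that is, equal to r_i. Since r_i >= p, a full position makes
    the following one full as well, and around the cycle this forces a = r, which is excluded. *)
Lemma EQ_normal a : (forall j, a j <= r j)%N -> (exists j, a j != r j) ->
  exists b, [/\ forall j, (b j < p)%N, EQ a = EQ b, val_of b = val_of a %[mod q.-1]
     & (0 < val_of a)%N -> (0 < val_of b)%N].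
Proof.
move: {2}(\sum_j a j)%N (leqnn (\sum_j a j)%N) => n.
elim: n a => [|n IH] a an ar anr.
  exists a; have a0' j : a j = 0%N.
    by apply/eqP; move: an; rewrite leqn0 sum_nat_eq0 => /forallP/(_ j).
  by split=> // j; rewrite a0'.
case: (pickP (fun i : 'I_f => (p <= a (ord_pred i)) && (a i < r i))%N) => [i /andP[pa ai]|h].
  have ni := ord_pred_neq i.
  set a' : 'I_f -> nat := (fun j => a j + (j == i) - p * (j == ord_pred i))%N.
  have a'E j : a' j = if j == i then (a i).+1 else if j == ord_pred i then (a j - p)%N else a j.
    rewrite /a'; case: eqVneq => [->|ji] /=.
      by rewrite eq_sym (negbTE ni); lia.
    by case: eqVneq => _ /=; lia.
  have [|||b [bp eb vb b0]] := IH a'.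
  - have sE : (\sum_j a' j + p * 1 = \sum_j a j + 1)%N.
      have -> : (p * 1 = \sum_j p * (j == ord_pred i))%N.
        by rewrite -big_distrr /= (bigD1 (ord_pred i)) //= eqxx big1 // => j /negbTE ->.
      have -> : (1 = \sum_j (j == i))%N.
        by rewrite (bigD1 i) //= eqxx big1 // => j /negbTE ->.
      rewrite -!big_split /=; apply: eq_bigr => j _.
      by rewrite /a' subnK //; case: eqP => [->|_]; rewrite ?muln1 ?muln0 // (leq_trans pa) // leq_addr.
    by move: an sE; rewrite muln1; set x := (\sum_j a j)%N; set y := (\sum_j a' j)%N; lia.
  - by move=> j; rewrite a'E; case: eqVneq => [->//|_]; case: eqVneq => _; have := ar j; lia.
  - exists (ord_pred i); rewrite a'E (negbTE ni) eqxx.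
    by have := ar (ord_pred i); lia.
  exists b; split=> //; first by rewrite (EQ_carry ar pa ai).
    by rewrite vb val_carry.
  move=> _; apply: b0; rewrite lt0n val_of_eq0 //; apply/forallPn; exists i.
  by rewrite a'E eqxx.
exists a; split=> // j.
have nr i : a i <> r i.
  move=> air; case: anr => i1 /eqP; apply.
  apply: (@ordS_closed (fun i => a i = r i) i) => // {air i1}i air.
  have := h (ordS i); rewrite ordSK air.
  have -> : (p <= r i)%N by apply: leq_trans (r_ge i); have := q_gt H; lia.
  by move=> /= /negbT; rewrite -leqNgt => h'; apply/eqP; rewrite eqn_leq ar.
have := h (ordS j); rewrite ordSK => /negbT; rewrite negb_and -!ltnNge => /orP[//|].
by rewrite ltnS => h'; case: (nr (ordS j)); apply/eqP; rewrite eqn_leq ar.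
Qed.

(** Positivity survives the carries, so a value divisible by q - 1 is represented by q - 1 and not
    by 0. *)
Lemma EQ_eQ a n : (forall j, a j <= r j)%N -> (0 < val_of a)%N ->
  val_of a != val_of r -> (0 < n < q)%N -> val_of a = n %[mod q.-1] -> EQ a = eQ n.
Proof.
move=> ar va var nq e.
have [|b [bp -> vb b0]] := EQ_normal ar.
  apply/existsP; apply: contraNT var => /existsPn h.
  by apply/eqP; apply: eq_bigr => i _; have := h i => /negPn/eqP ->.
apply: eq_EQ => j; rewrite -(dig_val_of p_gt1 j bp).
have -> // : val_of b = n.
apply/eqP; rewrite -(modq_eq H); [by rewrite vb e| |by lia].
by rewrite b0 //=; have := val_of_lt p_gt1 bp; lia.
Qed.

Definition monor (a : 'I_f -> nat) : {mpoly k[f + f]} := mono a (fun i => r i - a i)%N.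

Lemma gact_Xr_in g : g \in unitmx -> prQ (gact g (mono r (fun=> 0%N))) = 0.
Proof.
move=> ug; apply: prQ_Xr; apply: lspan_in; exists g => //; congr gact.
by apply: eq_bigr => i _; rewrite expr0 mulr1.
Qed.

Lemma gact_mono (g : 'M[Fq S]_2) a b : gact g (mono a b) = \prod_(i < f)
  ((io (g ord0 ord0) ^+ (p ^ i) *: pX i + io (g ord_max ord0) ^+ (p ^ i) *: pY i) ^+ a i *
   (io (g ord0 ord_max) ^+ (p ^ i) *: pX i + io (g ord_max ord_max) ^+ (p ^ i) *: pY i) ^+ b i).
Proof. by rewrite /gact /pact psubst_mono; apply: eq_bigr => i _; rewrite !mxE. Qed.

Definition wmx : 'M[Fq S]_2 := mx22 0 1 1 0.
Definition umx (c : Fq S) : 'M[Fq S]_2 := mx22 1 0 c 1.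
Definition tmx (a d : Fq S) : 'M[Fq S]_2 := mx22 a 0 0 d.

Lemma expp_gt0 (i : nat) : (0 < p ^ i)%N. Proof. by rewrite expn_gt0 p_gt0. Qed.

Lemma unit_wmx : wmx \in unitmx.
Proof. by rewrite unitmxE det_mx22 !mul0r sub0r mulr1 unitfE oppr_eq0 oner_neq0. Qed.
Lemma unit_umx c : umx c \in unitmx.
Proof. by rewrite unitmxE det_mx22 !mul0r subr0 mulr1 unitr1. Qed.
Lemma unit_tmx a d : a != 0 -> d != 0 -> tmx a d \in unitmx.
Proof. by move=> a0' d0; rewrite unitmxE det_mx22 mul0r subr0 unitfE mulf_neq0. Qed.

Lemma gact_w a b : gact wmx (mono a b) = mono b a.
Proof.
rewrite gact_mono; apply: eq_bigr => i _; rewrite !mx22E rmorph0 rmorph1 expr1n.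
by rewrite expr0n (gtn_eqF (expp_gt0 i)) !scale0r !scale1r add0r addr0 mulrC.
Qed.

Lemma gact_t x y a b : gact (tmx x y) (mono a b) =
  (io x ^+ val_of a * io y ^+ val_of b) *: mono a b.
Proof.
rewrite gact_mono /val_of !expr_sum -big_split /= -mul_mpolyC rmorph_prod -big_split /=.
apply: eq_bigr => i _; rewrite !mx22E rmorph0 expr0n (gtn_eqF (expp_gt0 i)).
rewrite !scale0r add0r addr0 !exprZn -!exprM !(mulnC _ (p ^ i)%N) -!mul_mpolyC.
by rewrite /= mpolyCM; ring.
Qed.

Lemma gact_u c a b : gact (umx c) (mono a b) =
  \prod_(i < f) ((pX i + io c ^+ (p ^ i) *: pY i) ^+ a i * pY i ^+ b i).
Proof.
rewrite gact_mono; apply: eq_bigr => i _; rewrite !mx22E rmorph0 rmorph1 expr1n.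
by rewrite expr0n (gtn_eqF (expp_gt0 i)) !scale0r !scale1r add0r.
Qed.

Lemma gact_u_expg s c a : (forall i, a i < p)%N -> (forall i, a i <= s i)%N ->
  gact (umx c) (mono a (fun i => s i - a i)%N) = \sum_(b : {ffun 'I_f -> 'I_p})
    (\prod_(i < f) ('C(a i, b i)%:R * io c ^+ (p ^ i * (a i - b i)))) *:
    mono (fun i => b i) (fun i => s i - b i)%N.
Proof.
move=> ap pr; rewrite gact_u.
pose F (i : 'I_f) (j : 'I_p) : {mpoly k[f + f]} :=
  ('C(a i, j)%:R * io c ^+ (p ^ i * (a i - j))) *: (pX i ^+ j * pY i ^+ (s i - j)).
rewrite (eq_bigr (fun i => \sum_j F i j)) => [|i _].
  rewrite bigA_distr_bigA /=; apply: eq_bigr => b _.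
  rewrite /F /(mono _ _) -mul_mpolyC rmorph_prod -big_split /=.
  by apply: eq_bigr => i _; rewrite mul_mpolyC.
rewrite addrC exprDn big_distrl /=.
rewrite (big_ord_widen_cond p xpredT (fun j => (((io c ^+ (p ^ i) *: pY i) ^+ (a i - j) *
  pX i ^+ j *+ 'C(a i, j)) * pY i ^+ (s i - a i)))) //= big_mkcond /=.
apply: eq_bigr => j _; rewrite /F ltnS; case: leqP => ja.
  rewrite exprZn -exprM -!mul_mpolyC -mulr_natl mpolyCM.
  rewrite (_ : (s i - j = (a i - j) + (s i - a i))%N); last by have := pr i; have := ap i; lia.
  by rewrite exprD mpolyC_nat; ring.
by rewrite bin_small // mul0r scale0r.
Qed.

Lemma gact_u_exp c a : (forall i, a i < p)%N ->
  gact (umx c) (monor a) = \sum_(b : {ffun 'I_f -> 'I_p})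
    (\prod_(i < f) ('C(a i, b i)%:R * io c ^+ (p ^ i * (a i - b i)))) *: monor (fun i => b i).
Proof.
move=> ap; apply: gact_u_expg => // i; apply: ltnW; apply: leq_trans (ap i) _.
by apply: leq_trans (r_ge i); have := q_gt H; lia.
Qed.

End QBasis.

(** If the upper left entry is nonzero, elimination writes the matrix as lower unipotent times
    diagonal times upper unipotent, and the upper factor is a lower one conjugated by w. Otherwise w
    exchanges the rows and brings a nonzero entry to that place. *)
Lemma bruhat_ind (F : fieldType) (Pr : 'M[F]_2 -> Prop) :
  (forall g h, g \in unitmx -> h \in unitmx -> Pr g -> Pr h -> Pr (g *m h)) ->
  (forall a d, a != 0 -> d != 0 -> Pr (mx22 a 0 0 d)) ->
  (forall c, Pr (mx22 1 0 c 1)) -> Pr (mx22 0 1 1 0) ->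
  forall g, g \in unitmx -> Pr g.
Proof.
move=> PM Pt Pu Pw.
have uu c : mx22 1 0 c 1 \in @unitmx F 2.
  by rewrite unitmxE det_mx22 mul0r mulr1 subr0 unitr1.
have uw : mx22 0 1 1 0 \in @unitmx F 2.
  by rewrite unitmxE det_mx22 mul0r mulr1 sub0r unitfE oppr_eq0 oner_neq0.
have Pl b : Pr (mx22 1 b 0 1) /\ mx22 1 b 0 1 \in unitmx.
  have -> : mx22 1 b 0 1 = mx22 0 1 1 0 *m (mx22 1 0 b 1 *m mx22 0 1 1 0).
    by rewrite !mul_mx22; apply: mx2P; rewrite !mx22E; ring.
  by rewrite !unitmx_mul uu uw; split=> //; apply: (PM); rewrite ?unitmx_mul ?uu ?uw //; exact: (PM).
have main a b c d : a != 0 -> a * d - b * c != 0 -> Pr (mx22 a b c d).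
  move=> a0 d0; have d1 : d - b * c / a != 0.
    apply: contraNneq d0 => e; rewrite (_ : a * d - b * c = a * (d - b * c / a)).
      by rewrite e mulr0.
    by field.
  have -> : mx22 a b c d =
      mx22 1 0 (c / a) 1 *m (mx22 a 0 0 (d - b * c / a) *m mx22 1 (b / a) 0 1).
    by rewrite !mul_mx22; apply: mx2P; rewrite !mx22E; field.
  have ut : mx22 a 0 0 (d - b * c / a) \in unitmx.
    by rewrite unitmxE det_mx22 mul0r subr0 unitfE mulf_neq0.
  have [p1 p2] := Pl (b / a).
  by apply: (PM); rewrite ?unitmx_mul ?ut ?p2 //; apply: (PM) => //; exact: Pt.
move=> g; rewrite (mx22_eta g) unitmxE det_mx22 unitfE.
set a := g ord0 ord0; set b := g ord0 ord_max; set c := g ord_max ord0.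
set d := g ord_max ord_max => dg.
have [a0|a0] := eqVneq a 0; last exact: main.
have -> : mx22 a b c d = mx22 0 1 1 0 *m mx22 c d a b.
  by rewrite !mul_mx22; apply: mx2P; rewrite !mx22E; ring.
have c0 : c != 0 by apply: contraNneq dg => ->; rewrite a0 mul0r mulr0 subrr.
have d' : c * b - d * a != 0.
  have -> : c * b - d * a = - (a * d - b * c) by ring.
  by rewrite oppr_eq0.
by apply: (PM) => //; [rewrite unitmxE det_mx22 unitfE|exact: main].
Qed.

(** * A basis of Q and the action of generators on it *)

Section QStruct.
Variables (p f : nat) (S : setting p f) (r : 'I_f -> nat) (a0 : nat).
Hypothesis H : weight_data p r a0.
Local Notation q := (p ^ f)%N.
Local Notation k := (Fpbar S).
Local Notation io := (Defs.iota S).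
Local Notation val_of := (@val_of p f).
Local Notation dig := (@dig p f).
Local Notation mono := (mono k).
Local Notation monor := (@monor p f S r).
Local Notation ell := (@ell p f S a0).
Local Notation prQ := (@prQ p f S r).
Local Notation Qamb := (Qamb S r).
Local Notation EQ := (@EQ p f S r).
Local Notation eQ := (@eQ p f S r).
Local Notation wmx := (@wmx p f S).
Local Notation umx := (@umx p f S).
Local Notation tmx := (@tmx p f S).
Local Notation Qact := (@Qact p f S r).
Local Notation QQ := (@Q p f S r).
Let p_prime := wd_prime H.
Let p_gt1 : (1 < p)%N := prime_gt1 p_prime.
Let p_gt0 : (0 < p)%N := prime_gt0 p_prime.
Let f_gt1 := wd_f H.
Let f_gt0 : (0 < f)%N := ltnW f_gt1.
Let r_ge := wd_r H.

Lemma p_le_r i : (p <= r i)%N.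
Proof. by apply: leq_trans (r_ge i); have := q_gt H; lia. Qed.

Lemma dig_le_r n i : (dig n i <= r i)%N.
Proof. by apply: ltnW; apply: leq_trans (p_le_r i); exact: dig_lt. Qed.

(** The monomial is Y^r, the image of X^r under w. *)
Lemma EQ_val0 a : val_of a = 0%N -> EQ a = 0.
Proof.
move=> /eqP; rewrite (val_of_eq0 p_gt1) => /forallP a_0.
have {}a_0 : a =1 (fun=> 0%N) by move=> i; exact/eqP.
have := gact_Xr_in r (unit_wmx S); rewrite (gact_w S H) => <-; congr prQ.
by apply: eq_mono => // i; rewrite a_0 subn0.
Qed.

Lemma EQ_valr a : (forall i, a i <= r i)%N -> val_of a = val_of r -> EQ a = 0.
Proof.
move=> ar var.
have /eqP : val_of (fun i => r i - a i)%N = 0%N by rewrite val_of_sub // var subnn.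
rewrite (val_of_eq0 p_gt1) => /forallP ra0.
have := gact_Xr_in r (unitmx1 (Fq S) 2).
rewrite (_ : gact 1%:M _ = mono r (fun=> 0%N)).
  move=> <-; congr prQ; apply: eq_mono => i; last by have := ra0 i => /eqP ->.
  by have := ra0 i; have := ar i; lia.
rewrite /gact -[RHS]pact_id; apply: eq_pact => i.
apply/matrixP => u v; rewrite !mxE; case: (u == v); rewrite ?rmorph1 ?rmorph0 ?expr1n //.
by rewrite expr0n (gtn_eqF (expp_gt0 H i)).
Qed.

(** It suffices to look at monomials. X^r and Y^r vanish on both sides; any other monomial has the
    class of the unique e_n with 0 < n < q in its residue class, and [ell_mono] selects this n. *)
Lemma prQ_expand0 P : Vpoly r P -> prQ P = \sum_(n < q | (0 < n)%N) ell n P *: eQ n.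
Proof.
move: P; apply: Vpoly_ind => [|c P Q eP eQ'|a ar].
- by rewrite prQ0 big1 // => n _; rewrite linear0 scale0r.
- rewrite prQ_lin eP eQ' scaler_sumr -big_split; apply: eq_bigr => n _ /=.
  rewrite [ell n (c *: P + Q)](_ : _ = c * ell n P + ell n Q).
    by rewrite [in RHS]scalerDl scalerA.
  exact: ell_is_linear.
- have abr i : (a i + (r i - a i) = r i)%N by have := ar i; lia.
  have vb : val_of (fun i => r i - a i)%N = (val_of r - val_of a)%N by exact: val_of_sub.
  rewrite -/(EQ a).
  have [va|va] := posnP (val_of a).
    rewrite EQ_val0 // big1 // => n n0.
    by rewrite (ell_mono S H) ?n0 ?ltn_ord // va scale0r.
  have [var|var] := eqVneq (val_of a) (val_of r).
    rewrite EQ_valr // big1 // => n n0.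
    by rewrite (ell_mono S H) ?n0 ?ltn_ord // vb var subnn andbF scale0r.
  have lt_ar : (val_of a < val_of r)%N.
    by rewrite ltn_neqAle var /=; apply: leq_sum => i _; rewrite leq_mul2r ar orbT.
  have q1 : (0 < q.-1)%N by have := q_gt H; lia.
  (* The representative of val a among 1, ..., q - 1: the shift by one sends multiples of q - 1 to q
     - 1 rather than to 0. *)
  pose n0 := ((val_of a).-1 %% q.-1).+1.
  have n0q : (n0 < q)%N by have := ltn_pmod (val_of a).-1 q1; rewrite /n0; lia.
  have n0E : val_of a = n0 %[mod q.-1].
    by rewrite /n0 -addn1 modnDml addn1 prednK.
  rewrite (EQ_eQ S H ar va var (n := n0)) // (bigD1 (Ordinal n0q)) //= big1 ?addr0.
    rewrite (ell_mono S H) ?n0q // va vb subn_gt0 lt_ar n0E eqxx scale1r //.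
  move=> n /andP[np]; rewrite -val_eqE /= => nn0; rewrite (ell_mono S H) ?np ?ltn_ord //.
  rewrite n0E (modq_eq H) //; [|by lia|by have := ltn_ord n; lia].
  by rewrite eq_sym (negbTE nn0) !andbF scale0r.
Qed.

Lemma bin_neq0 a b : (b <= a < p)%N -> 'C(a, b)%:R != 0 :> k.
Proof.
move=> /andP[ba ap]; rewrite -(dvdn_pcharf (char_k S)).
have fp n : (n < p)%N -> ~~ (p %| n`!)%N.
  elim: n => [|n IH] np; first by rewrite fact0 dvdn1; have := p_gt1; lia.
  by rewrite factS Euclid_dvdM // negb_or IH ?(ltnW np) // andbT gtnNdvd.
apply: contra (fp a ap) => h; rewrite -(bin_fact ba) dvdn_mulr //.
Qed.

(* The sum of c^(q - 1 - n) (c 1; 1 0) X^r over c in F_q is 'C(a0, n) e_n up to sign. *)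
Lemma eQ_lt n : (n < a0)%N -> eQ n = 0.
Proof.
move=> na; have a0p := a0_lt_p H; have a0q := a0_lt_q1 H.
have [->|n0] := posnP n.
  by apply: EQ_val0; rewrite val_of_dig // expn_gt0 p_gt0.
pose g (c : Fq S) : 'M[Fq S]_2 := mx22 c 1 1 0.
have ug c : g c \in unitmx.
  by rewrite unitmxE det_mx22 mulr0 mulr1 sub0r unitfE oppr_eq0 oner_neq0.
pose X := mono r (fun=> 0%N).
pose P := \sum_(c : Fq S) io c ^+ (q.-1 - n) *: gact (g c) X.
have v0 : val_of (fun=> 0%N) = 0%N by rewrite /(val_of _) big1.
have VP : Vpoly r P.
  apply: Vpoly_sum => c _; apply: VpolyZ; apply: Vpoly_pact; apply: Vpoly_mono => i.
  by rewrite addn0.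
have : prQ P = 0.
  rewrite prQ_sum big1 // => c _; rewrite prQZ (gact_Xr_in _ (ug c)) scaler0 //.
rewrite (prQ_expand0 VP).
have rE (x : Fq S) : io x ^+ val_of r = io x ^+ a0.
  by rewrite -!rmorphXn (exp_modq H _ (val_r_gt0 H) (wd_a0 H) (val_r_mod H)).
have ev1 (x : Fq S) : ev (io x) 1 P = - ('C(a0, n)%:R * io x ^+ n).
  rewrite rmorph_sum (eq_bigr (fun c => \sum_(i < a0.+1)
      ('C(a0, i)%:R * io x ^+ i) * io c ^+ (q.-1 - n + i))) => [|c _]; last first.
    have := ev_gact H x 1 (g c) X; rewrite rmorph1 /= evZ => ->.
    rewrite !mx22E !mul1r ev_mono v0 expr0 mulr1 rE rmorphD rmorph1 rmorphM.
    rewrite exprD1n mulr_sumr; apply: eq_bigr => i _.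
    by rewrite exprMn exprD -mulr_natl; ring.
  rewrite exchange_big /= (bigD1 (inord n)) //= inordK ?ltnS ?(ltnW na) //.
  rewrite -mulr_sumr (psum S H) subnK ?dvdnn; last by lia.
  rewrite (_ : (0 < q.-1)%N) ?mulrN1 /=; last by lia.
  rewrite big1 ?addr0 // => i; rewrite -val_eqE /= inordK ?ltnS ?(ltnW na) // => ni.
  rewrite -mulr_sumr (psum S H) dvd_mod; last by lia.
  case: (posnP i) => [i0|i0].
    rewrite i0 addn0 mod0n modn_small; last by lia.
    by rewrite (_ : (0 == n)%N = false) ?andbF ?mulr0 //; apply/eqP; lia.
  rewrite (modq_eq H); [|by have := ltn_ord i; lia|by lia].
  by rewrite (negbTE ni) andbF mulr0.
have ev10 : ev 1 0 P = 0.
  rewrite rmorph_sum (eq_bigr (fun c => io c ^+ (q.-1 - n + a0))) => [|c _]; last first.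
    have := ev_gact H 1 0 (g c) X; rewrite rmorph1 rmorph0 /= evZ => ->.
    by rewrite ev_mono v0 expr0 mulr1 !mx22E mulr1 mulr0 addr0 rE exprD.
  rewrite (psum S H) dvd_mod; last by lia.
  rewrite (modq_eq H); [|by have := wd_a0 H; lia|by lia].
  by rewrite (gtn_eqF na) andbF.
rewrite (eq_bigr (fun m : 'I_q => if m == n :> nat then - 'C(a0, n)%:R *: eQ n else 0)).
  have nq : (n < q)%N by lia.
  rewrite (bigD1 (Ordinal nq)) //= eqxx big1 ?addr0 => [/eqP|m /andP[_]].
    by rewrite scaler_eq0 oppr_eq0 (negbTE (bin_neq0 _)) /= ?(ltnW na) // => /eqP.
  by rewrite -val_eqE /= => /negbTE ->.
move=> m m0; rewrite /(ell _) ev10 mulr0 subr0.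
rewrite (eq_bigr (fun x => - 'C(a0, n)%:R * io x ^+ (q.-1 - m + n))) => [|x _]; last first.
  by rewrite ev1 exprD; ring.
rewrite -mulr_sumr (psum S H) dvd_mod; last by have := ltn_ord m; lia.
rewrite (modq_eq H); [|by lia|by have := ltn_ord m; lia].
rewrite (_ : (0 < q.-1 - m + n)%N) /=; last by lia.
by rewrite eq_sym; case: eqP => [->|_]; rewrite ?mulr0 ?oppr0 ?scale0r // mulrN1 opprK.
Qed.

Lemma prQ_expand P : Vpoly r P -> prQ P = \sum_(n < q | (a0 <= n)%N) ell n P *: eQ n.
Proof.
move=> rP; rewrite prQ_expand0 // (bigID (fun n : 'I_q => a0 <= n)%N) /= [X in _ + X]big1.
  rewrite addr0; apply: eq_bigl => n; have := wd_a0 H; lia.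
by move=> n /andP[_]; rewrite -ltnNge => na; rewrite eQ_lt // scaler0.
Qed.

(** This reads [ell n] on a chosen representative. Independence of the choice is available for a0 <=
    n < q, where [ell n] kills the kernel of [prQ]; hence this bound in the lemmas below. *)
Definition ellQ (n : nat) (x : Qamb) : k := ell n (lrepr x).

Lemma ellQ_pr n P : (a0 <= n < q)%N -> ellQ n (prQ P) = ell n P.
Proof.
move=> hn; apply/eqP; rewrite -subr_eq0 /ellQ -[X in _ - X]/(ell n P) -linearB.
apply/eqP; apply: (ell_ker H) => //; apply/lpiP; exact: lreprK.
Qed.

Lemma ellQ_lin n c x y : (a0 <= n < q)%N -> ellQ n (c *: x + y) = c * ellQ n x + ellQ n y.
Proof.
move=> hn; rewrite -[x]lreprK -[y]lreprK -[lpi _ (lrepr x)]/(prQ _) -[lpi _ (lrepr y)]/(prQ _).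
by rewrite -prQ_lin !(ellQ_pr _ hn) ell_is_linear.
Qed.

Lemma ellQ0 n : (a0 <= n < q)%N -> ellQ n 0 = 0.
Proof. by move=> hn; have := ellQ_pr 0 hn; rewrite prQ0 linear0. Qed.

Lemma ellQ_sum n I (s : seq I) (Pr : pred I) (F : I -> Qamb) : (a0 <= n < q)%N ->
  ellQ n (\sum_(i <- s | Pr i) F i) = \sum_(i <- s | Pr i) ellQ n (F i).
Proof.
move=> hn; apply: (big_morph (ellQ n)) => [x y|]; last exact: ellQ0.
by rewrite -[x]scale1r ellQ_lin // mul1r scale1r.
Qed.

Lemma ellQZ n c x : (a0 <= n < q)%N -> ellQ n (c *: x) = c * ellQ n x.
Proof. by move=> hn; rewrite -[c *: x]addr0 ellQ_lin // ellQ0 // addr0. Qed.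

Lemma Q_EQ a : (forall i, a i <= r i)%N -> QQ (EQ a).
Proof.
move=> ar; exists (monor a) => //; apply: Vpoly_mono => i.
by have := ar i; lia.
Qed.

Lemma Q_eQ n : QQ (eQ n).
Proof. apply: Q_EQ => i; exact: dig_le_r. Qed.

Lemma Q_expand x : QQ x -> x = \sum_(n < q | (a0 <= n)%N) ellQ n x *: eQ n.
Proof.
move=> [P rP <-]; rewrite {1}(prQ_expand rP); apply: eq_bigr => n an.
by rewrite ellQ_pr // an ltn_ord.
Qed.

Lemma ellQ_EQ n a : (a0 <= n < q)%N -> (forall i, a i < p)%N ->
  ellQ n (EQ a) = (val_of a == n)%:R.
Proof.
move=> /andP[an nq] ap.
have ar i : (a i <= r i)%N by apply: ltnW; exact: leq_trans (p_le_r i).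
have a01 := wd_a0 H.
rewrite ellQ_pr ?an // (ell_mono S H) => [|| i]; [|by lia|by have := ar i; lia].
have vq := val_of_lt p_gt1 ap; have rq := val_r_ge H.
rewrite val_of_sub // subn_gt0 (_ : (val_of a < val_of r)%N); last by lia.
rewrite andbT; have [va|va] /= := posnP (val_of a).
  by rewrite va (_ : (0 == n)%N = false) //; apply/eqP; lia.
by rewrite (modq_eq H) //; lia.
Qed.

Lemma ellQ_eQ n m : (a0 <= n < q)%N -> (m < q)%N -> ellQ n (eQ m) = (m == n)%:R.
Proof.
move=> hn hm; rewrite ellQ_EQ // ?val_of_dig // => i; exact: dig_lt.
Qed.

Lemma gact_comp g h P : gact (S := S) g (gact h P) = gact (g *m h) P.
Proof.
rewrite /gact pact_comp; apply: eq_pact => i.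
by apply/matrixP => u v; rewrite mulmx2 !mxE !big_ord_recl big_ord0 addr0
  (_ : lift ord0 ord0 = ord_max :> 'I_2) ?rmorphD ?rmorphM ?(frob_k H) ?exprMn //; exact/val_inj.
Qed.

Lemma gact_linear g : linear (gact (S := S) g).
Proof. by move=> c u v; rewrite /gact linearP. Qed.

Lemma pchar_mpoly n : p \in [pchar {mpoly k[n]}].
Proof. by rewrite inE p_prime /= -mpolyC_nat (p_eq0 S) mpolyC0. Qed.

(** theta_i is the determinant of the rows (X_i, Y_i) and (X_(i-1)^p, Y_(i-1)^p), and g acts on both
    through the same twisted matrix. *)
Lemma gact_theta g i : gact g (theta S i) = io (\det g) ^+ (p ^ i) *: theta S i.
Proof.
have fr (x : Fq S) := frob_pred H x i.
have frm (u v : {mpoly k[f + f]}) : (u + v) ^+ p = u ^+ p + v ^+ p.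
  by rewrite exprDn_pchar // pnatE ?pchar_mpoly.
rewrite /theta /gact /pact rmorphB !rmorphM !rmorphXn /= !psubstX !psubstY !frm !exprZn !mxE !fr.
rewrite det2 rmorphB !rmorphM (frobB_k H) !exprMn -!mul_mpolyC mpolyCB !mpolyCM.
by ring.
Qed.

Local Notation Ker := (@Vstar p f S r `|` @Xr p f S r)%classic.

Lemma gact_Ker g P : g \in unitmx -> lspan Ker P -> lspan Ker (gact g P).
Proof.
move=> ug; apply: (lspan_min (N := [set P | lspan Ker (gact g P)]%classic)) => /=.
- by rewrite /gact linear0; exact: lspan0.
- by move=> c u v hu hv; rewrite gact_linear; apply: lspanD => //; exact: lspanZ.
- move=> Q [[VQ [A QE]]|].
    apply: lspan_in; left; split; first by rewrite /gact; exact: Vpoly_pact.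
    exists (fun i : 'I_f => io (\det g) ^+ (p ^ i) *: gact g (A i)).
    rewrite QE /gact rmorph_sum; apply: eq_bigr => i _.
    by rewrite rmorphM /= -/(gact g _) gact_theta -/(gact g _) -scalerAl scalerAr.
  apply: (lspan_min (N := [set P | lspan Ker (gact g P)]%classic)) => /=.
  + by rewrite /gact linear0; exact: lspan0.
  + by move=> c u v hu hv; rewrite gact_linear; apply: lspanD => //; exact: lspanZ.
  + move=> _ [h uh ->]; apply: lspan_in; right; apply: lspan_in; exists (g *m h).
      by rewrite unitmx_mul ug.
    by rewrite gact_comp.
Qed.

Lemma Qact_pr g P : g \in unitmx -> Qact g (prQ P) = prQ (gact g P).
Proof.
move=> ug; apply: lquot_act_pi; first exact: gact_linear.
by move=> v; exact: gact_Ker.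
Qed.

Lemma Qact_lin g : g \in unitmx -> linear (Qact g).
Proof.
move=> ug; apply: lquot_act_linear; first exact: gact_linear.
by move=> v; exact: gact_Ker.
Qed.

Lemma Qact_comp g h x : g \in unitmx -> h \in unitmx ->
  Qact g (Qact h x) = Qact (g *m h) x.
Proof.
move=> ug uh; rewrite -[x]lreprK -[lpi _ _]/(prQ _).
have ugh : g *m h \in unitmx by rewrite unitmx_mul ug.
by rewrite (Qact_pr _ uh) (Qact_pr _ ug) (Qact_pr _ ugh) gact_comp.
Qed.

Lemma Qact_w n : (a0 <= n < q)%N -> Qact wmx (eQ n) = eQ (q.-1 + a0 - n).
Proof.
move=> /andP[an nq]; rewrite Qact_pr ?unit_wmx // (gact_w S H).
have dr i := dig_le_r n i; have rq := val_r_ge H; have a0q := a0_lt_q1 H.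
have a01 := wd_a0 H.
transitivity (EQ (fun i => r i - dig n i)%N).
  by congr prQ; apply: eq_mono => i //=; have := dr i; lia.
have vE : val_of (fun i => r i - dig n i)%N = (val_of r - n)%N.
  by rewrite val_of_sub // val_of_dig.
apply: (EQ_eQ S H); rewrite ?vE; try by lia.
apply/eqP; rewrite -(eqn_modDr n) subnK; last by lia.
rewrite subnK; last by lia.
by rewrite (val_r_mod H) modnDl.
Qed.

Lemma Qact_t x y n : x != 0 -> y != 0 -> (n < q)%N ->
  Qact (tmx x y) (eQ n) = (io x ^+ n * io y ^+ (val_of r - n)) *: eQ n.
Proof.
move=> x0 y0 nq; rewrite (Qact_pr _ (unit_tmx x0 y0)) (gact_t H) prQZ.
by rewrite val_of_sub ?val_of_dig // => i; exact: dig_le_r.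
Qed.

Lemma Qact_u c a : (forall i, a i < p)%N ->
  Qact (umx c) (EQ a) = \sum_(b : {ffun 'I_f -> 'I_p})
    (\prod_(i < f) ('C(a i, b i)%:R * io c ^+ (p ^ i * (a i - b i)))) *: EQ (fun i => b i).
Proof.
move=> ap; rewrite (Qact_pr _ (unit_umx c)) (gact_u_exp H) // prQ_sum.
by apply: eq_bigr => b _; rewrite prQZ.
Qed.

End QStruct.

Lemma linear_sumE (K : pzRingType) (U V : lmodType K) (F : U -> V) :
  linear F -> forall I (s : seq I) (Pr : pred I) (c : I -> K) (u : I -> U),
  F (\sum_(i <- s | Pr i) c i *: u i) = \sum_(i <- s | Pr i) c i *: F (u i).
Proof.
move=> lF I s Pr c u.
have F0 : F 0 = 0.
  by have := lF (-1) 0 0; rewrite !scaleN1r oppr0 addr0 addNr.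
elim: s => [|i s IH]; first by rewrite !big_nil.
by rewrite !big_cons; case: (Pr i); rewrite // lF IH.
Qed.

(** * The submodules of Q and its socle filtration *)

Section Chain.
Variables (p f : nat) (S : setting p f) (r : 'I_f -> nat) (a0 : nat).
Hypothesis H : weight_data p r a0.
Local Notation q := (p ^ f)%N.
Local Notation k := (Fpbar S).
Local Notation io := (Defs.iota S).
Local Notation val_of := (@val_of p f).
Local Notation dig := (@dig p f).
Local Notation Qamb := (Qamb S r).
Local Notation EQ := (@EQ p f S r).
Local Notation eQ := (@eQ p f S r).
Local Notation tmx := (@tmx p f S).
Local Notation Qact := (@Qact p f S r).
Local Notation QQ := (@Q p f S r).
Let p_prime := wd_prime H.
Let p_gt1 : (1 < p)%N := prime_gt1 p_prime.
Let p_gt0 : (0 < p)%N := prime_gt0 p_prime.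
Let f_gt1 := wd_f H.
Let f_gt0 : (0 < f)%N := ltnW f_gt1.
Let r_ge := wd_r H.

Local Notation ellQ := (@ellQ p f S r a0).
Local Notation act := Qact.

(** M_e, cut out by the coordinates that have to vanish instead of spanned by the e_n. For e = 0 it
    is all of Q and for e = f it is zero. *)
Definition Mset (e : nat) : set Qamb := [set x | QQ x /\
  forall n, (a0 <= n < q)%N -> (a0 <= n %% p ^ e)%N -> ellQ n x = 0]%classic.

Lemma QQ_lin c x y : QQ x -> QQ y -> QQ (c *: x + y).
Proof.
move=> [P rP <-] [P' rP' <-]; exists (c *: P + P'); last exact: prQ_lin.
by apply: VpolyD => //; exact: VpolyZ.
Qed.

Lemma QQ0 : QQ 0. Proof. by exists 0; [exact: Vpoly0|exact: prQ0]. Qed.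

Lemma QQ_act g x : g \in unitmx -> QQ x -> QQ (act g x).
Proof.
move=> ug [P rP <-]; rewrite (Qact_pr H _ ug); exists (gact g P) => //.
by rewrite /gact; exact: Vpoly_pact.
Qed.

Lemma Mset0 e : Mset e 0.
Proof. by split; [exact: QQ0|move=> n hn _; exact: (ellQ0 S H)]. Qed.

Lemma Mset_lin e c x y : Mset e x -> Mset e y -> Mset e (c *: x + y).
Proof.
move=> [Qx hx] [Qy hy]; split; first exact: QQ_lin.
by move=> n hn hm; rewrite (ellQ_lin H) // hx // hy // mulr0 addr0.
Qed.

Lemma Mset_sum e I (s : seq I) (Pr : pred I) (c : I -> k) (u : I -> Qamb) :
  (forall i, Pr i -> c i <> 0 -> Mset e (u i)) ->
  Mset e (\sum_(i <- s | Pr i) c i *: u i).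
Proof.
move=> h; elim/big_rec: _ => [|i x Pi Mx]; first exact: Mset0.
have [->|ci] := eqVneq (c i) 0; first by rewrite scale0r add0r.
by apply: Mset_lin => //; apply: h => //; exact/eqP.
Qed.

Lemma Mset_eQ e n : (n < q)%N -> (n %% p ^ e < a0)%N -> Mset e (eQ n).
Proof.
move=> nq hn; split; first exact: (Q_eQ S H).
move=> m hm hm'; rewrite (ellQ_eQ S H) //.
by case: eqP => // e'; move: hm'; rewrite -e' leqNgt hn.
Qed.

Lemma EQ_eQ_val a : (forall i, a i < p)%N -> EQ a = eQ (val_of a).
Proof. by move=> ap; apply: eq_EQ => i; rewrite dig_val_of. Qed.

Lemma Mset_EQ e a : (forall i, a i < p)%N -> (val_of a %% p ^ e < a0)%N -> Mset e (EQ a).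
Proof. by move=> ap h; rewrite EQ_eQ_val //; apply: Mset_eQ => //; exact: val_of_lt. Qed.

Lemma Mset_expand e x : Mset e x ->
  x = \sum_(n < q | (a0 <= n)%N && (n %% p ^ e < a0)%N) ellQ n x *: eQ n.
Proof.
move=> [Qx hx]; rewrite {1}(Q_expand H Qx) (bigID (fun n : 'I_q => n %% p ^ e < a0)%N) /=.
rewrite [X in _ + X]big1 ?addr0 // => n /andP[an]; rewrite -leqNgt => h.
by rewrite hx ?scale0r // an ltn_ord.
Qed.

(** Checked on generators. The torus scales each e_n; unipotent matrices only lower digits, so n mod
    p^e does not grow; and if v = n mod p^e < a0, then q - 1 + a0 - n has remainder a0 - 1 - v,
    again below a0. *)
Lemma Mset_act e g x : (e <= f)%N -> g \in unitmx -> Mset e x -> Mset e (act g x).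
Proof.
move=> ef ug; move: g ug x.
have gen g : g \in unitmx ->
    (forall n, (a0 <= n < q)%N -> (n %% p ^ e < a0)%N -> Mset e (act g (eQ n))) ->
    forall x, Mset e x -> Mset e (act g x).
  move=> ug h x Mx; rewrite {1}(Mset_expand Mx) (linear_sumE (Qact_lin H ug)).
  apply: Mset_sum => n /andP[an hn] _; apply: h => //.
  by rewrite an ltn_ord.
apply: bruhat_ind => [g h ug uh Pg Ph x Mx|a d a0' d0|c|].
- by rewrite -(Qact_comp H _ ug uh); apply/Pg/Ph.
- apply: gen; first exact: unit_tmx.
  move=> n /andP[an nq] hn; rewrite (Qact_t H a0' d0 nq).
  by rewrite -[_ *: _]addr0; apply: Mset_lin; [exact: Mset_eQ|exact: Mset0].
- apply: gen; first exact: unit_umx.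
  move=> n /andP[an nq] hn; rewrite /(eQ _) (Qact_u H) => [|i]; last exact: dig_lt.
  apply: Mset_sum => b _ cb.
  have ba i : (b i <= dig n i)%N.
    rewrite leqNgt; apply/negP => h; apply: cb.
    by rewrite (bigD1 i) //= bin_small // !mul0r.
  apply: Mset_EQ => [i|]; first exact: ltn_ord.
  apply: leq_ltn_trans hn; rewrite -[in X in (_ <= X)%N](val_of_dig p_gt1 nq).
  by apply: val_of_mod_le => // i; exact: dig_lt.
- apply: gen; first exact: unit_wmx.
  move=> n /andP[an nq] hn; rewrite (Qact_w S H) ?an //.
  have a01 := wd_a0 H; have a0q := a0_lt_q1 H.
  apply: Mset_eQ; first by lia.
  have qE : (q = p ^ (f - e) * p ^ e)%N by rewrite -expnD subnK.
  have nE := divn_eq n (p ^ e); set u := (n %/ p ^ e)%N in nE; set v := (n %% p ^ e)%N in nE hn.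
  have uq : (u * p ^ e <= p ^ (f - e) * p ^ e)%N by rewrite -qE; lia.
  have -> : (q.-1 + a0 - n = (p ^ (f - e) - u) * p ^ e + (a0.-1 - v))%N.
    rewrite mulnBl -qE; move: uq; rewrite -qE; move: nE; set w := (u * p ^ e)%N; lia.
  by rewrite modnMDl; apply: leq_ltn_trans (leq_mod _ _) _; lia.
Qed.

Section Submodule.
Variable N : set Qamb.
Hypotheses (GN : Gsubmodule act N) (NQ : (N `<=` QQ)%classic).

Lemma N_lin c x y : N x -> N y -> N (c *: x + y).
Proof. by case: GN => _ h _; exact: h. Qed.
Lemma N_0 : N 0. Proof. by case: GN. Qed.
Lemma N_act g x : g \in unitmx -> N x -> N (act g x).
Proof. by case: GN => _ _ h; exact: h. Qed.
Lemma N_scale c x : N x -> N (c *: x).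
Proof. by move=> Nx; rewrite -[c *: x]addr0; apply: N_lin => //; exact: N_0. Qed.

(** Summing a^(q-1-n) diag(a, 1) x over nonzero a projects onto the coordinate n up to sign. No
    other coordinate survives, because the indices from a0 to q - 1 are distinct modulo q - 1. *)
Lemma N_weight n x : (a0 <= n < q)%N -> N x -> ellQ n x != 0 -> N (eQ n).
Proof.
move=> hn Nx lx; have a01 := wd_a0 H; have /andP[an nq] := hn.
pose y := \sum_(a : Fq S | a != 0) io a ^+ (q.-1 - n) *: act (tmx a 1) x.
have Ny : N y.
  rewrite /y; elim/big_rec: _ => [|a z a_0 Nz]; first exact: N_0.
  by apply: N_lin => //; apply: N_act => //; apply: unit_tmx; rewrite ?oner_neq0.
have yE : y = - ellQ n x *: eQ n.
  rewrite /y (eq_bigr (fun a => \sum_(m < q | (a0 <= m)%N)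
      (io a ^+ (q.-1 - n + m) * ellQ m x) *: eQ m)) => [|a a_0]; last first.
    rewrite {1}(Q_expand H (NQ Nx)) (linear_sumE (Qact_lin H (unit_tmx a_0 (oner_neq0 _)))).
    rewrite scaler_sumr; apply: eq_bigr => m am.
    rewrite (Qact_t H a_0 (oner_neq0 _) (ltn_ord m)) rmorph1 expr1n mulr1 !scalerA exprD.
    by congr (_ *: _); ring.
  have inner (m : 'I_q) : (a0 <= m)%N -> \sum_(a : Fq S | a != 0)
      (io a ^+ (q.-1 - n + m) * ellQ m x) *: eQ m =
      if m == n :> nat then - ellQ n x *: eQ n else 0.
    move=> am; rewrite -scaler_suml -mulr_suml.
    have := psum S H (q.-1 - n + m); rewrite (bigD1 0) //= rmorph0 expr0n dvd_mod; last by lia.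
    rewrite (modq_eq H); [|by have := ltn_ord m; lia|by lia].
    rewrite (_ : (q.-1 - n + m == 0)%N = false) /=; last by lia.
    rewrite add0r (_ : (0 < q.-1 - n + m)%N) => [->|] /=; last by lia.
    by case: eqP => [->|_]; rewrite ?mulN1r // mul0r scale0r.
  rewrite exchange_big /= (eq_bigr _ inner) (bigD1 (Ordinal nq)) //= eqxx.
  rewrite big1 ?addr0 // => m /andP[am].
  by rewrite -val_eqE /= => /negbTE ->.
have := N_scale (- ellQ n x)^-1 Ny; rewrite yE scalerA mulVf ?oppr_eq0 //.
by rewrite scale1r.
Qed.

(* The unipotent matrix expands a monomial with Lucas coefficients, all nonzero below
   it digitwise; the torus then separates the terms. *)
Lemma N_digits a b : (forall i, a i < p)%N -> (forall i, b i <= a i)%N ->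
  (a0 <= val_of b)%N -> N (EQ a) -> N (EQ b).
Proof.
move=> ap ba ab Na; have bp i : (b i < p)%N by exact: leq_ltn_trans (ap i).
rewrite (EQ_eQ_val bp); have vq := val_of_lt p_gt1 bp.
have hn : (a0 <= val_of b < q)%N by rewrite ab.
apply: (N_weight hn (N_act (unit_umx 1) Na)).
rewrite (Qact_u H _ ap) (ellQ_sum H) //.
pose b' : {ffun 'I_f -> 'I_p} := [ffun i => Ordinal (bp i)].
rewrite (bigD1 b') //= [X in _ + X]big1 ?addr0 => [|c cb].
  rewrite (ellQZ H) // (ellQ_EQ S H) //.
  rewrite (_ : val_of _ = val_of b) ?eqxx ?mulr1; last first.
    by apply: eq_bigr => i _; rewrite ffunE.
  apply/prodf_neq0 => i _; rewrite rmorph1 expr1n mulr1 ffunE.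
  by apply: (bin_neq0 S H); rewrite ba ap.
rewrite (ellQZ H) // (ellQ_EQ S H) //.
case: eqP => e; last by rewrite mulr0.
case/eqP: cb; apply/ffunP => i; rewrite ffunE; apply/val_inj => /=.
exact: (val_of_inj p_gt1 (fun i => ltn_ord (c i)) bp e).
Qed.

Lemma N_eQ_digits m n : (m < q)%N -> (a0 <= n < q)%N ->
  (forall i, dig n i <= dig m i)%N -> N (eQ m) -> N (eQ n).
Proof.
move=> mq /andP[an nq] h; apply: N_digits => // [i|]; first exact: dig_lt.
by rewrite val_of_dig.
Qed.

(** These are the digits of the index of w e_(p^e). An index n' < q lies digitwise below it as soon
    as n' mod p^e < a0, which makes e_n' reachable from it. *)
Lemma val_of_top e : (0 < e <= f)%N ->
  val_of (fun i => if i == 0 :> nat then a0.-1 else if (i < e)%N then 0%N else p.-1) =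
  (q.-1 + a0 - p ^ e)%N.
Proof.
move=> /andP[e0 ef]; have a01 := wd_a0 H.
pose C j := if j == 0%N then a0.-1 else if (j < e)%N then 0%N else p.-1.
have sC m : (e <= m)%N -> (\sum_(0 <= j < m) C j * p ^ j + p ^ e = p ^ m + a0.-1)%N.
  elim: m => [|m IH] em; first by lia.
  have [me|me] := ltnP m e.
    have <- : e = m.+1 by lia.
    rewrite big_ltn // {1}/C /= expn0 muln1 big_nat big1 => [|j /andP[j0 je]]; first by lia.
    by rewrite /C je; case: eqP; [lia|rewrite mul0n].
  rewrite big_nat_recr //= {2}/C (_ : (m == 0)%N = false); last by lia.
  rewrite ltnNge me /= addnAC IH // expnS; have := p_gt0.
  have pE : (p * p ^ m = p ^ m + p.-1 * p ^ m)%N by rewrite -mulSn prednK.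
  by rewrite pE; lia.
have := sC f ef; rewrite big_mkord /(val_of _) -/C => h.
have pe : (p ^ e <= q)%N by rewrite leq_exp2l.
by set X := (\sum_(i < f) _)%N; have -> : X = (\sum_(i < f) C i * p ^ i)%N by []; lia.
Qed.

(** Descend, apply w, descend again. If digit 0 of n is at least a0, e_n leads down to e_a0, then by
    w to e_(q-1), all of whose digits are p - 1. Otherwise some higher digit e of n is nonzero: e_n
    leads down to e_(p^e), and w takes it to the index of [val_of_top], above all the required
    n'. *)
Lemma chain e : (e < f)%N -> forall n, (a0 <= n < q)%N -> (a0 <= n %% p ^ e.+1)%N ->
  N (eQ n) -> forall n', (a0 <= n' < q)%N -> (n' %% p ^ e < a0)%N -> N (eQ n').
Proof.
have a01 := wd_a0 H; have a0p := a0_lt_p H; have a0q := a0_lt_q1 H.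
have modS n j : (n %% p ^ j.+1 = n %% p ^ j + (n %/ p ^ j %% p) * p ^ j)%N.
  by rewrite -!(digsum_dig p_gt1) big_nat_recr.
elim: e => [|e IH] ef n hn hm Nn n' hn' hm'.
  have {}hm : (a0 <= n %% p)%N by rewrite expn1 in hm.
  pose b (i : 'I_f) := (a0 * (i == Ordinal f_gt0))%N.
  have bp i : (b i < p)%N by rewrite /b; case: (i == _); rewrite ?muln1 ?muln0.
  have vb : val_of b = a0 by rewrite val_of_delta /= expn0 muln1.
  have : N (EQ b).
    apply: N_digits Nn => [i|i|]; [exact: dig_lt| |by rewrite vb].
    by rewrite /b; case: eqP => [->|_]; rewrite ?muln0 // muln1 /(dig _ _) /= expn0 divn1.
  rewrite EQ_eQ_val // vb => Na0.
  have a0q' : (a0 < q)%N by lia.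
  have := N_act (unit_wmx S) Na0; rewrite (Qact_w S H) ?leqnn // addnK => Nq.
  apply: N_eQ_digits Nq => //; first by lia.
  move=> i; have := dig_lt p_gt1 n' i.
  have cp (j : 'I_f) : (p.-1 < p)%N by lia.
  have -> : q.-1 = val_of (fun=> p.-1).
    have -> : val_of (fun=> p.-1) = (\sum_(0 <= j < f) p.-1 * p ^ j)%N by rewrite big_mkord.
    by rewrite -big_distrr /= big_mkord -predn_exp.
  by rewrite dig_val_of //; lia.
have [h|h] := leqP a0 (n %% p ^ e.+1)%N.
  apply: (IH (ltnW ef) n hn h Nn n' hn').
  by apply: leq_ltn_trans hm'; rewrite (modS n' e) leq_addr.
have ne : (0 < n %/ p ^ e.+1 %% p)%N.
  by rewrite lt0n; apply/eqP => e0; move: hm; rewrite modS e0 mul0n addn0; lia.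
pose b (i : 'I_f) := (1 * (i == Ordinal ef))%N.
have bp i : (b i < p)%N by rewrite /b mul1n; case: (i == _).
have vb : val_of b = (p ^ e.+1)%N by rewrite val_of_delta mul1n.
have pe : (p <= p ^ e.+1)%N by rewrite expnS leq_pmulr // expn_gt0 p_gt0.
have peq : (p ^ e.+1 < q)%N by rewrite ltn_exp2l.
have : N (EQ b).
  apply: N_digits Nn => [i|i|]; [exact: dig_lt| |by rewrite vb; lia].
  by rewrite /b mul1n; case: eqP => [->|_].
rewrite EQ_eQ_val // vb => Nb.
have := N_act (unit_wmx S) Nb; rewrite (Qact_w S H); last by lia.
rewrite -(val_of_top (e := e.+1)); last by lia.
set c : 'I_f -> nat := (fun i => _) => Nc.
have cp i : (c i < p)%N by rewrite /c; case: ifP => _; [lia|case: ifP => _; lia].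
move: Nc; rewrite -EQ_eQ_val // => Nc; have /andP[an' nq'] := hn'.
apply: N_digits Nc => //; last by rewrite val_of_dig.
move=> i; rewrite /c; case: eqP => [i0|i0].
  rewrite /(dig _ _) i0 expn0 divn1.
  have : (n' %% p <= n' %% p ^ e.+1)%N.
    by rewrite -{1}(expn1 p) -(modn_dvdm (m := p ^ e.+1)) ?dvdn_exp2l // leq_mod.
  by lia.
case: ifP => ie; last by have := dig_lt p_gt1 n' i; rewrite /(dig _ _); lia.
have : (n' %% p ^ i.+1 <= n' %% p ^ e.+1)%N.
  by rewrite -(modn_dvdm (m := p ^ e.+1)) ?dvdn_exp2l // leq_mod.
rewrite modS leqn0; have : (p <= p ^ i)%N by rewrite -{1}(expn1 p) leq_exp2l //; lia.
rewrite -/(dig n' i); case: (dig n' i) => // d; rewrite mulSn; lia.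
Qed.

Lemma Mset_in_N e x : (e < f)%N -> N x -> ~ Mset e.+1 x -> (Mset e `<=` N)%classic.
Proof.
move=> ef Nx nMx y My.
have [n hn [hm ln]] : exists2 n, (a0 <= n < q)%N & (a0 <= n %% p ^ e.+1)%N /\ ellQ n x != 0.
  apply: contrapT => h; apply: nMx; split; first exact: NQ.
  move=> n hn hm; apply/eqP; apply: contrapT => /negP ln; apply: h.
  by exists n.
have Nn := N_weight hn Nx ln.
rewrite (Mset_expand My); elim/big_rec: _ => [|m z /andP[am hm'] Nz]; first exact: N_0.
apply: N_lin => //; apply: (chain ef hn hm Nn) => //.
by rewrite am ltn_ord.
Qed.

End Submodule.

Lemma Mset_le e e' : (e' <= e)%N -> (Mset e `<=` Mset e')%classic.
Proof.
move=> ee x [Qx hx]; split=> // n hn hm; apply: hx => //.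
apply: leq_trans hm _; rewrite -(modn_dvdm (m := p ^ e)) ?dvdn_exp2l //; exact: leq_mod.
Qed.

Lemma Mset_f x : Mset f x <-> x = 0.
Proof.
split=> [/Mset_expand ->|->]; last exact: Mset0.
by rewrite big1 // => n /andP[an]; rewrite modn_small // ltnNge an.
Qed.

(** Strictness of the chain, witnessed by e_a0 for e = 0 and by e_(p^e) for e > 0. *)
Lemma Mset_step e : (e < f)%N -> exists2 n, (a0 <= n < q)%N &
  (n %% p ^ e < a0)%N && (a0 <= n %% p ^ e.+1)%N.
Proof.
move=> ef; have a01 := wd_a0 H; have a0p := a0_lt_p H; have a0q := a0_lt_q1 H.
case: e ef => [|e] ef.
  by exists a0; rewrite ?expn0 ?modn1 ?expn1 ?modn_small ?a01 //; lia.
have pe : (p <= p ^ e.+1)%N by rewrite expnS leq_pmulr // expn_gt0 p_gt0.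
have peq : (p ^ e.+1 < q)%N by rewrite ltn_exp2l.
exists (p ^ e.+1)%N; first by lia.
by rewrite modnn a01 modn_small ?ltn_exp2l //; lia.
Qed.

(** Every nonzero submodule of Q / M_(e+1) contains M_e / M_(e+1). This is therefore the unique
    simple submodule, and hence the socle. *)
Lemma Qfil_Mset i : (i <= f)%N -> forall x, @Qfil p f S r i x <-> Mset (f - i) x.
Proof.
elim: i => [|i IH] hi x; first by rewrite subn0 Mset_f.
have {}IH := IH (ltnW hi).
have [e eE] : exists e, (f - i = e.+1)%N by exists (f - i).-1; lia.
have e'E : (f - i.+1 = e)%N by lia.
rewrite e'E; have ef : (e < f)%N by lia.
rewrite eE in IH.
set N := @Qfil p f S r i in IH *.
have spN v : lspan N v <-> Mset e.+1 v.
  split=> [|/IH]; last exact: lspan_in.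
  apply: (lspan_min (N := Mset e.+1)); first exact: Mset0.
    by move=> c u w; exact: Mset_lin.
  by move=> w /IH.
pose la := lquot_act (S := N) act.
have laE g v : g \in unitmx -> la g (lpi N v) = lpi N (act g v).
  move=> ug; apply: lquot_act_pi; first exact: (Qact_lin H).
  by move=> w /spN h; apply/spN; exact: Mset_act.
pose M' : set (lquot N) := (lpi N @` Mset e)%classic.
have GM' : Gsubmodule la M'.
  split.
  - by exists 0; [exact: Mset0|exact: linear0].
  - move=> c _ _ [u Mu <-] [v Mv <-]; exists (c *: u + v); first exact: Mset_lin.
    exact: linearP.
  - move=> g _ ug [u Mu <-]; rewrite laE //; exists (act g u) => //.
    by apply: Mset_act => //; lia.
have M'n0 : M' <> [set 0]%classic.
  move=> M'0; have [n hn /andP[h1 h2]] := Mset_step ef; have /andP[an nq] := hn.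
  have : M' (lpi N (eQ n)) by exists (eQ n) => //; exact: Mset_eQ.
  rewrite M'0 => /lpi_eq0/spN[_ /(_ n hn h2)]; rewrite (ellQ_eQ S H) // eqxx.
  by move/eqP; rewrite oner_eq0.
have M'Q : (M' `<=` lpi N @` QQ)%classic by move=> _ [u [Qu _] <-]; exists u.
(* N' is pulled back to Q. Either the preimage lies in M_(e+1), or [Mset_in_N] puts M_e inside
   it. *)
have dich N' : Gsubmodule la N' -> (N' `<=` lpi N @` QQ)%classic ->
    N' = [set 0]%classic \/ (M' `<=` N')%classic.
  move=> [N'0 N'l N'a] N'Q.
  pose N0 : set Qamb := [set v | QQ v /\ N' (lpi N v)]%classic.
  have GN0 : Gsubmodule act N0.
    split.
    - split; first exact: QQ0.
      by rewrite linear0.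
    - move=> c u v [Qu Nu] [Qv Nv]; split; first exact: QQ_lin.
      by rewrite linearP; exact: N'l.
    - move=> g v ug [Qv Nv]; split; first exact: QQ_act.
      by rewrite -laE //; exact: N'a.
  have N0Q : (N0 `<=` QQ)%classic by move=> v [].
  have [sub|nsub] := pselect (N0 `<=` Mset e.+1)%classic.
    left; apply/seteqP; split=> [y Ny|_ ->] //.
    have [u Qu uE] := N'Q y Ny; rewrite /set1 /= -uE; apply/lpi_eq0/spN/sub; split=> //.
    by rewrite uE.
  right; move/existsNP: nsub => [v /not_implyP[N0v nMv]].
  move=> _ [u Mu <-]; by have [] := Mset_in_N GN0 N0Q ef N0v nMv Mu.
split=> [[Qx]|Mx].
  have subM : (lspan [set w | exists N', [/\ Gsimple la N', N' `<=` lpi N @` QQ & N' w]]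
      `<=` M')%classic.
    have [M0 Ml _] := GM'; apply: lspan_min => // w [N' [[GN' N'n0 N's] N'Q Nw]].
    have [//|M'N'] := dich N' GN' N'Q.
    by have [M'0|->] := N's M' GM' M'N'.
  move=> /subM[u Mu /lpiP/spN uM].
  rewrite (_ : x = (-1) *: (u - x) + u); last by rewrite scaleN1r opprB subrK.
  by apply: Mset_lin => //; exact: Mset_le uM.
split; first by case: Mx.
apply: lspan_in; exists M'; split=> //; last by exists x.
split=> // N' GN' N'M'.
have [|M'N'] := dich N' GN' (subset_trans N'M' M'Q); first by left.
by right; apply/seteqP.
Qed.

End Chain.

(** * Compact induction and the Hecke operator *)

Section KRep.
Variables (p f : nat) (S : setting p f).
Hypothesis p_prime : prime p.
Local Notation G := ('M[L S]_2).

(** Additivity and multiplicativity are asked of elements of K only: an action through reduction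
    modulo p is multiplicative on integral matrices, not on all of G. *)
Record Krep (W : zmodType) (act : G -> W -> W) (M : set W) : Prop := KRep {
  kr_0 : M 0;
  kr_B : forall u v, M u -> M v -> M (u - v);
  kr_act : forall x v, inK x -> M v -> M (act x v);
  kr_add : forall x u v, inK x -> act x (u - v) = act x u - act x v;
  kr_mul : forall x y v, inK x -> inK y -> act (x *m y) v = act x (act y v);
  kr_1 : forall v, act 1%:M v = v
}.

Section Gen.
Variables (W : zmodType) (act : G -> W -> W) (M : set W).
Hypothesis KR : Krep act M.
Implicit Types (h : G -> W) (g x y : G) (v : W).

Lemma kr_act0 x : inK x -> act x 0 = 0.
Proof. by move=> Kx; have := kr_add KR 0 0 Kx; rewrite subr0 subrr. Qed.

Lemma bracket_ind g v : g \in unitmx -> M v -> ind act M (bracket act g v).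
Proof.
move=> ug Mv; rewrite /bracket; split.
- move=> g'; case: asboolP => // [h|_]; last exact: (kr_0 KR).
  by apply: (kr_act KR) => //; exact: (Kpart_inK p_prime).
- move=> g' ng; case: asboolP => // h; case/negP: ng.
  by have := inKZ_unit h; rewrite unitmx_mul => /andP[].
- move=> x g' Kx; rewrite -!mulmxA.
  case: asboolP => h; case: asboolP => h'; rewrite ?(Kpart_Kl _ Kx) ?kr_act0 //.
  + by rewrite (kr_mul KR) //; exact: (Kpart_inK p_prime).
  + by case: h'; apply: inKZ_invl h; exact: inK_KZ.
  + by case: h; apply: inKZ_mul h'; exact: inK_KZ.
- move=> g'; rewrite -scalemxAl.
  have eq : inKZ (p%:R *: (g' *m g)) <-> inKZ (g' *m g).
    rewrite -mul_scalar_mx; split; first exact: (inKZ_invl (inKZ_p S)).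
    exact: (inKZ_mul (inKZ_p S)).
  case: asboolP => h; case: asboolP => h' //; last 2 first.
  + by case: h'; apply/eq.
  + by case: h; apply/eq.
  by rewrite Kpart_p //; exact: inKZ_det.
- exists [:: invmx g] => g'; case: asboolP => [h _|]; last by rewrite eqxx.
  exists (invmx g); first by rewrite mem_head.
  by exists (g' *m g) => //; rewrite mulmxK.
Qed.

Lemma bracket_K g x v : inK x -> bracket act (g *m x) v = bracket act g (act x v).
Proof.
move=> Kx; apply: funext => g'; rewrite /bracket mulmxA.
have eq : inKZ (g' *m g *m x) <-> inKZ (g' *m g).
  split; first exact: (inKZ_invr (inK_KZ Kx)).
  by move=> h; apply: inKZ_mul => //; exact: inK_KZ.
case: asboolP => h; case: asboolP => h' //.
- by rewrite (Kpart_Kr _ Kx) (kr_mul KR) //; exact: (Kpart_inK p_prime).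
- by case: h'; apply/eq.
- by case: h; apply/eq.
Qed.

Lemma bracketB g u v : bracket act g (u - v) = bracket act g u - bracket act g v.
Proof.
apply: funext => g'; rewrite /bracket [RHS]/=.
rewrite -[RHS]/((if `[< inKZ (g' *m g) >] then act (Kpart (g' *m g)) u else 0) -
  (if `[< inKZ (g' *m g) >] then act (Kpart (g' *m g)) v else 0)).
case: asboolP => h; last by rewrite subrr.
by rewrite (kr_add KR) //; exact: (Kpart_inK p_prime).
Qed.

Lemma bracket0 g : bracket act g 0 = 0.
Proof. by rewrite -(subrr 0) bracketB subrr. Qed.

Lemma bracketD g u v : bracket act g (u + v) = bracket act g u + bracket act g v.
Proof.
have bN : bracket act g (- v) = - bracket act g v by rewrite -sub0r bracketB bracket0 sub0r.
by rewrite -{1}[v]opprK bracketB bN opprK.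
Qed.

Lemma bracket_sum g I (s : seq I) (Pr : pred I) (F : I -> W) :
  bracket act g (\sum_(i <- s | Pr i) F i) = \sum_(i <- s | Pr i) bracket act g (F i).
Proof. by apply: (big_morph (bracket act g)) => [u v|]; [exact: bracketD|exact: bracket0]. Qed.

Lemma ind0 : ind act M 0.
Proof.
split=> //; first by move=> g; exact: (kr_0 KR).
- by move=> x g Kx; rewrite [RHS]kr_act0.
- by exists [::] => g; rewrite eqxx.
Qed.

Lemma indB h h' : ind act M h -> ind act M h' -> ind act M (h - h').
Proof.
move=> [h1 h2 h3 h4 [s h5]] [h1' h2' h3' h4' [s' h5']].
have E g : (h - h') g = h g - h' g by [].
split.
- by move=> g; apply: (kr_B KR); [exact: h1|exact: h1'].
- by move=> g ng; rewrite E h2 // h2' // subrr.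
- by move=> x g Kx; rewrite !E h3 // h3' // (kr_add KR).
- by move=> g; rewrite !E h4 h4'.
- exists (s ++ s') => g; rewrite E => hg.
  have [e|n] := eqVneq (h g) 0.
    have : h' g != 0 by apply: contraNneq hg => e'; rewrite e e' subrr.
    by move=> /h5'[y ys' hy]; exists y; rewrite // mem_cat ys' orbT.
  by have [y ys hy] := h5 g n; exists y; rewrite // mem_cat ys.
Qed.

Lemma indN h : ind act M h -> ind act M (- h).
Proof. by move=> ih; rewrite -sub0r; apply: indB => //; exact: ind0. Qed.

Lemma indD h h' : ind act M h -> ind act M h' -> ind act M (h + h').
Proof. by move=> ih ih'; rewrite -[h']opprK; apply: indB => //; exact: indN. Qed.

Lemma ind_sum I (s : seq I) (Pr : pred I) (F : I -> G -> W) :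
  (forall i, Pr i -> ind act M (F i)) -> ind act M (\sum_(i <- s | Pr i) F i).
Proof. by move=> h; elim/big_ind: _; [exact: ind0|exact: indD|]. Qed.

Lemma ind_pz h (n : int) g : ind act M h -> h (p%:R ^ n *: g) = h g.
Proof.
move=> ih; have pos m g' : h (p%:R ^+ m *: g') = h g'.
  by elim: m g' => [|m IH] g'; rewrite ?expr0 ?scale1r // exprS -scalerA (ind_p ih).
case: n => m; first exact: pos.
rewrite NegzE -exprnN -(pos m.+1) scalerA mulfV ?scale1r //.
by rewrite expf_neq0 // (pL0 S).
Qed.

Lemma ind_KZ h x g : ind act M h -> inKZ x -> h (x *m g) = act (Kpart x) (h g).
Proof.
move=> ih KZx; have [n e] := KpartE x.
have -> : act (Kpart x) (h g) = h (Kpart x *m g).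
  by rewrite (ind_K ih) //; exact: (Kpart_inK p_prime).
by rewrite e -scalemxAl (ind_pz _ _ ih).
Qed.

(** Subtracting [y^-1, h(y)] deletes the coset KZ y from the support and changes no other value;
    inductions on the support rest on this. *)
Lemma peelE h y g : ind act M h -> y \in unitmx ->
  (h - bracket act (invmx y) (h y)) g =
  if `[< inKZ (g *m invmx y) >] then 0 else h g.
Proof.
move=> ih uy; rewrite -[LHS]/(h g - bracket act (invmx y) (h y) g) /bracket.
case: asboolP => hg; last by rewrite subr0.
by rewrite -(ind_KZ _ ih hg) mulmxKV // subrr.
Qed.

End Gen.

Lemma ind_map (W W' : zmodType) (act : G -> W -> W) (act' : G -> W' -> W')
    (M : set W) (M' : set W') (F : W -> W') h :
  F 0 = 0 -> (forall v, M v -> M' (F v)) ->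
  (forall x v, inK x -> M v -> F (act x v) = act' x (F v)) ->
  ind act M h -> ind act' M' (F \o h).
Proof.
move=> F0 FM Fa [h1 h2 h3 h4 [s h5]]; split => /=.
- by move=> g; apply: FM.
- by move=> g ng; rewrite h2.
- by move=> x g Kx; rewrite h3 // Fa.
- by move=> g; rewrite h4.
- by exists s => g hg; apply: h5; apply: contraNneq hg => ->; rewrite F0.
Qed.

Lemma bracket_map (W W' : zmodType) (act : G -> W -> W) (act' : G -> W' -> W')
    (F : W -> W') g v :
  F 0 = 0 -> (forall x, inK x -> F (act x v) = act' x (F v)) ->
  F \o bracket act g v = bracket act' g (F v).
Proof.
move=> F0 Fa; apply: funext => g' /=; rewrite /bracket.
by case: asboolP => h //; rewrite Fa //; exact: (Kpart_inK p_prime).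
Qed.

End KRep.

Section Congruence.
Variables (R : comNzRingType) (c : R).

Definition cong (x y : R) : Prop := exists z, x = y + c * z.

Lemma cong_refl x : cong x x. Proof. by exists 0; rewrite mulr0 addr0. Qed.

Lemma congM x y x' y' : cong x y -> cong x' y' -> cong (x * x') (y * y').
Proof. by move=> [z ->] [z' ->]; exists (y * z' + y' * z + c * z * z'); ring. Qed.

Lemma congX x y n : cong x y -> cong (x ^+ n) (y ^+ n).
Proof.
by move=> xy; elim: n => [|n IH]; [exact: cong_refl|rewrite !exprS; exact: congM].
Qed.

Lemma cong_prod I (s : seq I) (F F' : I -> R) : (forall i, cong (F i) (F' i)) ->
  cong (\prod_(i <- s) F i) (\prod_(i <- s) F' i).
Proof.
move=> h; elim: s => [|i s IH]; first by rewrite !big_nil; exact: cong_refl.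
by rewrite !big_cons; exact: congM.
Qed.

End Congruence.

(** * Coordinates in the monomial basis *)

Section Box.
Variables (R : comNzRingType) (f : nat) (r : 'I_f -> nat).

(** A common bound on all exponents gives a finite index type that does not depend on the ring;
    [in_box] selects the exponent vectors that occur. Coordinates over the valuation ring and over
    the residue field then share their indices. *)
Definition box := {ffun 'I_f -> 'I_(\max_i r i).+1}.
Definition in_box (a : box) : bool := [forall i, (a i <= r i)%N].
Definition box_mnm (a : box) : 'X_{1..f + f} := mnm_of (fun i => a i : nat) (fun i => r i - a i)%N.
Definition box_mono (a : box) : {mpoly R[f + f]} :=
  mono R (fun i => a i : nat) (fun i => r i - a i)%N.

Lemma box_mono_Vpoly a : in_box a -> Vpoly r (box_mono a).
Proof. by move=> /forallP h; apply: Vpoly_mono => i; have := h i; lia. Qed.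

Lemma Vpoly_expand P : Vpoly r P ->
  P = \sum_(a : box | in_box a) P@_(box_mnm a) *: box_mono a.
Proof.
move=> rP; apply/mpolyP => m; rewrite raddf_sum /=.
rewrite (eq_bigr (fun a => P@_m * (box_mnm a == m)%:R)) => [|a _]; last first.
  rewrite mcoeffZ /box_mono monoE mcoeffX -/(box_mnm a).
  by case: eqP => [->|_]; rewrite ?mulr0.
have [mP|mP] := boolP (m \in msupp P); last first.
  by rewrite (memN_msupp_eq0 mP) big1 // => a _; rewrite mul0r.
have rm := rP m mP.
have mr i : (m (lshift f i) < (\max_i r i).+1)%N.
  by rewrite ltnS; apply: leq_trans (leq_bigmax i); rewrite -rm leq_addr.
pose a : box := [ffun i => Ordinal (mr i)].
have am : box_mnm a = m.
  rewrite -[RHS]mnm_ofK /box_mnm; congr mnm_of; apply: funext => i; rewrite ffunE //=.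
  by rewrite -(rm i) addKn.
rewrite (bigD1 a) /=; last by apply/forallP => i; rewrite ffunE /= -(rm i) leq_addr.
rewrite am eqxx mulr1 big1 ?addr0 // => b /andP[_ ba]; case: eqP => [e|_]; last by rewrite mulr0.
case/eqP: ba; apply/ffunP => i; apply/val_inj; rewrite ffunE /=.
by have := mnm_of_l (fun i => b i : nat) (fun i => r i - b i)%N i; rewrite -/(box_mnm b) e.
Qed.

Lemma box_mnm_deg (P : {mpoly R[f + f]}) s a : Vpoly s P -> in_box a -> (exists i, s i != r i) -> P@_(box_mnm a) = 0.
Proof.
move=> sP /forallP ar [i si]; apply: memN_msupp_eq0; apply/negP => /sP/(_ i).
rewrite mnm_of_l mnm_of_r => e; case/eqP: si; rewrite -e; have := ar i; lia.
Qed.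

End Box.

(** * The substitutions of the Hecke operator modulo p *)

Section HeckePoly.
Variables (R : comNzRingType) (p f : nat) (r : 'I_f -> nat) (a0 : nat).
Hypothesis H : weight_data p r a0.
Local Notation q := (p ^ f)%N.
Local Notation polyO := {mpoly R[f + f]}.
Local Notation val_of := (@val_of p f).
Let p_prime := wd_prime H.
Let p_gt1 : (1 < p)%N := prime_gt1 p_prime.
Let p_gt0 : (0 < p)%N := prime_gt0 p_prime.
Let f_gt1 := wd_f H.
Let f_gt0 : (0 < f)%N := ltnW f_gt1.

(** Here [t] stands for minus a Teichmueller lift. *)
Definition AR (t : R) : polyO -> polyO :=
  psubst pX (fun i => t ^+ (p ^ i) *: pX i + p%:R *: pY i).
Definition BR : polyO -> polyO := psubst (fun i => p%:R *: pX i) pY.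
HB.instance Definition _ t := GRing.RMorphism.on (AR t).
HB.instance Definition _ := GRing.RMorphism.on BR.

Lemma Vpoly_pX (i : 'I_f) : Vpoly (fun j => (j == i) : nat) (pX i : {mpoly R[f + f]}).
Proof. by have := @Vpoly_linX R f 1 0 i; rewrite scale1r scale0r addr0. Qed.
Lemma Vpoly_pY (i : 'I_f) : Vpoly (fun j => (j == i) : nat) (pY i : {mpoly R[f + f]}).
Proof. by have := @Vpoly_linX R f 0 1 i; rewrite scale1r scale0r add0r. Qed.

Lemma AR_Vpoly s t P : Vpoly s P -> Vpoly s (AR t P).
Proof. by apply: Vpoly_psubst => i; [exact: Vpoly_pX|exact: Vpoly_linX]. Qed.
Lemma BR_Vpoly s P : Vpoly s P -> Vpoly s (BR P).
Proof.
by apply: Vpoly_psubst => i; [apply: VpolyZ; exact: Vpoly_pX|exact: Vpoly_pY].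
Qed.

Local Notation cng := (@cong polyO p%:R).

Lemma lin_mod_p (u : R) (i : 'I_f) : cng (u *: pX i + p%:R *: pY i) (u *: pX i).
Proof. by exists (pY i); rewrite -!mul_mpolyC mpolyC_nat. Qed.

Lemma AR_mono_mod t a b : (forall i, a i + b i = r i)%N ->
  cng (AR t (mono R a b)) (t ^+ val_of b *: mono R r (fun=> 0%N)).
Proof.
move=> abr; rewrite /AR psubst_mono.
have -> : t ^+ val_of b *: mono R r (fun=> 0%N) =
    \prod_(i < f) (pX i ^+ a i * (t ^+ (p ^ i) *: pX i) ^+ b i).
  rewrite /val_of expr_sum /mono -mul_mpolyC rmorph_prod -big_split.
  apply: eq_bigr => i _ /=; rewrite exprZn -exprM expr0 mulr1 -(abr i) exprD mulnC.
  by rewrite -mul_mpolyC; ring.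
apply: cong_prod => i; apply: congM; first exact: cong_refl.
by apply: congX; exact: lin_mod_p.
Qed.

Lemma BR_mono_mod a b : (exists i, a i != 0)%N -> cng (BR (mono R a b)) 0.
Proof.
move=> [i ai]; rewrite /BR psubst_mono.
have -> : 0 = \prod_(i < f) ((0 : polyO) ^+ a i * pY i ^+ b i).
  by rewrite (bigD1 i) //= expr0n (negbTE ai) !mul0r.
apply: cong_prod => j; apply: congM; last exact: cong_refl.
by apply: congX; exists (pX j); rewrite add0r -mul_mpolyC mpolyC_nat.
Qed.

Definition thetaR (i : 'I_f) : polyO :=
  pX i * pY (ord_pred i) ^+ p - pY i * pX (ord_pred i) ^+ p.

(** Modulo p the substitution replaces Y_j by t^(p^j) X_j. On such vectors both products in theta_i
    agree, with t^q = t taking care of the wrap-around. *)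
Lemma AR_theta t i : t ^+ q = t -> cng (AR t (thetaR i)) 0.
Proof.
move=> tq; rewrite /thetaR rmorphB !rmorphM !rmorphXn /= /AR !psubstX !psubstY.
have [z ez] := congX p (lin_mod_p (t ^+ (p ^ ord_pred i)) (ord_pred i)).
have ui : (t ^+ (p ^ ord_pred i)) ^+ p = t ^+ (p ^ i).
  rewrite -exprM -expnSr (ord_predE H); case: (posnP i) => [->|i0] /=.
    by rewrite prednK // tq expn0 expr1.
  by rewrite prednK.
rewrite ez exprZn ui; exists (pX i * z - pY i * pX (ord_pred i) ^+ p).
by rewrite -!mul_mpolyC !mpolyC_nat; ring.
Qed.

Lemma BR_theta i : cng (BR (thetaR i)) 0.
Proof.
rewrite /thetaR rmorphB !rmorphM !rmorphXn /= /BR !psubstX !psubstY exprZn.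
exists (pX i * pY (ord_pred i) ^+ p - pY i * (p%:R ^+ p.-1 *: pX (ord_pred i) ^+ p)).
have -> : (p%:R : R) ^+ p = p%:R * p%:R ^+ p.-1 by rewrite -exprS prednK.
by rewrite -!mul_mpolyC mpolyCM mpolyC_nat; ring.
Qed.

(* (T - a_p)[g, v0] is [g diag(1, p), Y^r] modulo p and a_p. *)
Definition v0 : polyO :=
  mono R (fun=> 0%N) r - mono R (fun=> p.-1) (fun i => r i - p.-1)%N.

Lemma p_le_r' i : (p.-1 <= r i)%N. Proof. by have := p_le_r H i; lia. Qed.

Lemma v0_Vpoly : Vpoly r v0.
Proof.
by apply: VpolyB; apply: Vpoly_mono => i //; have := p_le_r' i; lia.
Qed.

Lemma val_of_pred : val_of (fun=> p.-1) = q.-1.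
Proof.
have -> : val_of (fun=> p.-1) = (\sum_(0 <= j < f) p.-1 * p ^ j)%N by rewrite big_mkord.
by rewrite -big_distrr /= big_mkord -predn_exp.
Qed.

(** The two leading terms are t^(val r) X^r and t^(val r - (q-1)) X^r, and they agree because t^q =
    t and val r >= q. *)
Lemma AR_v0 t : t ^+ q = t -> cng (AR t v0) 0.
Proof.
move=> tq; rewrite /v0 rmorphB /=.
have [|z ->] := @AR_mono_mod t (fun=> 0%N) r; first by move=> i.
have [|z' ->] := @AR_mono_mod t (fun=> p.-1) (fun i => r i - p.-1)%N.
  by move=> i; have := p_le_r' i; lia.
have -> : t ^+ val_of (fun i => r i - p.-1)%N = t ^+ val_of r.
  rewrite val_of_sub => [|i]; last exact: p_le_r'.
  rewrite val_of_pred; have := val_r_ge H => h.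
  have -> : val_of r = (val_of r - q + q)%N by lia.
  have -> : (val_of r - q + q - q.-1 = val_of r - q + 1)%N by have := q_gt H; lia.
  by rewrite !exprD expr1 tq.
by exists (z - z'); ring.
Qed.

Lemma BR_v0 : cng (BR v0) (mono R (fun=> 0%N) r).
Proof.
rewrite /v0 rmorphB /=.
have [|z ->] := @BR_mono_mod (fun=> p.-1) (fun i => r i - p.-1)%N.
  by exists (Ordinal f_gt0); have := p_gt1; lia.
have -> : BR (mono R (fun=> 0%N) r) = mono R (fun=> 0%N) r.
  by rewrite /BR psubst_mono; apply: eq_bigr => i _; rewrite !expr0.
by exists (- z); ring.
Qed.

End HeckePoly.

Lemma map_thetaR (R R' : comNzRingType) p f (F : {rmorphism R -> R'}) (i : 'I_f) :
  map_mpoly F (thetaR R p i) = thetaR R' p i.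
Proof.
by rewrite /thetaR rmorphB !rmorphM !rmorphXn /= !map_pX !map_pY.
Qed.

(** * Integral models of the actions *)

Section Integral.
Variables (p f : nat) (S : setting p f) (r : 'I_f -> nat) (a0 : nat).
Hypothesis H : weight_data p r a0.
Local Notation q := (p ^ f)%N.
Local Notation O := (OE S).
Local Notation G := ('M[L S]_2).
Local Notation polyO := {mpoly (OE S)[f + f]}.
Local Notation io := (Defs.iota S).
Local Notation vL := (vL (s := S)).
Let p_prime := wd_prime H.
Let p_gt1 : (1 < p)%N := prime_gt1 p_prime.
Let p_gt0 : (0 < p)%N := prime_gt0 p_prime.
Let f_gt1 := wd_f H.
Let f_gt0 : (0 < f)%N := ltnW f_gt1.
Let r_ge := wd_r H.

(** Non-integral entries are replaced by a default value, so this is compared with [actE] and with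
    the reduced action under [inK]. *)
Definition actO (g : G) : polyO -> polyO :=
  pact (fun i => map_mx (fun a => toO (iter i (sigma S) a)) g).

Lemma emb_actO x P : inK x -> emb (actO x P) = actE x (emb P).
Proof.
move=> [ix _ _]; rewrite /actO emb_pact; apply: eq_pact => i.
by apply/matrixP => u v; rewrite !mxE /= toOK // vint_iter.
Qed.

Lemma red_actO x P : inK x -> red (actO x P) = Kact (gact (S := S)) x (red P).
Proof.
move=> [ix _ _]; rewrite /actO red_pact; apply: eq_pact => i.
by apply/matrixP => u v; rewrite !mxE /= redO_toO ?vint_iter // redL_iter // rmorphXn.
Qed.

Lemma iter_sigmaD i (x y : L S) :
  iter i (sigma S) (x + y) = iter i (sigma S) x + iter i (sigma S) y.
Proof. by elim: i => //= i ->; rewrite rmorphD. Qed.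
Lemma iter_sigmaM i (x y : L S) :
  iter i (sigma S) (x * y) = iter i (sigma S) x * iter i (sigma S) y.
Proof. by elim: i => //= i ->; rewrite rmorphM. Qed.
Lemma iter_sigma0 i : iter i (sigma S) (0 : L S) = 0.
Proof. by elim: i => //= i ->; rewrite rmorph0. Qed.
Lemma iter_sigma1 i : iter i (sigma S) (1 : L S) = 1.
Proof. by elim: i => //= i ->; rewrite rmorph1. Qed.

Lemma actE_comp (x y : G) P : actE (x *m y) P = actE x (actE y P).
Proof.
rewrite /actE pact_comp; apply: eq_pact => i.
apply/matrixP => u v; rewrite mulmx2 !mxE !big_ord_recl big_ord0 addr0.
have -> : lift ord0 ord0 = ord_max :> 'I_2 by exact/val_inj.
by rewrite iter_sigmaD !iter_sigmaM -!in_algE rmorphD !rmorphM.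
Qed.

Lemma actE_1 P : actE (1%:M : G) P = P.
Proof.
rewrite /actE -[RHS]pact_id; apply: eq_pact => i.
apply/matrixP => u v; rewrite !mxE; case: (u == v); rewrite /= ?mulr1n ?mulr0n.
  by rewrite iter_sigma1 scale1r.
by rewrite iter_sigma0 scale0r.
Qed.

Lemma actEZ (x : G) c P : actE x (c *: P) = c *: actE x P.
Proof. exact: linearZ. Qed.

Lemma KrepV : Krep (@actE p f S) (Vpoly r).
Proof.
split=> [|u v|x v _|x u v _|x y v _ _|v].
- exact: Vpoly0.
- exact: VpolyB.
- exact: Vpoly_pact.
- by rewrite /actE linearB.
- exact: actE_comp.
- exact: actE_1.
Qed.

Lemma KrepO : Krep (@actE p f S) (VOE r).
Proof.
split=> [|u v|x v Kx|x u v _|x y v _ _|v].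
- by apply/VOE_emb; exists 0; [exact: Vpoly0|rewrite emb0].
- move=> /VOE_emb[P rP ->] /VOE_emb[P' rP' ->]; apply/VOE_emb.
  by exists (P - P'); [exact: VpolyB|rewrite embB].
- move=> /VOE_emb[P rP ->]; apply/VOE_emb; exists (actO x P); first exact: Vpoly_pact.
  by rewrite emb_actO.
- by rewrite /actE linearB.
- exact: actE_comp.
- exact: actE_1.
Qed.

Lemma redL_1mx : map_mx (@redL _ _ S) (1%:M : G) = 1%:M.
Proof.
apply/matrixP => u v; rewrite !mxE; case: (u == v); rewrite /= ?mulr1n ?mulr0n.
  exact: (red_1 (redL_residue S)).
exact: (red0 (redL_residue S)).
Qed.

Lemma Krepk : Krep (Kact (gact (S := S))) (Vpoly r).
Proof.
split=> [|u v|x v Kx|x u v _|x y v [ix _ _] [iy _ _]|v].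
- exact: Vpoly0.
- exact: VpolyB.
- exact: Vpoly_pact.
- by rewrite /Kact /gact linearB.
- by rewrite /Kact (redL_mul ix iy) (gact_comp H).
- rewrite /Kact redL_1mx /gact -[RHS]pact_id; apply: eq_pact => i.
  apply/matrixP => u w; rewrite !mxE; case: (u == w); rewrite /= ?mulr1n ?mulr0n.
    by rewrite rmorph1 expr1n.
  by rewrite rmorph0 expr0n (gtn_eqF (expp_gt0 H i)).
Qed.

Definition tO (l : Fq S) : O := toO (teich l).

Lemma vint_teich l : vint vL (teich l : L S). Proof. by have [] := teichP l. Qed.

Lemma val_tO l : val (tO l) = (teich l)%:A.
Proof. by rewrite toOK // vint_teich. Qed.

Lemma red_tO l : redO (tO l) = io l.
Proof. by rewrite redO_toO ?vint_teich //; have [_ ->] := teichP l. Qed.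

Lemma tOq l : tO l ^+ q = tO l.
Proof.
apply: val_inj; rewrite rmorphXn /= val_tO -[LHS]/((in_alg (E S) (teich l)) ^+ q).
by rewrite -rmorphXn; have [_ _ ->] := teichP l.
Qed.

Lemma odd_p : odd p.
Proof. by case: (boolP (odd p)) => // /(prime_oddPn p_prime) e; have := wd_gt2 H; rewrite e. Qed.

Lemma NtOq l : (- tO l) ^+ q = - tO l.
Proof.
by rewrite exprNn -signr_odd oddX odd_p orbT expr1 mulN1r tOq.
Qed.

Definition AO (l : Fq S) : polyO -> polyO := @AR O p f (- tO l).
Definition BO : polyO -> polyO := @BR O p f.

Lemma emb_AO l P : emb (AO l P) = AE l (emb P).
Proof.
rewrite emb_psubst; apply: eq_psubst => i /=; first exact: emb_pX.
rewrite embD !embZ emb_pX emb_pY.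
by rewrite rmorphXn rmorphN rmorph_nat /= val_tO.
Qed.

Lemma emb_BO P : emb (BO P) = BE (emb P).
Proof.
rewrite emb_psubst; apply: eq_psubst => i /=; last exact: emb_pY.
by rewrite embZ emb_pX rmorph_nat.
Qed.

Lemma mcoeff_red (P : polyO) m : (red P)@_m = redO P@_m.
Proof. exact: mcoeff_map_mpoly. Qed.

Lemma AOM l P Q : AO l (P * Q) = AO l P * AO l Q.
Proof. exact: rmorphM. Qed.
Lemma BOM P Q : BO (P * Q) = BO P * BO Q.
Proof. exact: rmorphM. Qed.
Lemma actO_Vpoly s x P : Vpoly s P -> Vpoly s (actO x P).
Proof. by move=> sP; exact: Vpoly_pact. Qed.

Lemma actO_w a b : actO (mx22 0 1 1 0) (mono O a b) = mono O b a.
Proof.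
rewrite /actO /pact psubst_mono /mono; apply: eq_bigr => i _.
rewrite !mxE /= iter_sigma0 iter_sigma1.
have -> : toO (0 : L S) = 0.
  by apply: val_inj; rewrite toOK ?vint0 // scale0r rmorph0.
have -> : toO (1 : L S) = 1.
  by apply: val_inj; rewrite toOK ?vint1 // scale1r rmorph1.
by rewrite !scale0r !scale1r add0r addr0 mulrC.
Qed.

Lemma val_mulpI (x : O) : p%:R * x = 0 -> x = 0.
Proof.
move=> /(congr1 val); rewrite rmorphM rmorph_nat rmorph0 => /eqP.
by rewrite mulf_eq0 (negbTE (pE0 S)) /= => /eqP e; apply: val_inj.
Qed.

Lemma Vpoly_divp s (P : polyO) : Vpoly s (p%:R * P) -> Vpoly s P.
Proof.
move=> h m; rewrite mcoeff_msupp => Pm; apply: h; rewrite mcoeff_msupp.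
rewrite -mpolyC_nat mcoeffCM; apply: contra Pm => /eqP h; apply/eqP; exact: val_mulpI.
Qed.

Lemma red_thetaO i : red (thetaR O p i) = theta S i.
Proof. exact: map_thetaR. Qed.

End Integral.

(** * The weight Q_(f-1) / Q_(f-2) *)

Section GradedPiece.
Variables (p f : nat) (S : setting p f) (r : 'I_f -> nat) (a0 : nat).
Hypothesis H : weight_data p r a0.
Local Notation q := (p ^ f)%N.
Local Notation k := (Fpbar S).
Local Notation io := (Defs.iota S).
Local Notation val_of := (@val_of p f).
Local Notation dig := (@dig p f).
Local Notation mono := (mono k).
Local Notation Qamb := (Qamb S r).
Local Notation EQ := (@EQ p f S r).
Local Notation eQ := (@eQ p f S r).
Local Notation wmx := (@wmx p f S).
Local Notation umx := (@umx p f S).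
Local Notation tmx := (@tmx p f S).
Local Notation Qact := (@Qact p f S r).
Let p_prime := wd_prime H.
Let p_gt1 : (1 < p)%N := prime_gt1 p_prime.
Let p_gt0 : (0 < p)%N := prime_gt0 p_prime.
Let f_gt1 := wd_f H.
Let f_gt0 : (0 < f)%N := ltnW f_gt1.
Let r_ge := wd_r H.

Local Notation ellQ := (@ellQ p f S r a0).
Local Notation Mset := (@Mset p f S r a0).
Let i0 : 'I_f := Ordinal f_gt0.
Let i1 : 'I_f := Ordinal f_gt1.
Local Notation NN := (@Qfil p f S r (f - 2)).
Local Notation pi := (lpi NN).
Local Notation Qga := (@Qgr_act p f S r (f - 2)).

Lemma NN_Mset x : NN x <-> Mset 2 x.
Proof.
have := Qfil_Mset H (leq_subr 2 f) x.
by have -> : (f - (f - 2) = 2)%N by have := f_gt1; lia.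
Qed.

Lemma NN1_Mset x : @Qfil p f S r (f - 2).+1 x <-> Mset 1 x.
Proof.
have h : ((f - 2).+1 <= f)%N by have := f_gt1; lia.
have := Qfil_Mset H h x.
by have -> : (f - (f - 2).+1 = 1)%N by have := f_gt1; lia.
Qed.

Lemma span_NN v : lspan NN v <-> Mset 2 v.
Proof.
split=> [|/NN_Mset]; last exact: lspan_in.
apply: (lspan_min (N := Mset 2)); first exact: (Mset0 S H).
  by move=> c u w; exact: (Mset_lin H).
by move=> w /NN_Mset.
Qed.

Lemma pi_eq0 v : pi v = 0 <-> Mset 2 v.
Proof. by rewrite lpi_eq0 span_NN. Qed.

Lemma pi_eq v w : pi v = pi w <-> Mset 2 (v - w).
Proof. by rewrite lpiP span_NN. Qed.

Lemma Qga_pi g v : g \in unitmx -> Qga g (pi v) = pi (Qact g v).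
Proof.
move=> ug; apply: lquot_act_pi; first exact: (Qact_lin H).
by move=> w /span_NN h; apply/span_NN; apply: (Mset_act H).
Qed.

Lemma Qga_lin g : g \in unitmx -> linear (Qga g).
Proof.
move=> ug; apply: lquot_act_linear; first exact: (Qact_lin H).
by move=> w /span_NN h; apply/span_NN; apply: (Mset_act H).
Qed.

(** The n for which e_n lies in M_1 but not in M_2; they label a basis of Q_(f-1) / Q_(f-2). *)
Definition lev12 n := [&& (a0 <= n < q), n %% p < a0 & a0 <= n %% p ^ 2]%N.

Lemma pi_sep v w : Mset 1 v -> Mset 1 w ->
  (forall n, lev12 n -> ellQ n v = ellQ n w) -> pi v = pi w.
Proof.
move=> Mv Mw h; apply/pi_eq.
have [Qvw h1] : Mset 1 (v - w).
  have := Mset_lin H (-1) Mw Mv; rewrite scaleN1r addrC //.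
split=> // n hn hn2; have [n1|n1] := leqP a0 (n %% p); first by apply: h1; rewrite ?expn1.
have := h n; rewrite /lev12 hn n1 hn2 => /(_ isT) e.
by rewrite -scaleN1r addrC (ellQ_lin H) // e mulN1r addNr.
Qed.

Definition del (j : 'I_f) : nat := (j == i1).
(** An index in [lev12] has digit 0 below a0 and digit 1 nonzero, the others being free. After
    subtraction of p its digits range exactly over the box below [sw]. *)
Definition sw (j : 'I_f) : nat :=
  if j == i0 then a0.-1 else if j == i1 then p.-2 else p.-1.

Lemma i01 : i0 != i1. Proof. by []. Qed.

Lemma sw_lt j : (sw j + del j < p)%N.
Proof.
have := wd_gt2 H; have := a0_lt_p H; rewrite /sw /del.
case: eqP => [->|_]; first by rewrite (negbTE i01); lia.
by case: eqP => _; lia.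
Qed.

Lemma sw_ltp j : (sw j < p)%N. Proof. by have := sw_lt j; lia. Qed.

Lemma val_del : val_of del = p.
Proof.
rewrite -[RHS]expn1 -[RHS]mul1n -(@val_of_delta p f i1 1).
by apply: eq_bigr => j _; rewrite mul1n.
Qed.

Lemma val_sw : (val_of sw + 2 * p = q.-1 + a0)%N.
Proof.
have := val_of_top H (e := 1) f_gt0; rewrite expn1 => h.
have a0p := a0_lt_p H; have a01 := wd_a0 H; have qp := q_gt H.
have -> : (val_of sw + 2 * p = val_of (fun j => sw j + del j)%N + p)%N.
  by rewrite val_of_add val_del; lia.
have -> : val_of (fun j => sw j + del j)%N =
    val_of (fun i : 'I_f => if i == 0 :> nat then a0.-1 else if (i < 1)%N then 0%N else p.-1).
  apply: eq_bigr => j _; congr (_ * _)%N; rewrite /sw /del -!val_eqE /=.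
  by case: eqP => [->|j0]; [lia|case: eqP => j1; rewrite ltnS leqn0; case: eqP; have := wd_gt2 H; lia].
rewrite h; lia.
Qed.

Lemma lev12_dig n : lev12 n -> (p <= n)%N /\
  (forall j, dig (n - p) j <= sw j)%N /\ (forall j, dig n j = dig (n - p) j + del j)%N.
Proof.
move=> /and3P[/andP[an nq] n1 n2].
have modS : (n %% p ^ 2 = n %% p + (n %/ p %% p) * p)%N.
  by have := digsum_dig p_gt1 n 2; rewrite big_nat_recr //= big_nat1 expn0 divn1 muln1 expn1.
have d1 : (0 < n %/ p %% p)%N.
  by rewrite lt0n; apply/eqP => e; move: n2; rewrite modS e; lia.
have dn1 : (0 < dig n i1)%N by rewrite /(dig _ _) /= expn1.
have pn : (p <= n)%N by rewrite leqNgt; apply/negP => h; move: d1; rewrite divn_small // mod0n.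
have e j : dig (n - p) j = (dig n j - del j)%N.
  have ap i : (dig n i - del i < p)%N by have := dig_lt p_gt1 n i; lia.
  rewrite -(dig_val_of p_gt1 j ap); congr (dig _ j).
  rewrite val_of_sub ?val_del ?val_of_dig // => i; rewrite /del.
  by case: eqP => [->|].
split=> //; split=> j; rewrite e; last by rewrite subnK // /del; case: eqP => [->|].
have := dig_lt p_gt1 n j; rewrite /sw /del.
have [->|_] := eqVneq j i0; last by case: eqP => _; lia.
by rewrite (negbTE i01) /(dig _ _) /= expn0 divn1; lia.
Qed.

Lemma lev12_val b : (forall j, b j <= sw j)%N -> lev12 (val_of b + p)%N.
Proof.
move=> bs; have a0p := a0_lt_p H.
have bp j : (b j + del j < p)%N by apply: leq_ltn_trans (sw_lt j); rewrite leq_add2r; exact: bs.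
have vE : (val_of b + p = val_of (fun j => b j + del j))%N by rewrite val_of_add val_del.
have vq := val_of_lt p_gt1 bp; rewrite -vE in vq.
have d0 : ((val_of b + p) %% p = b i0)%N.
  have := dig_val_of p_gt1 i0 bp; rewrite -vE /(dig _ _) /= expn0 divn1 => ->.
  by rewrite /del (negbTE i01) addn0.
have d1 : ((val_of b + p) %/ p %% p = b i1 + 1)%N.
  by have := dig_val_of p_gt1 i1 bp; rewrite -vE /(dig _ _) /= expn1 => ->; rewrite /del eqxx.
have modS : ((val_of b + p) %% p ^ 2 = b i0 + (b i1 + 1) * p)%N.
  have := digsum_dig p_gt1 (val_of b + p) 2.
  by rewrite big_nat_recr //= big_nat1 expn0 divn1 muln1 expn1 d0 d1.
apply/and3P; split; [by rewrite vq andbT; lia| |by rewrite modS; nia].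
by rewrite d0; have := bs i0; have := wd_a0 H; rewrite /sw eqxx; lia.
Qed.

Lemma ffun_sum_digits (F : ('I_f -> nat) -> k) n : (n < q)%N ->
  \sum_(b : {ffun 'I_f -> 'I_p}) F (fun i => b i) * (val_of (fun i => b i) == n)%:R =
  F (dig n).
Proof.
move=> nq; pose b' : {ffun 'I_f -> 'I_p} := [ffun i => Ordinal (dig_lt p_gt1 n i)].
have bE : (fun i => b' i : nat) = dig n by apply: funext => i; rewrite ffunE.
rewrite (bigD1 b') //= bE val_of_dig // eqxx mulr1 big1 ?addr0 // => b bb.
case: eqP => e; last by rewrite mulr0.
case/eqP: bb; apply/ffunP => i; rewrite ffunE; apply/val_inj => /=.
by rewrite -e dig_val_of // => j; exact: ltn_ord.
Qed.

(** The factor 1 / (b_1 + 1) is imposed by the unipotent matrices: C(b_1 + 1, d_1 + 1) = C(b_1, d_1)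
    (b_1 + 1) / (d_1 + 1), and the shift by [del] raises digit 1 by one. *)
Definition phi0 (P : {mpoly k[f + f]}) : Qamb :=
  \sum_(b : {ffun 'I_f -> 'I_p}) (P@_(mnm_of (fun j => b j : nat) (fun j => sw j - b j)%N) *
    (b i1).+1%:R^-1) *: EQ (fun j => b j + del j)%N.

Lemma phi0_lin c P Q : phi0 (c *: P + Q) = c *: phi0 P + phi0 Q.
Proof.
rewrite /phi0 scaler_sumr -big_split; apply: eq_bigr => b _ /=.
by rewrite mcoeffD mcoeffZ mulrDl -mulrA scalerDl scalerA.
Qed.

Lemma coef_sw (P : {mpoly k[f + f]}) (b : {ffun 'I_f -> 'I_p}) : Vpoly sw P ->
  P@_(mnm_of (fun j => b j : nat) (fun j => sw j - b j)%N) <> 0 ->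
  forall j, (b j <= sw j)%N.
Proof.
move=> sP /eqP nz j; rewrite -mcoeff_msupp in nz.
by have := sP _ nz j; rewrite mnm_of_l mnm_of_r; lia.
Qed.

Lemma ellQ_phi0 n (P : {mpoly k[f + f]}) : Vpoly sw P -> lev12 n -> ellQ n (phi0 P) =
  P@_(mnm_of (dig (n - p)) (fun j => sw j - dig (n - p) j)%N) * (dig (n - p) i1).+1%:R^-1.
Proof.
move=> sP ln; have [pn [ds dn]] := lev12_dig ln; have /and3P[hn _ _] := ln.
rewrite (ellQ_sum H) //.
pose F (b : 'I_f -> nat) := P@_(mnm_of b (fun j => sw j - b j)%N) * (b i1).+1%:R^-1.
rewrite -[RHS]/(F (dig (n - p))) -ffun_sum_digits; last by move: hn; lia.
apply: eq_bigr => b _; rewrite (ellQZ H) //.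
have [e|/eqP nz] := eqVneq (P@_(mnm_of (fun j => b j : nat) (fun j => sw j - b j)%N)) 0.
  by rewrite /F e !mul0r.
have bs := coef_sw sP nz.
have bp j : (b j + del j < p)%N by apply: leq_ltn_trans (sw_lt j); rewrite leq_add2r; exact: bs.
rewrite (ellQ_EQ S H) // val_of_add val_del; congr (_ * _%:R).
by rewrite -[in RHS](eqn_add2r p) subnK.
Qed.

Lemma phi0_M1 (P : {mpoly k[f + f]}) : Vpoly sw P -> Mset 1 (phi0 P).
Proof.
move=> sP; apply: (Mset_sum H) => b _ nz.
have {}nz : P@_(mnm_of (fun j => b j : nat) (fun j => sw j - b j)%N) <> 0.
  by move=> e; apply: nz; rewrite e mul0r.
have bs := coef_sw sP nz.
have bp j : (b j + del j < p)%N by apply: leq_ltn_trans (sw_lt j); rewrite leq_add2r; exact: bs.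
apply: (Mset_EQ S H) => //; rewrite expn1 val_of_add val_del.
by have /and3P[_ h _] := lev12_val bs.
Qed.

Definition phi : {mpoly k[f + f]} -> Qgr_amb S r (f - 2) := fun P => pi (phi0 P).

Lemma phi_is_linear : linear phi.
Proof. by move=> c P Q; rewrite /phi phi0_lin lpiD lpiZ. Qed.
HB.instance Definition _ := GRing.isLinear.Build k {mpoly k[f + f]}
  (Qgr_amb S r (f - 2)) *:%R phi phi_is_linear.

Lemma mcoeff_mono_dig a d : (forall j, a j < p)%N -> (forall j, d j < p)%N ->
  (mono a (fun j => sw j - a j)%N)@_(mnm_of d (fun j => sw j - d j)%N) =
  (val_of a == val_of d)%:R.
Proof.
move=> ap dp; rewrite monoE mcoeffX; congr (_%:R); apply: congr1; apply/eqP/eqP => [/mnm_of_inj[e _]|e].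
  by apply: eq_bigr => i _; rewrite e.
by have -> : a = d by apply: funext; exact: (val_of_inj p_gt1 ap dp e).
Qed.

Lemma phi0_mono b : (forall j, b j <= sw j)%N ->
  phi0 (mono b (fun j => sw j - b j)%N) = (b i1).+1%:R^-1 *: EQ (fun j => b j + del j)%N.
Proof.
move=> bs; have bp j : (b j < p)%N by have := bs j; have := sw_ltp j; lia.
pose b' : {ffun 'I_f -> 'I_p} := [ffun i => Ordinal (bp i)].
have bE : (fun i => b' i : nat) = b by apply: funext => i; rewrite ffunE.
rewrite /phi0 (bigD1 b') //= big1 => [|c cb].
  rewrite addr0; have -> : mnm_of (fun j => b' j : nat) (fun j => sw j - b' j)%N =
      mnm_of b (fun j => sw j - b j)%N.
    by congr mnm_of; apply: funext => j; rewrite ffunE.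
  rewrite mcoeff_mono_dig // eqxx mul1r ffunE /=.
  by congr (_ *: _); apply: eq_EQ => j; rewrite ffunE.
rewrite (@mcoeff_mono_dig b (fun j => c j) bp (fun j => ltn_ord (c j))); case: eqP => e; last by rewrite mul0r scale0r.
case/eqP: cb; apply/ffunP => i; rewrite ffunE; apply/val_inj => /=.
exact/esym/(val_of_inj p_gt1 bp _ e).
Qed.

Lemma wact_lin m g c P Q : wact m g (c *: P + Q) = c *: wact m g P + wact (S := S) m g Q.
Proof. by rewrite /wact gact_linear scalerDr !scalerA mulrC. Qed.

(** Monomials and generators suffice. On the torus the twist det^p makes up for the shift of indices
    by p; for the unipotent matrices see the factor in [phi0]; for w the sign (-1)^p = -1 agrees
    with sw_1 - b_1 + 1 = -(b_1 + 1) modulo p. *)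
Lemma phi_equiv g (P : {mpoly k[f + f]}) : g \in unitmx -> Vpoly sw P -> phi (wact p g P) = Qga g (phi P).
Proof.
move=> ug; move: g ug P.
have gen g : g \in unitmx -> (forall b, (forall j, b j <= sw j)%N ->
    phi (wact p g (mono b (fun j => sw j - b j)%N)) =
    Qga g (phi (mono b (fun j => sw j - b j)%N))) ->
    forall P, Vpoly sw P -> phi (wact p g P) = Qga g (phi P).
  move=> ug h; apply: Vpoly_ind => [|c P Q eP eQ'|a as'].
  - have lin := Qga_lin ug; have := lin (-1) 0 0; rewrite scaler0 addr0 => e0.
    have e1 : wact p g (0 : {mpoly k[f + f]}) = 0.
      by have := wact_lin p g (-1) 0 0; rewrite scaler0 addr0 scaleN1r addNr.
    by rewrite e1 linear0 {1}e0 scaleN1r addNr.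
  - rewrite wact_lin (phi_is_linear c (wact p g P)) eP eQ'.
    by rewrite (phi_is_linear c P) (Qga_lin ug).
  - exact: h.
apply: bruhat_ind => [g h ug uh Pg Ph P sP|a d a0' d0|c|].
- have -> : wact p (g *m h) P = wact p g (wact p h P).
    rewrite /wact -(gact_comp H) det_mulmx rmorphM exprMn -scalerA; congr (_ *: _).
    by rewrite /gact linearZ.
  have sh : Vpoly sw (wact p h P) by apply: VpolyZ; rewrite /gact; exact: Vpoly_pact.
  have ugh : g *m h \in unitmx by rewrite unitmx_mul ug.
  by rewrite (Pg _ sh) (Ph _ sP) /phi (Qga_pi _ uh) (Qga_pi _ ug) (Qga_pi _ ugh) (Qact_comp H _ ug uh).
- have ut := unit_tmx (S := S) a0' d0; apply: gen => // b bs.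
  have bp j : (b j + del j < p)%N by apply: leq_ltn_trans (sw_lt j); rewrite leq_add2r; exact: bs.
  have vb : (val_of b <= val_of sw)%N by apply: leq_sum => j _; rewrite leq_mul2r bs orbT.
  have vq := val_of_lt p_gt1 bp; rewrite val_of_add val_del in vq.
  have vr := val_r_ge H.
  rewrite /phi (Qga_pi _ ut) /wact (gact_t H) scalerA -[_ *: mono _ _]addr0 phi0_lin.
  have -> : phi0 0 = 0 by rewrite /phi0 big1 // => c _; rewrite mcoeff0 mul0r scale0r.
  rewrite addr0 phi0_mono // (EQ_eQ_val S H bp) val_of_add val_del.
  have := Qact_lin H ut (b i1).+1%:R^-1 (eQ (val_of b + p)) 0.
  have -> : Qact (tmx a d) 0 = 0.
    by have := Qact_lin H ut (-1) 0 0; rewrite scaler0 addr0 scaleN1r addNr.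
  rewrite !addr0 => ->; rewrite (Qact_t H a0' d0 vq) !scalerA; congr (pi (_ *: _)).
  rewrite det_mx22 mul0r subr0 rmorphM exprMn val_of_sub //.
  have -> : io d ^+ (val_of r - (val_of b + p)) = io d ^+ (p + (val_of sw - val_of b)).
    rewrite -!rmorphXn; congr (io _); apply: (exp_modq H); [by lia|by lia|].
    have := val_sw; have := val_r_mod H => e1 e2.
    apply/eqP; rewrite -(eqn_modDr (val_of b + p)) subnK; last by lia.
    rewrite (_ : (p + (val_of sw - val_of b) + (val_of b + p) = q.-1 + a0)%N); last by lia.
    by rewrite modnDl e1.
  by rewrite !exprD; ring.
- have uu := unit_umx (S := S) c; apply: gen => // b bs.
  have bp j : (b j + del j < p)%N by apply: leq_ltn_trans (sw_lt j); rewrite leq_add2r; exact: bs.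
  have bp' j : (b j < p)%N by have := bp j; lia.
  rewrite /phi (Qga_pi _ uu).
  have sP : Vpoly sw (wact p (umx c) (mono b (fun j => sw j - b j)%N)).
    apply: VpolyZ; rewrite /gact; apply: Vpoly_pact; apply: Vpoly_mono => j.
    by have := bs j; lia.
  have sb : Vpoly sw (mono b (fun j => sw j - b j)%N).
    by apply: Vpoly_mono => j; have := bs j; lia.
  apply: pi_sep; [exact: phi0_M1|by apply: (Mset_act H) => //; exact: phi0_M1|].
  move=> n ln; have [pn [ds dn]] := lev12_dig ln; have /and3P[hn _ _] := ln.
  rewrite ellQ_phi0 // phi0_mono //.
  have := Qact_lin H uu (b i1).+1%:R^-1 (EQ (fun j => b j + del j)%N) 0.
  have -> : Qact (umx c) 0 = 0.
    by have := Qact_lin H uu (-1) 0 0; rewrite scaler0 addr0 scaleN1r addNr.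
  rewrite !addr0 => ->; rewrite (ellQZ H) // (Qact_u H _ bp) (ellQ_sum H) //.
  set co := fun (a d : 'I_f -> nat) => \prod_(i < f) ('C(a i, d i)%:R * io c ^+ (p ^ i * (a i - d i))) : k.
  have -> : \sum_(b' : {ffun 'I_f -> 'I_p}) ellQ n (\prod_(i < f)
      ('C(b i + del i, b' i)%:R * io c ^+ (p ^ i * (b i + del i - b' i))) *:
      EQ (fun i => b' i)) = co (fun j => b j + del j)%N (dig n).
    have /andP[_ nq] := hn.
    rewrite -(ffun_sum_digits (co (fun j => b j + del j)%N) nq); apply: eq_bigr => b' _.
    by rewrite (ellQZ H) // (ellQ_EQ S H).
  have dp j : (dig (n - p) j < p)%N by exact: dig_lt.
  have -> : (wact p (umx c) (mono b (fun j => sw j - b j)%N))@_(mnm_of (dig (n - p))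
      (fun j => sw j - dig (n - p) j)%N) = co b (dig (n - p)).
    rewrite /wact det_mx22 mul0r subr0 mulr1 rmorph1 expr1n scale1r (gact_u_expg H) //.
    have np : (n - p < q)%N by move: hn; lia.
    rewrite raddf_sum -(ffun_sum_digits (co b) np); apply: eq_bigr => b' _ /=.
    by rewrite mcoeffZ mcoeff_mono_dig // val_of_dig.
  have nz m : (m < p)%N -> (0 < m)%N -> m%:R != 0 :> k.
    by move=> mp m0; rewrite -(dvdn_pcharf (char_k S)) gtnNdvd.
  have b1 := bp i1; rewrite /del eqxx addn1 in b1.
  have d1 : ((dig (n - p) i1).+1 < p)%N.
    by have := ds i1; have := sw_lt i1; rewrite /del eqxx; lia.
  apply: (mulfI (nz _ b1 isT)); apply: (mulIf (nz _ d1 isT)).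
  rewrite mulrA mulfVK ?nz // mulVKf ?nz //.
  rewrite /co (bigD1 i1) //= [in RHS](bigD1 i1) //= dn /del eqxx !addn1 subSS.
  rewrite [X in _ = _ * X * _](eq_bigr (fun i => 'C(b i, dig (n - p) i)%:R *
      io c ^+ (p ^ i * (b i - dig (n - p) i)))) => [|i /negbTE ni]; last first.
    by rewrite dn /del ni !addn0.
  have := mul_bin_diag (b i1).+1 (dig (n - p) i1); rewrite /= => /(congr1 (fun m => m%:R : k)).
  rewrite !natrM; set X := \prod_(i < f | _) _; set Y := io c ^+ _ => e.
  rewrite mulrA mulrA e; ring.
- have uw := unit_wmx S; apply: gen => // b bs.
  have bp j : (b j + del j < p)%N by apply: leq_ltn_trans (sw_lt j); rewrite leq_add2r; exact: bs.
  rewrite /phi (Qga_pi _ uw).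
  have odd_p : odd p.
    by case: (boolP (odd p)) => // /(prime_oddPn p_prime) e; have := wd_gt2 H; rewrite e.
  have -> : wact p wmx (mono b (fun j => sw j - b j)%N) =
      (-1) *: mono (fun j => sw j - b j)%N (fun j => sw j - (sw j - b j))%N + 0.
    rewrite /wact (gact_w S H) det_mx22 mul0r sub0r mulr1 rmorphN rmorph1.
    rewrite -signr_odd odd_p expr1 addr0; congr (_ *: _); apply: eq_mono => j //.
    by have := bs j; lia.
  rewrite phi0_lin.
  have -> : phi0 0 = 0 by rewrite /phi0 big1 // => c _; rewrite mcoeff0 mul0r scale0r.
  rewrite addr0 phi0_mono => [|j]; last exact: leq_subr.
  rewrite phi0_mono // (EQ_eQ_val S H bp).
  have := Qact_lin H uw (b i1).+1%:R^-1 (eQ (val_of (fun j => b j + del j)%N)) 0.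
  have -> : Qact wmx 0 = 0.
    by have := Qact_lin H uw (-1) 0 0; rewrite scaler0 addr0 scaleN1r addNr.
  rewrite !addr0 => ->.
  have /and3P[hn _ _] := lev12_val bs.
  rewrite val_of_add val_del (Qact_w S H) // scalerA.
  have sbp j : (sw j - b j + del j < p)%N by have := bs j; have := sw_lt j; lia.
  rewrite (EQ_eQ_val S H sbp) val_of_add val_del val_of_sub //.
  have vb : (val_of b <= val_of sw)%N by apply: leq_sum => j _; rewrite leq_mul2r bs orbT.
  have -> : (val_of sw - val_of b + p = q.-1 + a0 - (val_of b + p))%N.
    by have := val_sw; lia.
  congr (pi (_ *: _)).
  have b1 := bs i1; rewrite /sw /= in b1.
  have e : (sw i1 - b i1).+1%:R = - (b i1).+1%:R :> k.
    apply/eqP; rewrite -addr_eq0 -natrD /sw /=.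
    have -> : ((p.-2 - b i1).+1 + (b i1).+1 = p)%N by have := wd_gt2 H; lia.
    by rewrite (p_eq0 S).
  by rewrite e invrN mulN1r opprK.
Qed.

Lemma phi_inj (P : {mpoly k[f + f]}) : Vpoly sw P -> phi P = 0 -> P = 0.
Proof.
move=> sP /pi_eq0[_ h]; apply/mpolyP => m; rewrite mcoeff0.
have [mP|mP] := boolP (m \in msupp P); last exact: memN_msupp_eq0.
have sm := sP m mP; pose b j := m (lshift f j).
have bs j : (b j <= sw j)%N by rewrite -sm leq_addr.
have bp j : (b j < p)%N by have := bs j; have := sw_ltp j; lia.
have ln := lev12_val bs; have /and3P[hn _ h2] := ln.
have := h _ hn h2; rewrite ellQ_phi0 // addnK.
have dE : dig (val_of b) = b by apply: funext => j; rewrite dig_val_of.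
rewrite dE => /eqP; rewrite mulf_eq0 invr_eq0.
have -> : mnm_of b (fun j => sw j - b j)%N = m.
  rewrite -[RHS]mnm_ofK; congr mnm_of; apply: funext => j.
  by rewrite -sm addKn.
rewrite -(dvdn_pcharf (char_k S)) gtnNdvd ?orbF //; first by move/eqP.
by have := bs i1; have := sw_lt i1; rewrite /del eqxx; lia.
Qed.

Lemma phi_image : (phi @` Vpoly sw)%classic = @Qgr p f S r (f - 2).
Proof.
apply/seteqP; split=> [_ [P sP <-]|_ [v /NN1_Mset Mv <-]].
  by exists (phi0 P) => //; apply/NN1_Mset; exact: phi0_M1.
pose P := \sum_(b : {ffun 'I_f -> 'I_p} | [forall j, (b j <= sw j)%N])
  (ellQ (val_of (fun j => b j) + p) v * (b i1).+1%:R) *: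
  mono (fun j => b j) (fun j => sw j - b j)%N.
have sP : Vpoly sw P.
  apply: Vpoly_sum => b /forallP bs; apply: VpolyZ; apply: Vpoly_mono => j.
  by have := bs j; lia.
exists P => //; apply: pi_sep => //; first exact: phi0_M1.
move=> n ln; have [pn [ds dn]] := lev12_dig ln; have /and3P[hn _ _] := ln.
rewrite ellQ_phi0 // /P raddf_sum /= big_mkcond /=.
pose F (b : 'I_f -> nat) : k := if [forall j, (b j <= sw j)%N] then
  ellQ (val_of b + p) v * (b i1).+1%:R else 0.
rewrite (eq_bigr (fun b : {ffun 'I_f -> 'I_p} => F (fun j => b j) *
   (val_of (fun j => b j) == (n - p)%N)%:R)) => [|b _]; last first.
  rewrite /F; case: ifP => bs; last by rewrite mul0r.
  by rewrite mcoeffZ mcoeff_mono_dig ?val_of_dig //; [move: hn; lia|move=> j; exact: dig_lt].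
have np : (n - p < q)%N by move: hn; lia.
rewrite ffun_sum_digits // /F.
have -> : [forall j, (dig (n - p) j <= sw j)%N] by apply/forallP.
rewrite val_of_dig // subnK // mulfK //.
rewrite -(dvdn_pcharf (char_k S)) gtnNdvd //.
by have := ds i1; have := sw_lt i1; rewrite /del eqxx; lia.
Qed.

Lemma graded_piece_weight : exists (s : 'I_f -> nat) (m : nat)
  (phi : {linear {mpoly k[f + f]} -> Qgr_amb S r (f - 2)}), weight_iso s m phi.
Proof.
exists sw, p, phi; split.
- exact: sw_ltp.
- by move=> g P; exact: phi_equiv.
- exact: phi_inj.
- exact: phi_image.
Qed.

End GradedPiece.

(** * Rigidity of the isomorphism with a weight *)

Section WeightIso.
Variables (p f : nat) (S : setting p f) (r : 'I_f -> nat) (a0 : nat).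
Hypothesis H : weight_data p r a0.
Local Notation q := (p ^ f)%N.
Local Notation k := (Fpbar S).
Local Notation io := (Defs.iota S).
Local Notation val_of := (@val_of p f).
Local Notation dig := (@dig p f).
Local Notation mono := (mono k).
Local Notation EQ := (@EQ p f S r).
Local Notation eQ := (@eQ p f S r).
Local Notation wmx := (@wmx p f S).
Local Notation umx := (@umx p f S).
Local Notation tmx := (@tmx p f S).
Local Notation Qact := (@Qact p f S r).
Local Notation QQ := (@Q p f S r).
Let p_prime := wd_prime H.
Let p_gt1 : (1 < p)%N := prime_gt1 p_prime.
Let p_gt0 : (0 < p)%N := prime_gt0 p_prime.
Let f_gt1 := wd_f H.
Let f_gt0 : (0 < f)%N := ltnW f_gt1.
Let r_ge := wd_r H.

Local Notation ellQ := (@ellQ p f S r a0).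
Let i0 : 'I_f := Ordinal f_gt0.
Let i1 : 'I_f := Ordinal f_gt1.
Local Notation NN := (@Qfil p f S r (f - 2)).
Local Notation pi := (lpi NN).
Local Notation Qga := (@Qgr_act p f S r (f - 2)).

Local Notation lev12 := (@lev12 p f a0).
Local Notation sw := (sw H).
Local Notation del := (del H).

Lemma exp_inj m n : (forall a : Fq S, a != 0 -> io a ^+ m = io a ^+ n) -> m = n %[mod q.-1].
Proof.
wlog mn : m n / (m <= n)%N.
  by move=> h; have [|/ltnW] := leqP m n; [exact: h|move=> nm e; apply/esym/h => // a /e].
move=> h; apply/eqP; rewrite eq_sym eqn_mod_dvd //.
apply/negPn/negP => /(exists_expn_neq1 S H)[a a_0 /eqP]; apply.
have ia : io a != 0 by rewrite fmorph_eq0.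
apply: (fmorph_inj io); rewrite rmorphXn rmorph1.
apply: (mulfI (expf_neq0 m ia)); rewrite -exprD subnKC // mulr1.
exact/esym/h.
Qed.

Lemma ellQ_t n a v : (a0 <= n < q)%N -> a != 0 -> QQ v ->
  ellQ n (Qact (tmx a 1) v) = io a ^+ n * ellQ n v.
Proof.
move=> hn a_0 Qv; have /andP[an nq] := hn.
have ut := unit_tmx a_0 (oner_neq0 (Fq S)).
rewrite {1}(Q_expand H Qv) (linear_sumE (Qact_lin H ut)) (ellQ_sum H) //.
rewrite (bigD1 (Ordinal nq)) //= [X in _ + X]big1 => [|m /andP[am]].
  rewrite (ellQZ H) // (Qact_t H a_0 (oner_neq0 _) nq) (ellQZ H) // (ellQ_eQ S H) // eqxx.
  by rewrite rmorph1 expr1n !mulr1 addr0 mulrC.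
rewrite -val_eqE /= => mn.
rewrite (ellQZ H) // (Qact_t H a_0 (oner_neq0 _) (ltn_ord m)) (ellQZ H) // (ellQ_eQ S H) //.
by rewrite (negbTE mn) !mulr0.
Qed.

Lemma dig_p : dig p =1 del.
Proof.
move=> j; have dp i : (del i < p)%N by rewrite /(del _); case: eqP.
by have := dig_val_of p_gt1 j dp; rewrite (val_del H).
Qed.

Lemma val_sw_bounds : (0 < val_of sw < q.-1)%N.
Proof.
have vsw := val_sw H; have a0p := a0_lt_p H; have qp2 := p2_le_q H.
have p3 := wd_gt2 H; have a01 := wd_a0 H.
have : (3 * p <= p * p)%N by rewrite leq_mul2r p3 orbT.
move: vsw a0p qp2 p3 a01; move: (val_of sw) q (p * p)%N => v Q P; clear; lia.
Qed.

Lemma modq_small n : (0 < n < q.-1)%N -> (0 == n %[mod q.-1]) = false.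
Proof. by move=> /andP[n0 nq]; rewrite mod0n modn_small // eq_sym (gtn_eqF n0). Qed.

Lemma ellQ_u n a : (a0 <= n < q)%N -> (forall i, a i < p)%N ->
  ellQ n (Qact (umx 1) (EQ a)) = \prod_(i < f) 'C(a i, dig n i)%:R.
Proof.
move=> hn ap; have /andP[_ nq] := hn.
rewrite (Qact_u H _ ap) (ellQ_sum H) //.
pose F (b : 'I_f -> nat) : k := \prod_(i < f) 'C(a i, b i)%:R.
rewrite -[RHS]/(F (dig n)) -(ffun_sum_digits H F nq); apply: eq_bigr => b _.
rewrite (ellQZ H) // (ellQ_EQ S H) //; congr (_ * _); apply: eq_bigr => i _.
by rewrite rmorph1 expr1n mulr1.
Qed.

Variables (s : 'I_f -> nat) (m : nat).
Variable (ph : {linear {mpoly k[f + f]} -> Qgr_amb S r (f - 2)}).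
Hypothesis iso : weight_iso s m ph.

Let X : {mpoly k[f + f]} := mono s (fun=> 0%N).
Let Y : {mpoly k[f + f]} := mono (fun=> 0%N) s.

Lemma sX : Vpoly s X. Proof. by apply: Vpoly_mono => i; rewrite addn0. Qed.
Lemma sY : Vpoly s Y. Proof. exact: Vpoly_mono. Qed.

Lemma mono_neq0 (a b : 'I_f -> nat) : mono a b != 0.
Proof. by rewrite monoE -msupp_eq0 msuppX. Qed.

Lemma ph_equiv g P : g \in unitmx -> Vpoly s P -> ph (wact m g P) = Qga g (ph P).
Proof. by case: iso => _ h _ _; exact: h. Qed.

Lemma phZ c P : ph (c *: P) = c *: ph P.
Proof. exact: linearZ. Qed.

Lemma piZ c v : pi (c *: v) = c *: pi v.
Proof. exact: lpiZ. Qed.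

Lemma QgaZ g c x : g \in unitmx -> Qga g (c *: x) = c *: Qga g x.
Proof.
move=> ug; have lin := Qga_lin H ug; have := lin c x 0.
have -> : Qga g 0 = 0 by have := lin (-1) 0 0; rewrite scaler0 addr0 scaleN1r addNr.
by rewrite !addr0.
Qed.

Lemma ph_neq0 P : Vpoly s P -> P != 0 -> ph P <> 0.
Proof. by case: iso => _ _ h _ sP /eqP n0 /(h _ sP). Qed.

Lemma wact_t a P' b c : P' = mono b c ->
  wact m (tmx a 1) P' = (io a ^+ (m + val_of b)) *: P'.
Proof.
move=> ->; rewrite /wact (gact_t H) det_mx22 mulr1 mulr0 subr0 scalerA rmorph1 expr1n mulr1.
by rewrite exprD.
Qed.

(** X^s is an eigenvector of the torus, and the e_n with n in [lev12] have pairwise distinct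
    characters; so the image of X^s has a single nonzero coordinate. *)
Lemma ph_X_weight : exists n C, [/\ lev12 n, C != 0, ph X = C *: pi (eQ n) &
  forall a : Fq S, a != 0 -> io a ^+ (m + val_of s) = io a ^+ n].
Proof.
have : @Qgr p f S r (f - 2) (ph X) by case: iso => _ _ _ <-; exists X => //; exact: sX.
move=> [v /(NN1_Mset H) Mv vE].
have [n [ln nz]] : exists n, lev12 n /\ ellQ n v != 0.
  apply: contrapT => h; apply: (ph_neq0 sX (mono_neq0 _ _)); rewrite -vE.
  transitivity (pi 0); last exact: linear0.
  apply: (pi_sep H) => //; first exact: (Mset0 S H).
  move=> n ln; have /and3P[hn _ _] := ln; rewrite (ellQ0 S H) //.
  by apply/eqP/negPn/negP => nz; apply: h; exists n.
have wt n' a : lev12 n' -> a != 0 ->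
    io a ^+ n' * ellQ n' v = io a ^+ (m + val_of s) * ellQ n' v.
  move=> /and3P[hn' _ h2'] a_0; have ut := unit_tmx a_0 (oner_neq0 (Fq S)).
  have := ph_equiv ut sX; rewrite (wact_t _ (erefl X)) phZ -vE (Qga_pi H _ ut) -piZ => /esym.
  move=> /(pi_eq H)[_ /(_ n' hn' h2')].
  rewrite -scaleN1r addrC (ellQ_lin H) // (ellQZ H) // ellQ_t //; last by case: Mv.
  by move/eqP; rewrite mulN1r addrC subr_eq0 => /eqP.
have wtn n' a : lev12 n' -> ellQ n' v != 0 -> a != 0 -> io a ^+ (m + val_of s) = io a ^+ n'.
  by move=> ln' nz' a_0; apply: (mulIf nz'); rewrite wt.
exists n, (ellQ n v); split=> //; last by move=> a; exact: wtn.
rewrite -vE -piZ; have /and3P[hn hn1 hn2] := ln; have /andP[an nq] := hn.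
apply: (pi_sep H) => //.
  have := Mset_lin H (ellQ n v) (Mset_eQ S H nq (e := 1) _) (Mset0 S H 1).
  by rewrite expn1 addr0; apply.
move=> n' ln'; have /and3P[hn' _ _] := ln'; rewrite (ellQZ H) // (ellQ_eQ S H) //.
have [<-|nn'] := eqVneq n n'; first by rewrite mulr1.
rewrite mulr0; apply/eqP/negPn/negP => nz'; case/eqP: nn'.
apply/eqP; rewrite -(modq_eq H); [|by have := wd_a0 H; lia|by have := wd_a0 H; lia].
apply/eqP; apply: exp_inj => a a_0; by rewrite -(wtn _ _ ln' nz' a_0) -(wtn _ _ ln nz a_0).
Qed.

(** X^s is fixed by the upper unipotent matrices, so w X^s is fixed by the lower ones, and this pins
    down its image as a multiple of e_p. Comparing torus characters then determines val s modulo q -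
    1, hence s, and the sign (-1)^m relating X^s and Y^s. *)
Lemma weight_iso_extremal : s =1 sw /\ exists C, [/\ C != 0,
  ph X = C *: pi (eQ (q.-1 + a0 - p)) & ph Y = - C *: pi (eQ p)].
Proof.
have [n [C [ln Cn0 XE wtX]]] := ph_X_weight.
have [pn [ds dn]] := lev12_dig H ln; have /and3P[hn _ _] := ln; have /andP[an nq] := hn.
set b := dig (n - p) in ds dn.
have np : (n - p < q)%N by lia.
have vb : (val_of b + p = n)%N by rewrite val_of_dig // subnK.
have vbs : (val_of b <= val_of sw)%N by apply: leq_sum => j _; rewrite leq_mul2r ds orbT.
have vsw := val_sw H.
pose n' := (q.-1 + a0 - n)%N.
have n'E : n' = (val_of (fun j => sw j - b j)%N + p)%N by rewrite val_of_sub // /n'; lia.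
have ln' : lev12 n' by rewrite n'E; exact: (@lev12_val p f r a0 H (fun j => sw j - b j)%N (fun j => leq_subr _ _)).
have [pn' [ds' dn']] := lev12_dig H ln'; have /and3P[hn' _ _] := ln'; have /andP[_ nq'] := hn'.
have lp : lev12 p.
  have := @lev12_val p f r a0 H (fun=> 0%N) (fun=> isT).
  by rewrite /(val_of _) big1.
have /and3P[hp _ hp2] := lp; have /andP[_ pq] := hp.
have uw := unit_wmx S; have uu := unit_umx (1 : Fq S).
pose lm : 'M[Fq S]_2 := mx22 1 1 0 1.
have ul : lm \in unitmx by rewrite unitmxE det_mx22 mulr0 mulr1 subr0 unitr1.
have lX : wact m lm X = X.
  rewrite /wact det_mx22 mulr0 mulr1 subr0 rmorph1 expr1n scale1r gact_mono.
  apply: eq_bigr => i _; rewrite !mx22E rmorph0 rmorph1 expr1n expr0n.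
  by rewrite (gtn_eqF (expp_gt0 H i)) scale0r scale1r addr0 !expr0.
have wX : Qga wmx (ph X) = C *: pi (eQ n').
  by rewrite XE (QgaZ _ _ uw) (Qga_pi H _ uw) (Qact_w S H hn).
have fixw : Qga (umx 1) (Qga wmx (ph X)) = Qga wmx (ph X).
  have [v vE] : exists v, ph X = pi v by exists (C *: eQ n); rewrite piZ.
  have := ph_equiv ul sX; rewrite lX => e.
  have mE : umx 1 *m wmx = wmx *m lm.
    by rewrite !mul_mx22; apply: mx2P; rewrite !mx22E; ring.
  rewrite [in RHS]e vE (Qga_pi H v uw) (Qga_pi H (Qact wmx v) uu) (Qga_pi H v ul).
  by rewrite (Qga_pi H (Qact lm v) uw) (Qact_comp H v uu uw) (Qact_comp H v uw ul) mE.
(* The coefficient of e_p in the unipotent translate of e_n' is digit 1 of n', nonzero in the field.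
   If n' were not p, invariance would make it zero. *)
have n'p : n' = p.
  move: fixw; rewrite wX (QgaZ _ _ uu) (Qga_pi H _ uu) => /(scalerI Cn0)/(pi_eq H)[_ /(_ p hp hp2)].
  rewrite -scaleN1r addrC (ellQ_lin H) // ellQ_u // => [|i]; last exact: dig_lt.
  rewrite (ellQ_eQ S H) // (bigD1 (Ordinal f_gt1)) //= big1 => [|i ni]; last first.
    by rewrite dig_p /(del _) (negbTE ni) bin0.
  rewrite dig_p /(del _) eqxx bin1 mulr1; case: eqP => // _.
  rewrite mulr0 add0r => /eqP; rewrite -(dvdn_pcharf (char_k S)) gtnNdvd //; last exact: dig_lt.
  by rewrite dn' /(del _) eqxx addn1.
have nle : (n <= q.-1 + a0)%N by move: nq; clear; move: q => Q; lia.
have nE : n = (q.-1 + a0 - p)%N by rewrite -[LHS](subKn nle) -/n' n'p.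
have wY : wact m wmx X = (-1) ^+ m *: Y.
  by rewrite /wact (gact_w S H) det_mx22 mul0r sub0r mulr1 rmorphN rmorph1.
have YE : (-1) ^+ m *: ph Y = C *: pi (eQ p).
  by rewrite -phZ -wY (ph_equiv uw sX) wX n'p.
have sq1 : (-1) ^+ m * (-1) ^+ m = 1 :> k by rewrite -expr2 sqrr_sign.
have YE' : ph Y = ((-1) ^+ m * C) *: pi (eQ p).
  by rewrite -scalerA -YE scalerA sq1 scale1r.
have wtY (a : Fq S) : a != 0 -> io a ^+ m = io a ^+ p.
  move=> a_0; have ut := unit_tmx a_0 (oner_neq0 (Fq S)).
  have := ph_equiv ut sY; rewrite (wact_t _ (erefl Y)) phZ.
  rewrite (_ : val_of (fun=> 0%N) = 0%N) ?addn0; last by rewrite /(val_of _) big1.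
  rewrite {2}YE' (QgaZ _ _ ut) (Qga_pi H _ ut) (Qact_t H a_0 (oner_neq0 _) pq) rmorph1 expr1n mulr1.
  rewrite piZ scalerA mulrC -scalerA -YE' => /eqP; rewrite -subr_eq0 -scalerBl scaler_eq0.
  by rewrite subr_eq0 => /orP[/eqP //|/eqP h]; case: (ph_neq0 sY (mono_neq0 _ _) h).
(* The torus acts on Y^s by a^m and on e_p by a^p; taking a = -1 gives (-1)^m = (-1)^p with p
   odd. *)
have sgn : (-1) ^+ m = -1 :> k.
  have n1 : (-1 : Fq S) != 0 by rewrite oppr_eq0 oner_neq0.
  have := wtY _ n1; rewrite rmorphN rmorph1 => ->; rewrite -signr_odd.
  by rewrite (odd_p H).
have sp : forall j, (s j < p)%N by case: iso.
have sswE : val_of s = val_of sw.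
  have e1 : val_of s + p = val_of sw + p %[mod q.-1].
    apply: exp_inj => a a_0.
    rewrite addnC exprD -(wtY _ a_0) -exprD (wtX _ a_0); congr (_ ^+ _).
    by rewrite nE -vsw mulSn mul1n addnCA addKn addnC.
  have sw0 := val_sw_bounds.
  have /eqP e2 : val_of s == val_of sw %[mod q.-1] by rewrite -(eqn_modDr p) e1.
  have sq := val_of_lt p_gt1 sp.
  have s0 : (0 < val_of s)%N.
    by rewrite lt0n; apply/eqP => s0; have := modq_small sw0; rewrite -e2 s0 eqxx.
  have /andP[sw1 sw2] := sw0.
  apply/eqP; rewrite -(modq_eq H); [by rewrite e2| |by rewrite sw1 ltnW].
  by rewrite s0 /= -ltnS prednK // expn_gt0 p_gt0.
split; first exact: (val_of_inj p_gt1 sp (sw_ltp H) sswE).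
exists C; split; [exact: Cn0|by rewrite XE nE|].
by rewrite YE' sgn mulN1r.
Qed.

End WeightIso.

(** * Integral lifts of the Hecke translates *)

Section SecondOrder.
Variables (R : comNzRingType) (c : R).

Lemma exp_second_order (A B : R) n : exists z,
  (A + c * B) ^+ n = A ^+ n + c * (n%:R * A ^+ n.-1 * B) + c ^+ 2 * z.
Proof.
elim: n => [|n [z IH]]; first by exists 0; rewrite !expr0; ring.
exists (A * z + n%:R * A ^+ n.-1 * B ^+ 2 + c * B * z).
rewrite exprS IH /=; case: n {IH} => [|n]; first by rewrite !expr0 !exprS; ring.
rewrite /= !exprS -[n.+2%:R]natr1; move: (n.+1%:R : R) (A ^+ n) => N' X.
by rewrite !expr0; ring.
Qed.

Lemma prod_second_order (I : eqType) (s : seq I) (F P Q : I -> R) : uniq s ->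
  (forall i, exists z, F i = P i + c * Q i + c ^+ 2 * z) -> exists z,
  \prod_(i <- s) F i = \prod_(i <- s) P i +
    c * (\sum_(i <- s) Q i * \prod_(j <- s | j != i) P j) + c ^+ 2 * z.
Proof.
move=> + hF; elim: s => [|i s IH] /= => [_|/andP[is' us]].
  by exists 0; rewrite !big_nil; ring.
have [z hz] := IH us; have [zi hi] := hF i.
exists (zi * \prod_(j <- s) P j + P i * z + Q i * (\sum_(j <- s) Q j * \prod_(j' <- s | j' != j) P j')
  + c * Q i * z + c * zi * (\sum_(j <- s) Q j * \prod_(j' <- s | j' != j) P j') + c ^+ 2 * zi * z).
rewrite !big_cons hz hi eqxx /=.
have -> : \prod_(j <- s | j != i) P j = \prod_(j <- s) P j.
  rewrite big_seq_cond [in RHS]big_seq; apply: eq_bigl => j.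
  by case: eqP => [->|_]; rewrite ?andbT // (negbTE is').
have -> : \sum_(j <- s) Q j * \prod_(j' <- i :: s | j' != j) P j' =
    P i * \sum_(j <- s) Q j * \prod_(j' <- s | j' != j) P j'.
  rewrite big_distrr /= big_seq [in RHS]big_seq; apply: eq_bigr => j js.
  rewrite big_cons (_ : i != j); first by ring.
  by apply: contraNneq is' => ->.
ring.
Qed.

End SecondOrder.

(** * First-order expansion of powers of linear forms *)

Section LinearForms.
Variables (R : comNzRingType) (p f : nat) (r : 'I_f -> nat).
Hypothesis r_gt0 : forall i, (0 < r i)%N.
Local Notation poly := {mpoly R[f + f]}.

Definition dl (i j : 'I_f) : nat := (j == i).
(** The translate of Y^r by an upper unipotent matrix. Below, [N0] is the value of X^r at u, [N1]
    that of its i-th partial derivative stripped of the factor r_i, and [MX], [MY] are the monomials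
    adjacent to X^r and Y^r. *)
Definition LinX (u : 'I_f -> R) : poly := \prod_(i < f) (u i *: pX i + pY i) ^+ r i.
Definition N0 (u : 'I_f -> R) : R := \prod_(i < f) u i ^+ r i.
Definition N1 (u : 'I_f -> R) (i : 'I_f) : R := \prod_(j < f) u j ^+ (r j - dl i j).
Definition MX (i : 'I_f) : poly := mono R (fun j => r j - dl i j)%N (dl i).
Definition MY (i : 'I_f) : poly := mono R (dl i) (fun j => r j - dl i j)%N.

Lemma AR_LinX t u : AR p t (LinX u) =
  \prod_(i < f) ((u i + t ^+ (p ^ i)) *: pX i + p%:R *: pY i) ^+ r i.
Proof.
rewrite /LinX rmorph_prod; apply: eq_bigr => i _; rewrite rmorphXn; congr (_ ^+ _).
by rewrite rmorphD /= /AR linearZ /= psubstX psubstY scalerDl addrA.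
Qed.

Lemma BR_LinX u : BR p (LinX u) = \prod_(i < f) (pY i + p%:R * (u i *: pX i)) ^+ r i.
Proof.
rewrite /LinX rmorph_prod; apply: eq_bigr => i _; rewrite rmorphXn; congr (_ ^+ _).
rewrite rmorphD /= /BR linearZ /= psubstX psubstY addrC; congr (_ + _).
by rewrite scalerA mulrC -scalerA -[in LHS]mul_mpolyC mpolyC_nat.
Qed.

Lemma mono_X (a : 'I_f -> nat) : mono R a (fun=> 0%N) = \prod_(i < f) pX i ^+ a i.
Proof. by apply: eq_bigr => i _; rewrite expr0 mulr1. Qed.

Lemma MX_E i : MX i = pX i ^+ (r i).-1 * pY i * \prod_(j < f | j != i) pX j ^+ r j.
Proof.
rewrite /MX /mono (bigD1 i) //= /dl eqxx subn1 expr1; congr (_ * _).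
by apply: eq_bigr => j /negbTE ->; rewrite subn0 expr0 mulr1.
Qed.

Lemma MY_E i : MY i = pX i * pY i ^+ (r i).-1 * \prod_(j < f | j != i) pY j ^+ r j.
Proof.
rewrite /MY /mono (bigD1 i) //= /dl eqxx subn1 expr1; congr (_ * _).
by apply: eq_bigr => j /negbTE ->; rewrite subn0 expr0 mul1r.
Qed.

Lemma N1_E u i : N1 u i = u i ^+ (r i).-1 * \prod_(j < f | j != i) u j ^+ r j.
Proof.
rewrite /N1 (bigD1 i) //= /dl eqxx subn1; congr (_ * _).
by apply: eq_bigr => j /negbTE ->; rewrite subn0.
Qed.

Lemma LinX_expand u : exists z : poly,
  \prod_(i < f) (u i *: pX i + p%:R *: pY i) ^+ r i =
  N0 u *: mono R r (fun=> 0%N) + p%:R * (\sum_i (r i)%:R * N1 u i *: MX i) + p%:R ^+ 2 * z.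
Proof.
have h i := exp_second_order (p%:R : poly) (u i *: pX i) (pY i) (r i).
have := prod_second_order (index_enum_uniq 'I_f) h => -[z hz]; exists z.
rewrite (eq_bigr (fun i => (u i *: pX i + p%:R * pY i) ^+ r i)) => [|i _]; last first.
  by congr (_ ^+ _); rewrite -[p%:R *: _]mul_mpolyC mpolyC_nat.
rewrite hz; congr (_ + _ * _ + _).
  rewrite /N0 mono_X -mul_mpolyC rmorph_prod -big_split; apply: eq_bigr => i _ /=.
  by rewrite exprZn mul_mpolyC.
apply: eq_bigr => i _; rewrite MX_E N1_E.
rewrite (eq_bigr (fun j => (u j ^+ r j)%:MP * pX j ^+ r j)) => [|j _]; last first.
  by rewrite exprZn mul_mpolyC.
rewrite big_split /= -rmorph_prod exprZn -!mul_mpolyC !mpolyCM mpolyC_nat; ring.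
Qed.

Lemma LinY_expand u : exists z : poly,
  \prod_(i < f) (pY i + p%:R * (u i *: pX i)) ^+ r i =
  mono R (fun=> 0%N) r + p%:R * (\sum_i (r i)%:R * u i *: MY i) + p%:R ^+ 2 * z.
Proof.
have h i := exp_second_order (p%:R : poly) (pY i) (u i *: pX i) (r i).
have := prod_second_order (index_enum_uniq 'I_f) h => -[z hz]; exists z.
rewrite hz; congr (_ + _ * _ + _).
  by rewrite /mono; apply: eq_bigr => i _; rewrite expr0 mul1r.
apply: eq_bigr => i _; rewrite MY_E -!mul_mpolyC mpolyCM mpolyC_nat; ring.
Qed.

Variables (C : finType) (tb : C -> R) (nu : C -> 'I_f -> R).

(* With LinX (nu c) the translate of Y^r by an upper unipotent matrix, the weights tb are
   chosen to make the leading terms of AR and BR on Wpoly divisible by p; the quotients are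
   governed by the first-order terms, whence the factors r_i. *)
Definition Wpoly : poly := \sum_c tb c *: LinX (nu c).

Lemma AR_Wpoly t e : \sum_c tb c * N0 (fun i => nu c i + t ^+ (p ^ i)) = p%:R * e ->
  exists z, AR p t Wpoly = p%:R * (e *: mono R r (fun=> 0%N) +
    \sum_i ((r i)%:R * \sum_c tb c * N1 (fun j => nu c j + t ^+ (p ^ j)) i) *: MX i + p%:R * z).
Proof.
move=> he; have [z hz] := choice (fun c => LinX_expand (fun i => nu c i + t ^+ (p ^ i))).
exists (\sum_c tb c *: z c).
rewrite /Wpoly rmorph_sum (eq_bigr (fun c =>
    (tb c * N0 (fun i => nu c i + t ^+ (p ^ i))) *: mono R r (fun=> 0%N) +
    p%:R * (\sum_i (tb c * ((r i)%:R * N1 (fun i => nu c i + t ^+ (p ^ i)) i)) *: MX i) +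
    p%:R ^+ 2 * (tb c *: z c))) => [|c _]; last first.
  rewrite /= /AR linearZ /= -/(AR p t _) AR_LinX hz !scalerDr scalerA !scalerAr scaler_sumr.
  by congr (_ + _ * _ + _); apply: eq_bigr => i _; rewrite scalerA.
rewrite !big_split /= -scaler_suml he -!mulr_sumr exchange_big /=.
rewrite (eq_bigr (fun i => ((r i)%:R * \sum_c tb c * N1 (fun j => nu c j + t ^+ (p ^ j)) i) *: MX i)).
  by rewrite -!mul_mpolyC mpolyCM mpolyC_nat; ring.
move=> i _; rewrite -scaler_suml mulr_sumr; congr (_ *: _); apply: eq_bigr => c _; ring.
Qed.

Lemma BR_Wpoly e : \sum_c tb c = p%:R * e ->
  exists z, BR p Wpoly = p%:R * (e *: mono R (fun=> 0%N) r +
    \sum_i ((r i)%:R * \sum_c tb c * nu c i) *: MY i + p%:R * z).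
Proof.
move=> he; have [z hz] := choice (fun c => LinY_expand (nu c)).
exists (\sum_c tb c *: z c).
rewrite /Wpoly rmorph_sum (eq_bigr (fun c =>
    tb c *: mono R (fun=> 0%N) r +
    p%:R * (\sum_i (tb c * ((r i)%:R * nu c i)) *: MY i) +
    p%:R ^+ 2 * (tb c *: z c))) => [|c _]; last first.
  rewrite /= /BR linearZ /= -/(BR p _) BR_LinX hz !scalerDr !scalerAr scaler_sumr.
  by congr (_ + _ * _ + _); apply: eq_bigr => i _; rewrite scalerA.
rewrite !big_split /= -scaler_suml he -!mulr_sumr exchange_big /=.
rewrite (eq_bigr (fun i => ((r i)%:R * \sum_c tb c * nu c i) *: MY i)).
  by rewrite -!mul_mpolyC mpolyCM mpolyC_nat; ring.
move=> i _; rewrite -scaler_suml mulr_sumr; congr (_ *: _); apply: eq_bigr => c _; ring.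
Qed.

Lemma LinX_Vpoly u : Vpoly r (LinX u).
Proof.
have h i : Vpoly (fun j => r i * (j == i))%N ((u i *: pX i + pY i) ^+ r i).
  by apply: Vpoly_exp; rewrite -[pY i]scale1r; exact: Vpoly_linX.
apply: eq_Vpoly (Vpoly_prod h) => i /=.
by rewrite (bigD1 i) //= eqxx muln1 big1 ?addn0 // => j /negbTE ji; rewrite eq_sym ji muln0.
Qed.

Lemma Wpoly_Vpoly : Vpoly r Wpoly.
Proof. by apply: Vpoly_sum => c _; apply: VpolyZ; exact: LinX_Vpoly. Qed.

End LinearForms.

(** * The polynomial W and its Hecke translates divided by p *)

Section HeckeLift.
Variables (p f : nat) (S : setting p f) (r : 'I_f -> nat) (a0 : nat).
Hypothesis H : weight_data p r a0.
Local Notation q := (p ^ f)%N.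
Local Notation k := (Fpbar S).
Local Notation io := (Defs.iota S).
Local Notation val_of := (@val_of p f).
Local Notation dig := (@dig p f).
Local Notation prQ := (@prQ p f S r).
Local Notation Qamb := (Qamb S r).
Local Notation EQ := (@EQ p f S r).
Local Notation eQ := (@eQ p f S r).
Local Notation wmx := (@wmx p f S).
Local Notation Qact := (@Qact p f S r).
Let p_prime := wd_prime H.
Let p_gt1 : (1 < p)%N := prime_gt1 p_prime.
Let p_gt0 : (0 < p)%N := prime_gt0 p_prime.
Let f_gt1 := wd_f H.
Let f_gt0 : (0 < f)%N := ltnW f_gt1.
Let r_ge := wd_r H.

Local Notation Mset := (@Mset p f S r a0).
Let i0 : 'I_f := Ordinal f_gt0.
Let i1 : 'I_f := Ordinal f_gt1.
Local Notation NN := (@Qfil p f S r (f - 2)).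
Local Notation pi := (lpi NN).

Local Notation O := (OE S).
Local Notation G := ('M[L S]_2).
Local Notation polyO := {mpoly (OE S)[f + f]}.
Local Notation vL := (vL (s := S)).
Local Notation redO := (@redO p f S).
Local Notation sw := (sw H).
Local Notation del := (del H).
Hypothesis r1_p : ~~ (p %| r i1)%N.
Hypothesis r0_p : a0 = 1%N -> (p %| r i0)%N.

Definition isL (e : O) : Prop := exists2 x : L S, vint vL x & val e = x%:A.

Lemma isL_toO x : vint vL x -> isL (toO x).
Proof. by move=> ix; exists x => //; exact: toOK. Qed.

Lemma isLD d e : isL d -> isL e -> isL (d + e).
Proof.
by move=> [x ix dE] [y iy eE]; exists (x + y); [exact: vintD|rewrite rmorphD /= dE eE scalerDl].
Qed.

Lemma isLM d e : isL d -> isL e -> isL (d * e).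
Proof.
move=> [x ix dE] [y iy eE]; exists (x * y); first exact: vintM.
by rewrite rmorphM /= dE eE -!in_algE -rmorphM.
Qed.

Lemma isLN d : isL d -> isL (- d).
Proof. by move=> [x ix dE]; exists (- x); [exact: vintN|rewrite rmorphN /= dE scaleNr]. Qed.

Lemma isL0 : isL 0. Proof. by exists 0; [exact: vint0|rewrite rmorph0 scale0r]. Qed.
Lemma isL1 : isL 1. Proof. by exists 1; [exact: vint1|rewrite rmorph1 scale1r]. Qed.

Lemma isLX d n : isL d -> isL (d ^+ n).
Proof. by move=> hd; elim: n => [|n IH]; [exact: isL1|rewrite exprS; exact: isLM]. Qed.

Lemma isL_sum I (s : seq I) (F : I -> O) : (forall i, isL (F i)) -> isL (\sum_(i <- s) F i).
Proof. by move=> h; apply: (big_ind isL) => [|d e|i _]; [exact: isL0|exact: isLD|]. Qed.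

Lemma isL_prod I (s : seq I) (F : I -> O) : (forall i, isL (F i)) -> isL (\prod_(i <- s) F i).
Proof. by move=> h; apply: (big_ind isL) => [|d e|i _]; [exact: isL1|exact: isLM|]. Qed.

(* Coefficients coming from the unramified field L vanish mod p as soon as they
   reduce to zero, since vL is integer valued. *)
Lemma isL_div e : isL e -> redO e = 0 -> exists e', e = p%:R * e'.
Proof.
move=> [x ix eE] re.
have rx : redL x = 0.
  by apply/eqP; rewrite -(fmorph_eq0 io) iotaP // -eE; exact/eqP.
have [y iy xE] := vmax_div_p p_prime ix rx.
exists (toO y); apply: val_inj; rewrite rmorphM rmorph_nat /= toOK // eE xE.
by rewrite -!in_algE rmorphM rmorph_nat.
Qed.

(** The entry through which [nmx c] acts on the i-th factor; it reduces to c^(p^i). *)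
Definition nuO (c : Fq S) (i : 'I_f) : O := toO (iter i (sigma S) (teich c)).
Definition nmx (c : Fq S) : G := mx22 1 (teich c) 0 1.

Lemma isL_tO c : isL (tO c). Proof. by apply: isL_toO; exact: vint_teich. Qed.
Lemma isL_nuO c i : isL (nuO c i).
Proof. by apply: isL_toO; apply: vint_iter; exact: vint_teich. Qed.

Lemma red_nuO c i : redO (nuO c i) = io c ^+ (p ^ i).
Proof.
rewrite redO_toO; last by apply: vint_iter; exact: vint_teich.
by rewrite redL_iter ?vint_teich // rmorphXn; have [_ -> _] := teichP c.
Qed.

Lemma inK_nmx c : inK (nmx c).
Proof.
have Hv := @vL_valuation _ _ S.
split; rewrite ?det_mx22 ?mulr0 ?mulr1 ?subr0 ?oner_neq0 ?vlt1 //.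
by move=> i j; case: (ord2P i) => ->; case: (ord2P j) => ->;
  rewrite mx22E ?vint0 ?vint1 ?vint_teich.
Qed.

Lemma toO1 : toO (1 : L S) = 1.
Proof. by apply: val_inj; rewrite toOK ?vint1 // scale1r rmorph1. Qed.

Lemma actO_nmx c : actO (nmx c) (mono O (fun=> 0%N) r) = LinX r (nuO c).
Proof.
rewrite /actO /pact psubst_mono /LinX; apply: eq_bigr => i _.
rewrite !mxE /= iter_sigma1 toO1 expr0 mul1r scale1r.
by [].
Qed.

Lemma r_gt0 i : (0 < r i)%N. Proof. by apply: leq_trans (p_le_r H i). Qed.

Definition WJ J : polyO := Wpoly r (fun c : Fq S => tO c ^+ J) nuO.

Lemma red_diff c l i : redO (nuO c i + (- tO l) ^+ (p ^ i)) = io (c - l) ^+ (p ^ i).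
Proof.
by rewrite rmorphD rmorphXn rmorphN /= red_nuO red_tO rmorphB -(frob_k H).
Qed.

Lemma red_prod c l (n : 'I_f -> nat) :
  redO (\prod_(i < f) (nuO c i + (- tO l) ^+ (p ^ i)) ^+ n i) = io (c - l) ^+ val_of n.
Proof.
rewrite rmorph_prod /val_of expr_sum; apply: eq_bigr => i _.
by rewrite rmorphXn [X in X ^+ _]red_diff -exprM mulnC.
Qed.

(** After expansion, every exponent of c lies strictly between 0 and q - 1, so each power sum
    vanishes. J > 0 keeps the exponent away from 0. *)
Lemma sum_small J e l : (0 < J)%N -> (J + e < q.-1)%N ->
  \sum_(c : Fq S) io c ^+ J * io (c - l) ^+ e = 0.
Proof.
move=> J0 Je; rewrite (eq_bigr (fun c => \sum_(i < e.+1)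
    (io (- l) ^+ i *+ 'C(e, i)) * io c ^+ (J + (e - i)))) => [|c _]; last first.
  rewrite rmorphD exprDn mulr_sumr; apply: eq_bigr => i _.
  by rewrite exprD mulrnAr mulrnAl; congr (_ *+ _); ring.
rewrite exchange_big big1 // => i _; rewrite -mulr_sumr (psum S H).
have h1 : (0 < J + (e - i) < q.-1)%N.
  by rewrite addn_gt0 J0 /= (leq_ltn_trans _ Je) // leq_add2l leq_subr.
by have /andP[h2 h3] := h1; rewrite gtnNdvd // andbF mulr0.
Qed.

Lemma io_val_r (x : Fq S) : io x ^+ val_of r = io x ^+ a0.
Proof. by rewrite -!rmorphXn (exp_modq H _ (val_r_gt0 H) (wd_a0 H) (val_r_mod H)). Qed.

Lemma dl_le i j : (dl i j <= r j)%N.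
Proof. by rewrite /dl; case: eqP => // _; exact: r_gt0. Qed.

Lemma val_dl i : val_of (dl i) = (p ^ i)%N.
Proof.
by rewrite -[RHS]mul1n -(@val_of_delta p f i 1); apply: eq_bigr => j _; rewrite mul1n.
Qed.

Lemma prQ_mono_r : prQ (mono k r (fun=> 0%N)) = 0.
Proof.
have := @EQ_valr p f S r a0 H r (fun i => leqnn _) (erefl _) => <-.
by congr prQ; apply: eq_mono => i //; rewrite subnn.
Qed.

Lemma prQ_mono_0 : prQ (mono k (fun=> 0%N) r) = 0.
Proof.
have v0 : val_of (fun=> 0%N) = 0%N by rewrite /(val_of _) big1.
have := @EQ_val0 p f S r a0 H _ v0 => <-.
by congr prQ; apply: eq_mono => i //; rewrite subn0.
Qed.

Lemma prQ_MX i : prQ (MX k r i) = Qact wmx (EQ (dl i)).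
Proof. by rewrite (Qact_pr H _ (unit_wmx S)) (gact_w S H). Qed.

(** The leading coefficient comes from L and reduces to the sum of c^J (c - l)^a0, which is zero;
    hence it is p e for some e. After division by p the unknown e multiplies X^r, which is zero in
    Q, and the first-order terms remain. *)
Lemma Wpoly_image_A J l : (0 < J)%N -> (J + a0 < q.-1)%N -> exists D : polyO,
  [/\ Vpoly r D, AO l (WJ J) = p%:R * D &
   prQ (red D) = \sum_i ((r i)%:R * \sum_(c : Fq S) io c ^+ J * io (c - l) ^+ (val_of r - p ^ i))
      *: Qact wmx (EQ (dl i))].
Proof.
move=> J0 Ja.
pose E0 := \sum_(c : Fq S) tO c ^+ J * N0 r (fun i => nuO c i + (- tO l) ^+ (p ^ i)).
have isE0 : isL E0.
  apply: isL_sum => c; apply: isLM; first by apply: isLX; exact: isL_tO.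
  apply: isL_prod => i; apply: isLX; apply: isLD; first exact: isL_nuO.
  by apply: isLX; apply: isLN; exact: isL_tO.
have rE0 : redO E0 = 0.
  rewrite rmorph_sum -[RHS](sum_small l J0 Ja); apply: eq_bigr => c _.
  by rewrite rmorphM rmorphXn /= red_tO [X in _ * X]red_prod io_val_r.
have [e eE] := isL_div isE0 rE0.
have [z zE] := AR_Wpoly eE.
set D := (e *: mono O r (fun=> 0%N) + _ + p%:R * z) in zE.
have AE : AO l (WJ J) = p%:R * D by exact: zE.
exists D; split=> //.
  apply: Vpoly_divp; rewrite -AE; apply: AR_Vpoly; exact: Wpoly_Vpoly.
rewrite /D redD redD redZ red_mono red_sum.
have -> : red (p%:R * z) = 0.
  by rewrite redM /red rmorph_nat -mpolyC_nat (p_eq0 S) mpolyC0 mul0r.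
rewrite addr0 prQ_lin prQ_mono_r scaler0 add0r prQ_sum; apply: eq_bigr => i _.
rewrite redZ prQZ [red (MX _ _ _)]red_mono prQ_MX; congr (_ *: _).
rewrite rmorphM rmorph_nat rmorph_sum; congr (_ * _); apply: eq_bigr => c _.
rewrite rmorphM rmorphXn /= red_tO; congr (_ * _).
by rewrite [LHS](red_prod c l) val_of_sub ?val_dl // => j; exact: dl_le.
Qed.

Lemma Wpoly_image_B J : (0 < J)%N -> (J + a0 < q.-1)%N -> exists D : polyO,
  [/\ Vpoly r D, BO (WJ J) = p%:R * D &
   prQ (red D) = \sum_i ((r i)%:R * \sum_(c : Fq S) io c ^+ (J + p ^ i)) *: EQ (dl i)].
Proof.
move=> J0 Ja.
pose E0 := \sum_(c : Fq S) tO c ^+ J.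
have isE0 : isL E0 by apply: isL_sum => c; apply: isLX; exact: isL_tO.
have rE0 : redO E0 = 0.
  have Je : (J + 0 < q.-1)%N by rewrite addn0; apply: leq_ltn_trans Ja; exact: leq_addr.
  rewrite rmorph_sum -[RHS](sum_small 0 J0 Je); apply: eq_bigr => c _.
  by rewrite rmorphXn /= red_tO expr0 mulr1.
have [e eE] := isL_div isE0 rE0.
have [z zE] := BR_Wpoly r nuO eE.
set D := (e *: mono O (fun=> 0%N) r + _ + p%:R * z) in zE.
have BE : BO (WJ J) = p%:R * D by exact: zE.
exists D; split=> //.
  apply: Vpoly_divp; rewrite -BE; apply: BR_Vpoly; exact: Wpoly_Vpoly.
rewrite /D redD redD redZ red_mono red_sum.
have -> : red (p%:R * z) = 0.
  by rewrite redM /red rmorph_nat -mpolyC_nat (p_eq0 S) mpolyC0 mul0r.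
rewrite addr0 prQ_lin prQ_mono_0 scaler0 add0r prQ_sum; apply: eq_bigr => i _.
rewrite redZ prQZ [red (MY _ _ _)]red_mono; congr (_ *: _).
rewrite rmorphM rmorph_nat rmorph_sum; congr (_ * _); apply: eq_bigr => c _.
by rewrite rmorphM rmorphXn /= red_tO red_nuO exprD.
Qed.

Lemma dl_lt (i j : 'I_f) : (dl i j < p)%N.
Proof. by rewrite /dl; case: eqP. Qed.

Lemma EQ_dl_M e (i : 'I_f) : (0 < e <= i)%N -> Mset e (EQ (dl i)).
Proof.
move=> /andP[e0 ei]; apply: (Mset_EQ S H); first exact: dl_lt.
rewrite val_dl (_ : (p ^ i %% p ^ e)%N = 0%N) ?(wd_a0 H) //.
by apply/eqP; exact: dvdn_exp2l.
Qed.

Variable b : 'I_f -> nat.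
Hypothesis bs : forall j, (b j <= sw j)%N.

Definition jb := (val_of b + p)%N.
(** With this exponent c^(J + jb) = c^(q-1), so that summing over c isolates the coefficient of
    index jb = val b + p. *)
Definition Jb := (q.-1 - jb)%N.
(** The binomial coefficient of q - 1 + a0 - p over jb, computed digit by digit as in the theorem of
    Lucas. *)
Definition Bb : k := \prod_(i < f) 'C(sw i + del i, b i + del i)%:R.

Lemma vb_le : (val_of b <= val_of sw)%N.
Proof. by apply: leq_sum => j _; rewrite leq_mul2r bs orbT. Qed.

Lemma jb_bounds : (p <= jb)%N && (jb + p <= q.-1 + a0)%N.
Proof.
have := vb_le; have := val_sw H; rewrite /jb; move: (val_of b) (val_of sw) q => x y Q.
by clear; lia.
Qed.

Lemma jb_lt : (jb < q.-1)%N.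
Proof.
have /andP[_] := jb_bounds; have := a0_lt_p H; move: jb q => x Q; clear; lia.
Qed.

Lemma Jb_gt0 : (0 < Jb)%N. Proof. by rewrite subn_gt0 jb_lt. Qed.
Lemma Jb_a0 : (Jb + a0 < q.-1)%N.
Proof.
have /andP[h _] := jb_bounds; have := jb_lt; have := a0_lt_p H; move: h; rewrite /Jb.
move: jb q => x Q; clear; lia.
Qed.

Lemma bp j : (b j + del j < p)%N.
Proof. by apply: leq_ltn_trans (sw_lt H j); rewrite leq_add2r; exact: bs. Qed.

Lemma val_bdel : val_of (fun j => b j + del j)%N = jb.
Proof. by rewrite val_of_add (val_del H). Qed.

Lemma val_swdel : val_of (fun j => sw j + del j)%N = (q.-1 + a0 - p)%N.
Proof.
rewrite val_of_add (val_del H); have := val_sw H; move: (val_of sw) q => y Q; clear; lia.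
Qed.

Lemma Bb_neq0 : Bb != 0.
Proof.
apply/prodf_neq0 => i _; apply: (bin_neq0 S H).
by rewrite leq_add2r bs (sw_lt H i).
Qed.

(** Modulo q - 1 the exponent val r - p is q - 1 + a0 - p, with digits [sw] + [del]. Expanding the
    power of c - l digitwise and summing over c keeps the term with c^jb alone. *)
Lemma binomial_character_sum l : \sum_(c : Fq S) io c ^+ Jb * io (c - l) ^+ (val_of r - p) =
  - (Bb * (- io l) ^+ (val_of sw - val_of b)).
Proof.
have vr := val_r_ge H; have qp := q_gt H; have a0p := a0_lt_p H; have a01 := wd_a0 H.
pose d j := (sw j + del j)%N.
have dp j : (d j < p)%N by exact: sw_lt.
have e1 (x : Fq S) : io x ^+ (val_of r - p) = io x ^+ val_of d.
  rewrite -!rmorphXn; congr (io _); apply: (exp_modq H).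
  - by rewrite subn_gt0 (leq_trans qp).
  - rewrite val_swdel; move: q qp => Q; clear -a0p a01; lia.
  - rewrite val_swdel; apply/eqP; rewrite -(eqn_modDr p) subnK; last by rewrite (leq_trans (ltnW qp)).
    rewrite subnK; first by rewrite (val_r_mod H) modnDl.
    by move: q qp => Q; clear; lia.
pose co (y : Fq S) (a : 'I_f -> nat) : k := \prod_(i < f) ('C(d i, a i)%:R * io y ^+ (p ^ i * (d i - a i))).
(* The digitwise binomial expansion is the action of a unipotent matrix on X^d, evaluated at (x,
   1). *)
have lucas (x y : Fq S) : io (x + y) ^+ val_of d =
    \sum_(a : {ffun 'I_f -> 'I_p}) co y (fun i => a i) * io x ^+ val_of (fun i => a i).
  have := gact_u_expg (S := S) H y dp (fun j => leqnn (d j)) => /(congr1 (ev (io x) (io 1))).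
  rewrite (ev_gact H) !mx22E ev_mono !mul1r mul0r add0r.
  rewrite (_ : val_of (fun i => d i - d i)%N = 0%N); last first.
    by rewrite /(val_of _) big1 // => i _; rewrite subnn.
  rewrite expr0 mulr1 mulr1 => ->; rewrite rmorph_sum; apply: eq_bigr => a _ /=.
  by rewrite evZ ev_mono rmorph1 expr1n mulr1.
rewrite (eq_bigr (fun c => \sum_(a : {ffun 'I_f -> 'I_p})
    co (- l) (fun i => a i) * io c ^+ (Jb + val_of (fun i => a i)))) => [|c _]; last first.
  rewrite e1 lucas mulr_sumr; apply: eq_bigr => a _; rewrite exprD; ring.
rewrite exchange_big /=.
have jq : (jb < q)%N by apply: leq_trans jb_lt _; exact: leq_pred.
rewrite (eq_bigr (fun a : {ffun 'I_f -> 'I_p} => (- co (- l) (fun i => a i)) *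
    (val_of (fun i => a i) == jb)%:R)) => [|a _]; last first.
  rewrite -mulr_sumr (psum S H) dvd_mod; last by apply: ltnW; exact: jb_lt.
  rewrite addn_gt0 Jb_gt0 /=.
  have -> : (val_of (fun i => a i) == jb %[mod q.-1]) = (val_of (fun i => a i) == jb).
    have aq : (val_of (fun i => a i) < q)%N by apply: (val_of_lt p_gt1) => i; exact: ltn_ord.
    have j0 : (0 < jb)%N by apply: leq_trans p_gt0 _; have /andP[] := jb_bounds.
    have [a_0|a_0] := posnP (val_of (fun i => a i)).
      rewrite a_0 (@modq_small p f); last by rewrite j0 jb_lt.
      by rewrite eq_sym (gtn_eqF j0).
    apply: (modq_eq H); last by rewrite j0 ltnW // jb_lt.
    by rewrite a_0 /= -ltnS prednK // expn_gt0 p_gt0.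
  by case: eqP => _; rewrite ?mulrN1 ?mulr1 ?mulr0.
rewrite (ffun_sum_digits H (fun a => - co (- l) a) jq); congr (- _).
have dE : dig jb = (fun j => b j + del j)%N.
  by apply: funext => j; rewrite -val_bdel dig_val_of //; exact: bp.
rewrite dE /co big_split /=; congr (_ * _).
rewrite -expr_sum rmorphN; congr (_ ^+ _).
rewrite -(val_of_sub p (a := sw) (b := b) bs); apply: eq_bigr => i _.
by rewrite mulnC /d subnDr.
Qed.

Lemma pi_sum_kill (F : 'I_f -> k) (V : 'I_f -> Qamb) :
  F i0 = 0 -> (forall i : 'I_f, (1 < i)%N -> Mset 2 (V i)) -> Mset 1 (V i1) ->
  Mset 1 (\sum_i F i *: V i) /\ pi (\sum_i F i *: V i) = F i1 *: pi (V i1).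
Proof.
move=> F0 V2 V1.
have iP (i : 'I_f) : [\/ i = i0, i = i1 | (1 < i)%N].
  case: i => [[|[|n]] h]; [constructor 1|constructor 2|by constructor 3]; exact: val_inj.
split.
  apply: (Mset_sum H) => i _ Fi; case: (iP i) => [e|e|h]; first by case: Fi; rewrite e.
    by rewrite e.
  by apply: (Mset_le (e := 2)) => //; exact: V2.
rewrite (bigD1 i1) //= -piZ; apply/(pi_eq H); set A := _ *: V i1; set B := \sum_(i | _) _.
have -> : A + B - A = B by rewrite addrC addKr.
rewrite {}/A {}/B.
apply: (Mset_sum H) => i ni Fi; case: (iP i) => [e|e|h]; first by case: Fi; rewrite e.
  by rewrite e eqxx in ni.
exact: V2.
Qed.

Lemma Qact_w_i1 : Qact wmx (EQ (dl i1)) = eQ (q.-1 + a0 - p).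
Proof.
rewrite (EQ_eQ_val S H (dl_lt i1)) val_dl expn1 (Qact_w S H) //.
by rewrite (ltnW (a0_lt_p H)) (q_gt H).
Qed.

Lemma hecke_lift_A l : exists D : polyO, [/\ Vpoly r D, AO l (WJ Jb) = p%:R * D,
  Mset 1 (prQ (red D)) & pi (prQ (red D)) =
   (- ((r i1)%:R * Bb) * (- io l) ^+ (val_of sw - val_of b)) *: pi (eQ (q.-1 + a0 - p))].
Proof.
have [D [rD AE prD]] := Wpoly_image_A l Jb_gt0 Jb_a0.
pose F (i : 'I_f) : k := (r i)%:R * \sum_(c : Fq S) io c ^+ Jb * io (c - l) ^+ (val_of r - p ^ i).
pose V (i : 'I_f) := Qact wmx (EQ (dl i)).
(* For a0 > 1 the sum is that of c^J (c - l)^(a0 - 1) and [sum_small] applies. For a0 = 1 the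
   exponent val r - 1 is divisible by q - 1 and the sum need not vanish; there r_0 is zero in the
   field. *)
have F0 : F i0 = 0.
  have a01 := wd_a0 H; rewrite /F; have [a1|a1] := eqVneq a0 1%N.
    by have := r0_p a1; rewrite (dvdn_pcharf (char_k S)) => /eqP ->; rewrite mul0r.
  have a2 : (0 < a0.-1)%N by move: a01 a1; case: (a0) => [|[|]].
  have Ja : (Jb + a0.-1 < q.-1)%N by apply: leq_ltn_trans Jb_a0; rewrite leq_add2l leq_pred.
  have vr := val_r_ge H; have qp := q_gt H.
  have ex (x : Fq S) : io x ^+ (val_of r - p ^ i0) = io x ^+ a0.-1.
    rewrite -!rmorphXn; congr (io _); apply: (exp_modq H) => //.
      by rewrite expn0 subn_gt0 (leq_trans _ vr) // (leq_trans p_gt1 (ltnW qp)).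
    apply/eqP; rewrite expn0 -(eqn_modDr 1) subnK ?addn1 ?prednK ?(val_r_gt0 H) //.
    by rewrite (val_r_mod H).
  rewrite (eq_bigr (fun c => io c ^+ Jb * io (c - l) ^+ a0.-1)) => [|c _]; last by rewrite ex.
  by rewrite (sum_small l Jb_gt0 Ja) mulr0.
have V2 (i : 'I_f) : (1 < i)%N -> Mset 2 (V i).
  by move=> h; apply: (Mset_act H) => //; [exact: unit_wmx|exact: EQ_dl_M].
have V1 : Mset 1 (V i1).
  by apply: (Mset_act H) => //; [exact: unit_wmx|exact: EQ_dl_M].
have [h1 h2] := pi_sum_kill F0 V2 V1.
exists D; split; [exact: rD|exact: AE|by rewrite prD|].
rewrite prD h2 /V Qact_w_i1; congr (_ *: _).
by rewrite /F expn1 binomial_character_sum mulrN mulrA mulNr.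
Qed.

Lemma hecke_lift_B : exists D : polyO, [/\ Vpoly r D, BO (WJ Jb) = p%:R * D,
  Mset 1 (prQ (red D)) & pi (prQ (red D)) =
   (- (r i1)%:R * (val_of b == 0)%N%:R) *: pi (eQ p)].
Proof.
have [D [rD BE prD]] := Wpoly_image_B Jb_gt0 Jb_a0.
pose F (i : 'I_f) : k := (r i)%:R * \sum_(c : Fq S) io c ^+ (Jb + p ^ i).
pose V (i : 'I_f) := EQ (dl i).
have /andP[pj jp] := jb_bounds; have jq := jb_lt; have a0p := a0_lt_p H.
have F0 : F i0 = 0.
  rewrite /F (psum S H) expn0 gtnNdvd ?andbF ?mulr0 // ?addn1 // /Jb.
  by move: jb q pj jq => x Q; clear -p_gt1; lia.
have V2 (i : 'I_f) : (1 < i)%N -> Mset 2 (V i) by move=> h; exact: EQ_dl_M.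
have V1 : Mset 1 (V i1) by exact: EQ_dl_M.
have [h1 h2] := pi_sum_kill F0 V2 V1.
exists D; split; [exact: rD|exact: BE|by rewrite prD|].
rewrite prD h2 /V (EQ_eQ_val S H (dl_lt i1)) val_dl expn1; congr (_ *: _).
rewrite /F (psum S H) expn1.
(* So the power sum is nonzero exactly when val b = 0, that is for Y^s, the only monomial on which
   the second term of T does not vanish. *)
have -> : (Jb + p = q.-1 - val_of b)%N.
  by move: jq; rewrite /Jb /jb; move: (val_of b) q => x Q; clear; lia.
have vq : (val_of b < q.-1)%N by apply: leq_ltn_trans jq; rewrite /jb leq_addr.
rewrite subn_gt0 vq /=; case: (posnP (val_of b)) => [->|v0].
  by rewrite subn0 dvdnn mulrN1 mulr1.
rewrite gtnNdvd ?mulr0 //; first by rewrite subn_gt0.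
by rewrite ltn_subrL v0 (leq_ltn_trans _ vq).
Qed.

Lemma r1_neq0 : (r i1)%:R != 0 :> k.
Proof. by rewrite -(dvdn_pcharf (char_k S)). Qed.

Lemma Bb0 : val_of b = 0%N -> Bb = -1.
Proof.
move=> /eqP; rewrite (val_of_eq0 p_gt1) => /forallP b0.
rewrite /Bb (bigD1 i1) //= big1 => [|i ni].
  have /eqP -> := b0 i1; rewrite /(del _) eqxx add0n bin1 mulr1 /(sw _) /= .
  have -> : (p.-2 + 1)%N = p.-1 by move: p (wd_gt2 H) => P; clear; lia.
  by rewrite -[LHS](addrK 1) natr1 prednK // (p_eq0 S) sub0r.
by have /eqP -> := b0 i; rewrite /(del _) (negbTE ni) !addn0 bin0.
Qed.

End HeckeLift.

Section LinearAlgebra.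

(** Here F plays the projection modulo T - a_p. The hypotheses give F(Y) = (a_p / p) F(w) and F(y_i)
    = a_p F(v_i) - p F(Yc_i); substituting the second in the first trades the coefficient a_p / p
    for a_p^2 / p and a_p. *)
Lemma lift_relation (K : fieldType) (V W : lmodType K) (F : V -> W) (I : finType)
    (p ap : K) (Y w : V) (t : I -> K) (y v Yc : I -> V) :
  (forall a u u', F (a *: u + u') = a *: F u + F u') -> p != 0 ->
  F (p *: Y) = ap *: F w -> w = \sum_i t i *: y i ->
  (forall i, F (p *: Yc i + y i) = ap *: F (v i)) ->
  F (Y - \sum_i ((ap ^+ 2 / p) *: (t i *: v i) - ap *: (t i *: Yc i))) = 0.
Proof.
move=> linF p0 FY wE Fy.
have F0 : F 0 = 0.
  by have := linF (-1) 0 0; rewrite scaler0 addr0 scaleN1r addNr.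
have FZ a u : F (a *: u) = a *: F u by rewrite -[a *: u]addr0 linF F0 addr0.
have FD u u' : F (u + u') = F u + F u' by rewrite -{1}[u]scale1r linF scale1r.
have FN u : F (- u) = - F u by rewrite -scaleN1r FZ scaleN1r.
have Fs (h : I -> V) : F (\sum_i h i) = \sum_i F (h i).
  by apply: (big_morph F) => // u u'.
have {}FY : F Y = (ap / p) *: F w.
  by rewrite mulrC -scalerA -FY FZ scalerA mulVf // scale1r.
have {}Fy i : F (y i) = ap *: F (v i) - p *: F (Yc i) by rewrite -Fy linF addrC addKr.
rewrite FD FN FY wE !Fs scaler_sumr -sumrB big1 // => i _.
rewrite FD FN !FZ Fy; apply/eqP; rewrite subr_eq0; apply/eqP.
rewrite !scalerBr !scalerA; congr (_ *: _ - _ *: _); first by ring.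
by field.
Qed.

End LinearAlgebra.

(** * The Hecke operator of a weight on monomials *)

Section WeightHecke.
Variables (p f : nat) (S : setting p f) (r : 'I_f -> nat) (a0 : nat).
Hypothesis H : weight_data p r a0.
Local Notation k := (Fpbar S).
Local Notation io := (Defs.iota S).
Local Notation G := ('M[L S]_2).
Local Notation Qga := (@Qgr_act p f S r (f - 2)).
Let p_prime := wd_prime H.
Let p_gt0 : (0 < p)%N := prime_gt0 p_prime.

Lemma Aw_mono (s b : 'I_f -> nat) l : (forall i, b i <= s i)%N ->
  Aw l (mono k b (fun i => s i - b i)%N) =
  (- io l) ^+ (val_of p s - val_of p b) *: mono k s (fun=> 0%N).
Proof.
move=> bs; rewrite /Aw psubst_mono -(val_of_sub p bs) /val_of expr_sum.
rewrite /mono -mul_mpolyC rmorph_prod -big_split; apply: eq_bigr => i _ /=.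
rewrite exprZn -exprM expr0 mulr1 -[in RHS](subnKC (bs i)) exprD mulnC.
by rewrite -mul_mpolyC addnC addnK; ring.
Qed.

Lemma Bw_mono (s b : 'I_f -> nat) : (forall i, b i <= s i)%N ->
  Bw (mono k b (fun i => s i - b i)%N) = (val_of p b == 0)%N%:R *: mono k (fun=> 0%N) s.
Proof.
move=> bs; rewrite /Bw psubst_mono (val_of_eq0 (prime_gt1 p_prime)).
case: forallP => [b0|/forallP]; rewrite ?scale1r ?scale0r.
  by apply: eq_bigr => i _; have /eqP -> := b0 i; rewrite subn0 !expr0.
rewrite negb_forall => /existsP[i bi].
by rewrite (bigD1 i) //= expr0n (negbTE bi) !mul0r.
Qed.

Lemma Aw_lin l c (u v : {mpoly k[f + f]}) : Aw l (c *: u + v) = c *: Aw l u + Aw l v.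
Proof. exact: linearP. Qed.
Lemma Bw_lin c (u v : {mpoly k[f + f]}) : Bw (c *: u + v) = c *: Bw u + Bw v.
Proof. exact: linearP. Qed.

Definition grbracket (g : G) (w : Qgr_amb S r (f - 2)) := bracket (Kact Qga) g w.

Lemma grbracket_lin g c u v : grbracket g (c *: u + v) = c *: grbracket g u + grbracket g v.
Proof.
apply: funext => g'; rewrite -[RHS]/(c *: grbracket g u g' + grbracket g v g') /grbracket /bracket.
case: asboolP => h; last by rewrite scaler0 addr0.
by apply: (Qga_lin H); apply: inK_red; exact: (Kpart_inK p_prime).
Qed.

Lemma grbracket0 g : grbracket g 0 = 0.
Proof. by have := grbracket_lin g (-1) 0 0; rewrite scaler0 addr0 scaleN1r addNr. Qed.

Lemma grbracketZ g c u : grbracket g (c *: u) = c *: grbracket g u.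
Proof. by rewrite -[c *: u]addr0 grbracket_lin grbracket0 addr0. Qed.

Lemma bracketE (W : zmodType) (act : G -> W -> W) g v g' :
  bracket act g v g' = if `[< inKZ (g' *m g) >] then act (Kpart (g' *m g)) v else 0.
Proof. by []. Qed.

End WeightHecke.

(** * The kernel of the natural map *)

Opaque emb red AE BE AO BO actE actO gact psubst pact AR BR bracket.

Section HeckeGen.
Variables (p f : nat) (S : setting p f).
Local Notation G := ('M[L S]_2).
Definition ml (l : Fq S) : G := mx22 p%:R (teich l) 0 1.
Definition al : G := mx22 1 0 0 p%:R.

Lemma hecke_bracketE (W : zmodType) (act : G -> W -> W) A B g v A' B' :
  (forall l, A l v = A' l) -> B v = B' ->
  hecke_bracket act A B g v =
  \sum_(l : Fq S) bracket act (g *m ml l) (A' l) + bracket act (g *m al) B'.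
Proof.
move=> hA hB; rewrite /hecke_bracket hB; congr (_ + _).
by apply: eq_bigr => l _; rewrite hA.
Qed.

End HeckeGen.

Section FactorThroughQ.
Variables (p f : nat) (S : setting p f) (r : 'I_f -> nat) (a0 : nat).
Hypothesis H : weight_data p r a0.
Local Notation q := (p ^ f)%N.
Local Notation k := (Fpbar S).
Local Notation O := (OE S).
Local Notation G := ('M[L S]_2).
Local Notation polyO := {mpoly (OE S)[f + f]}.
Local Notation vL := (vL (s := S)).
Local Notation vE := (vE (s := S)).
Local Notation redE := (@redE _ _ S).
Let p_prime := wd_prime H.
Let p_gt1 : (1 < p)%N := prime_gt1 p_prime.
Let p_gt0 : (0 < p)%N := prime_gt0 p_prime.
Let f_gt1 := wd_f H.
Let f_gt0 : (0 < f)%N := ltnW f_gt1.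
Let r_ge := wd_r H.

Variables (ap : E S) (ap_neq0 : ap != 0) (ap_gt0 : 0 < vE ap) (ap_lt1 : vE ap < 1).
Local Notation polyE := {mpoly (E S)[f + f]}.
Local Notation T := (T_minus_ap r ap).
Local Notation act := (@actE p f S).
Local Notation KV := (KrepV S r).
Local Notation KO := (KrepO S r).
Local Notation hIO := (ind act (VOE r)).
Local Notation AO := (@AO p f S).
Local Notation BO := (@BO p f S).

Definition brO (g : G) (P : polyO) : G -> polyE := bracket act g (emb P).
Local Notation ml := (@ml p f S).
Local Notation al := (al S).

Lemma unit_ml l : ml l \in unitmx.
Proof. by rewrite unitmxE det_mx22 mulr1 mulr0 subr0 unitfE (pL0 S). Qed.
Lemma unit_al : al \in unitmx.
Proof. by rewrite unitmxE det_mx22 mul1r mulr0 subr0 unitfE (pL0 S). Qed.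

Lemma bracketZ g c v : bracket act g (c *: v) = c *: bracket act g v.
Proof.
apply/esym/(bracket_map p_prime (F := fun v => c *: v)); first exact: scaler0.
by move=> x _; rewrite actEZ.
Qed.

Lemma brO_ind g P : g \in unitmx -> Vpoly r P -> hIO (brO g P).
Proof.
move=> ug rP; apply: (bracket_ind p_prime KO) => //; apply/VOE_emb; by exists P.
Qed.

Lemma brOD g P Q : brO g (P + Q) = brO g P + brO g Q.
Proof. by rewrite /brO embD (bracketD p_prime KV). Qed.
Lemma brOZ g c P : brO g (c *: P) = val c *: brO g P.
Proof. by rewrite /brO embZ bracketZ. Qed.
Lemma brO_sum g I (s : seq I) (Pr : pred I) (F : I -> polyO) :
  brO g (\sum_(i <- s | Pr i) F i) = \sum_(i <- s | Pr i) brO g (F i).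
Proof. by rewrite /brO emb_sum (bracket_sum p_prime KV). Qed.
Lemma brO_p g P : brO g (p%:R * P) = p%:R *: brO g P.
Proof. by rewrite -mpolyC_nat mul_mpolyC brOZ rmorph_nat. Qed.
Lemma brO_K g x P : inK x -> brO (g *m x) P = brO g (actO x P).
Proof. by move=> Kx; rewrite /brO (bracket_K p_prime KV _ _ Kx) (emb_actO _ Kx). Qed.

Lemma hecke_emb g P : hecke_bracket act (@AE p f S) (@BE p f S) g (emb P) =
  \sum_(l : Fq S) brO (g *m ml l) (AO l P) + brO (g *m al) (BO P).
Proof.
apply: hecke_bracketE => [l|].
  exact/esym/emb_AO.
exact/esym/emb_BO.
Qed.

Lemma hIOZ a h : vint vE a -> hIO h -> hIO (a *: h).
Proof.
move=> ia; apply: (ind_map (F := fun v => a *: v)) => [|v|x v Kx _].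
- exact: scaler0.
- move=> /VOE_emb[P rP ->]; apply/VOE_emb.
  exists ((insubd (0 : O) a) *: P); first exact: VpolyZ.
  by rewrite embZ insubdK.
- by rewrite actEZ.
Qed.

Lemma Theta_lpi h : hIO h -> Theta (lpi T h).
Proof. by exists h. Qed.

Lemma tens_scale c (t : ThetaE r ap) : tens c t = c *: tens 1 t.
Proof. by rewrite /tens -[c in LHS]mulr1 -scalerA; exact: linearZ. Qed.

Lemma tens_D (t u : ThetaE r ap) : Theta t -> Theta u -> tens 1 (t + u) = tens 1 t + tens 1 u.
Proof.
move=> Tt Tu; rewrite /tens -lpiD; apply/lpiP.
rewrite -scalerDr -scalerBr; apply: lspanZ; apply: lspan_in; left.
by exists t, u; split=> //; rewrite opprD addrA.
Qed.

Lemma tens_Z a (t : ThetaE r ap) : vint vE a -> Theta t -> tens 1 (a *: t) = redE a *: tens 1 t.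
Proof.
move=> ia Tt; rewrite -tens_scale /tens; apply/lpiP.
by rewrite scale1r; apply: lspan_in; right; exists a, t.
Qed.

(** The tensor relations are imposed on Theta only, so additivity and semilinearity of [tau] are
    stated for functions with values in [VOE]. *)
Definition tau (h : G -> polyE) : ThetaBar r ap := tens 1 (lpi T h).

Lemma tauD h h' : hIO h -> hIO h' -> tau (h + h') = tau h + tau h'.
Proof.
by move=> ih ih'; rewrite /tau lpiD tens_D //; exact: Theta_lpi.
Qed.

Lemma tauZ a h : vint vE a -> hIO h -> tau (a *: h) = redE a *: tau h.
Proof.
move=> ia ih; rewrite /tau lpiZ -[lquot_scale _ _]/(a *: lpi T h).
by apply: tens_Z => //; exact: Theta_lpi.
Qed.

Lemma vE_N1 : vint vE (-1). Proof. by rewrite /vint vltN1 ?lexx ?orbT //; exact: vE_valuation. Qed.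

Lemma tauN h : hIO h -> tau (- h) = - tau h.
Proof.
move=> ih; rewrite -[- h]scaleN1r tauZ ?vE_N1 //.
have rm := redE_residue S; have Hv := @vE_valuation _ _ S.
rewrite (redN Hv rm) ?(red_1 rm) ?scaleN1r //.
by rewrite /vint vlt1 ?lexx ?orbT.
Qed.

Lemma tauB h h' : hIO h -> hIO h' -> tau (h - h') = tau h - tau h'.
Proof. by move=> ih ih'; rewrite tauD ?tauN //; exact: (indN KO). Qed.

Lemma tau0 : tau 0 = 0.
Proof. by have h := ind0 KO; have := tauB h h; rewrite !subrr. Qed.

Lemma tau_sum I (s : seq I) (Pr : pred I) (F : I -> G -> polyE) :
  (forall i, Pr i -> hIO (F i)) ->
  tau (\sum_(i <- s | Pr i) F i) = \sum_(i <- s | Pr i) tau (F i).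
Proof.
move=> h; suff [] : hIO (\sum_(i <- s | Pr i) F i) /\
  tau (\sum_(i <- s | Pr i) F i) = \sum_(i <- s | Pr i) tau (F i) by [].
elim: s => [|i s [IH1 IH2]]; first by rewrite !big_nil tau0; split=> //; exact: (ind0 KO).
rewrite !big_cons; case: ifP => Pi //; rewrite tauD ?IH2; [|exact: h|by []].
by split=> //; apply: (indD KO) => //; exact: h.
Qed.

Lemma T_rel g v : g \in unitmx -> Vpoly r v ->
  lpi T (hecke_bracket act (@AE p f S) (@BE p f S) g v) = ap *: lpi T (bracket act g v).
Proof.
move=> ug rv; rewrite -[ap *: _]/(lquot_scale ap (lpi T (bracket act g v))) -lpiZ.
apply/lpiP; apply: lspan_in.
exists (bracket act g v), (hecke_bracket act (@AE p f S) (@BE p f S) g v); split=> //.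
exists 1%N, (fun=> g), (fun=> v); split=> //; by rewrite big_ord1.
Qed.

Lemma red_pos x : x != 0 -> 0 < vE x -> vint vE x /\ redE x = 0.
Proof.
move=> x0 vx; have ix : vint vE x by rewrite /vint (ltW vx) orbT.
by split=> //; apply/eqP; rewrite (red_ker (redE_residue S)) // /vmax vx orbT.
Qed.

Lemma red_p : vint vE p%:R /\ redE p%:R = 0.
Proof. by apply: red_pos; rewrite ?(pE0 S) // (vEp S). Qed.

Lemma red_ap : vint vE ap /\ redE ap = 0.
Proof. exact: red_pos. Qed.

Lemma red_p_ap : vint vE (p%:R / ap) /\ redE (p%:R / ap) = 0.
Proof.
have Hv := @vE_valuation _ _ S.
apply: red_pos; first by rewrite mulf_neq0 ?invr_eq0 ?(pE0 S).
by rewrite vltM ?invr_eq0 ?(pE0 S) // vltV // (vEp S) subr_gt0.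
Qed.

Definition Psi g P : ThetaBar r ap := tau (brO g P).

(* (T - a_p)(- [g, P] / a_p) is [g, P] modulo p / a_p. *)
Lemma Psi_div g P : g \in unitmx -> Vpoly r P ->
  (forall l, cong p%:R (AO l P) 0) -> cong p%:R (BO P) 0 -> Psi g P = 0.
Proof.
move=> ug rP hA [D hD]; have [C hC] := choice hA.
have {}hC l : AO l P = p%:R * C l by rewrite hC add0r.
rewrite add0r in hD.
have rC l : Vpoly r (C l) by apply: Vpoly_divp; rewrite -hC; exact: AR_Vpoly.
have rD : Vpoly r D by apply: Vpoly_divp; rewrite -hD; exact: BR_Vpoly.
pose Y := \sum_(l : Fq S) brO (g *m ml l) (C l) + brO (g *m al) D.
have iY : hIO Y.
  apply: (indD KO); last by apply: brO_ind; rewrite ?unitmx_mul ?ug ?unit_al.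
  by apply: (ind_sum KO) => l _; apply: brO_ind; rewrite ?unitmx_mul ?ug ?unit_ml.
have hY : hecke_bracket act (@AE p f S) (@BE p f S) g (emb P) = p%:R *: Y.
  rewrite hecke_emb hD brO_p /Y scalerDr scaler_sumr; congr (_ + _).
  by apply: eq_bigr => l _; rewrite hC brO_p.
have rE : Vpoly r (emb P) by apply: emb_Vpoly.
have := T_rel ug rE; rewrite hY => e.
have {}e : lpi T (brO g P) = lpi T ((p%:R / ap) *: Y).
  have : ap^-1 *: lpi T (p%:R *: Y) = ap^-1 *: (ap *: lpi T (brO g P)) by rewrite e.
  rewrite scalerA mulVf // scale1r => <-.
  by rewrite mulrC -scalerA; exact/esym/lpiZ.
have [i0 r0] := red_p_ap.
by rewrite /Psi /tau e -/(tau _) tauZ // r0 scale0r.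
Qed.

Lemma PsiY g : g \in unitmx -> Psi g (mono O (fun=> 0%N) r) = 0.
Proof.
move=> ug; pose g' := g *m invmx al.
have ug' : g' \in unitmx by rewrite unitmx_mul ug unitmx_inv unit_al.
have gE : g' *m al = g by rewrite mulmxKV ?unit_al.
have tq l : (- tO l) ^+ q = - tO (S := S) l by exact: (NtOq H).
have [C hC] := choice (fun l => AR_v0 H (tq l)).
have {}hC l : AO l (v0 O p r) = p%:R * C l by rewrite [LHS]hC add0r.
have [D hD'] := BR_v0 O H.
have hD : BO (v0 O p r) = mono O (fun=> 0%N) r + p%:R * D by exact: hD'.
have rv : Vpoly r (v0 O p r) by apply: (v0_Vpoly H).
set Yr := mono O (fun=> 0%N) r in hD *.
have rY : Vpoly r Yr by apply: Vpoly_mono.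
have rC l : Vpoly r (C l) by apply: Vpoly_divp; rewrite -hC; exact: AR_Vpoly.
have rD : Vpoly r D.
  apply: Vpoly_divp; have -> : p%:R * D = BO (v0 O p r) - Yr by rewrite hD addrC addKr.
  by apply: VpolyB => //; exact: BR_Vpoly.
pose Y := \sum_(l : Fq S) brO (g' *m ml l) (C l) + brO g D.
have iY : hIO Y.
  apply: (indD KO); last exact: brO_ind.
  by apply: (ind_sum KO) => l _; apply: brO_ind => //; rewrite unitmx_mul ug' unit_ml.
have hY : hecke_bracket act (@AE p f S) (@BE p f S) g' (emb (v0 O p r)) =
    p%:R *: Y + brO g Yr.
  rewrite hecke_emb gE hD brOD brO_p /Y scalerDr scaler_sumr.
  rewrite -addrA [X in _ + X = _]addrC; congr (_ + _).
  by apply: eq_bigr => l _; rewrite hC brO_p.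
have rE : Vpoly r (emb (v0 O p r)) by apply: emb_Vpoly.
have := T_rel ug' rE; rewrite hY => e.
have iv := brO_ind ug' rv; have iYr := brO_ind ug rY.
have [ip rp] := red_p; have [ia ra] := red_ap.
have : tau (p%:R *: Y + brO g Yr) = tau (ap *: brO g' (v0 O p r)).
  by rewrite /tau e lpiZ.
by rewrite (tauD (hIOZ ip iY) iYr) (tauZ ip iY) (tauZ ia iv) rp ra !scale0r add0r.
Qed.

Lemma inK_w : inK (mx22 0 1 1 0 : G).
Proof.
have Hv := @vL_valuation _ _ S.
split; rewrite ?det_mx22 ?mul0r ?mulr1 ?sub0r ?oppr_eq0 ?oner_neq0 ?vltN1 //.
by move=> i j; case: (ord2P i) => ->; case: (ord2P j) => ->; rewrite mx22E ?vint0 ?vint1.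
Qed.

Lemma PsiX g : g \in unitmx -> Psi g (mono O r (fun=> 0%N)) = 0.
Proof.
move=> ug; rewrite -actO_w /Psi -brO_K; last exact: inK_w.
by apply: PsiY; rewrite unitmx_mul ug inK_unit //; exact: inK_w.
Qed.

(** [Psi g] descends to residue polynomials: each monomial is lifted to itself and the coordinates
    stay in the residue field. *)
Definition Phi g (X : {mpoly k[f + f]}) : ThetaBar r ap :=
  \sum_(a : box r | in_box a) X@_(box_mnm a) *: Psi g (box_mono O a).

Lemma Phi_lin g c X Y : Phi g (c *: X + Y) = c *: Phi g X + Phi g Y.
Proof.
rewrite /Phi scaler_sumr -big_split; apply: eq_bigr => a _ /=.
by rewrite mcoeffD mcoeffZ scalerDl scalerA.
Qed.

Lemma Phi0 g : Phi g 0 = 0.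
Proof. by rewrite /Phi big1 // => a _; rewrite mcoeff0 scale0r. Qed.

Lemma Phi_red g P : g \in unitmx -> Vpoly r P -> Phi g (red P) = Psi g P.
Proof.
move=> ug rP; rewrite [in RHS](Vpoly_expand rP) /Psi brO_sum tau_sum => [|a ba].
  apply: eq_bigr => a ba; rewrite brOZ tauZ.
  - by rewrite mcoeff_red.
  - exact: OvalP.
  - by apply: brO_ind => //; exact: box_mono_Vpoly.
by apply: brO_ind => //; apply: VpolyZ; exact: box_mono_Vpoly.
Qed.

Lemma Vpoly_theta (R : comNzRingType) (i : 'I_f) :
  Vpoly (fun j => (j == i) + p * (j == ord_pred i))%N (thetaR R p i).
Proof.
apply: VpolyB.
  by apply: VpolyM; [exact: Vpoly_pX|apply: Vpoly_exp; exact: Vpoly_pY].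
by apply: VpolyM; [exact: Vpoly_pY|apply: Vpoly_exp; exact: Vpoly_pX].
Qed.

Lemma Phi_theta g i c d : g \in unitmx -> Phi g (theta S i * mono k c d) = 0.
Proof.
move=> ug; pose s j := ((j == i) + p * (j == ord_pred i) + (c j + d j))%N.
have rT (R : comNzRingType) : Vpoly s (thetaR R p i * mono R c d).
  by apply: VpolyM; [exact: Vpoly_theta|exact: Vpoly_mono].
(* The cofactors of the theta_i in an element of [Vstar] need not be homogeneous. A product of the
   wrong multidegree has no coordinate in the box, so [Phi g] ignores it. *)
have [/existsP sr|/existsPn sr] := boolP [exists j, s j != r j].
  by rewrite /Phi big1 // => a ba; rewrite (box_mnm_deg (rT k)) ?scale0r.
have {}rT : Vpoly r (thetaR O p i * mono O c d).
  by apply: eq_Vpoly (rT O) => j; apply/eqP; rewrite -[_ == _]negbK sr.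
have -> : theta S i * mono k c d = red (thetaR O p i * mono O c d).
  by rewrite (@redM p f S) red_thetaO red_mono.
rewrite Phi_red //; apply: Psi_div => // [l|].
  have tq : (- tO l) ^+ q = - tO (S := S) l by exact: (NtOq H).
  have [z hz] := AR_theta H i tq; exists (z * AO l (mono O c d)).
  by rewrite AOM [X in X * _]hz !add0r mulrA.
have [z hz] := BR_theta O H i; exists (z * BO (mono O c d)).
by rewrite BOM [X in X * _]hz !add0r mulrA.
Qed.

Lemma Phi_Ker g X : g \in unitmx -> lspan (@Vstar p f S r `|` @Xr p f S r)%classic X ->
  Phi g X = 0.
Proof.
move=> ug; apply: (lspan_min (N := [set X | Phi g X = 0]%classic)) => /=.
- exact: Phi0.
- by move=> c u v hu hv; rewrite Phi_lin hu hv scaler0 addr0.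
- move=> Y [[_ [A ->]]|].
    have Phi_sum I (t : seq I) (F : I -> {mpoly k[f + f]}) :
        (forall j, Phi g (F j) = 0) -> Phi g (\sum_(j <- t) F j) = 0.
      move=> h; elim: t => [|j t IH]; first by rewrite big_nil Phi0.
      by rewrite big_cons -[F j]scale1r Phi_lin h IH scaler0 addr0.
    apply: (Phi_sum) => i; rewrite {1}(mpolyE (A i)) mulr_sumr; apply: (Phi_sum) => m.
    rewrite -scalerAr -[_ *: _]addr0 Phi_lin Phi0 addr0 -(mnm_ofK m) -monoE.
    by rewrite Phi_theta // scaler0.
  apply: (lspan_min (N := [set X | Phi g X = 0]%classic)) => /=.
  + exact: Phi0.
  + by move=> c u v hu hv; rewrite Phi_lin hu hv scaler0 addr0.
  + move=> _ [h uh ->]; rewrite /mkset.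
    (* The matrix h is lifted entrywise to an element of K, so that [g, h X^r] becomes [g Hm, X^r],
       where [PsiX] applies. *)
    pose Hm : G := map_mx (@teich _ _ S) h.
    have ihm i j : vint vL (Hm i j) by rewrite mxE; exact: vint_teich.
    have redH : map_mx (@redL _ _ S) Hm = h.
      by apply/matrixP => i j; rewrite !mxE; have [_ ->] := teichP (h i j).
    have rdet : redL (\det Hm) = \det h by rewrite -redL_det // redH.
    have idet : vint vL (\det Hm).
      rewrite det2; apply: vintD; first exact: vintM.
      by apply: vintN; exact: vintM.
    have dn0 : redL (\det Hm) != 0 by rewrite rdet -unitfE -unitmxE.
    have KH : inK Hm.
      move: dn0; rewrite (red_ker (redL_residue S)) // /vmax negb_or -leNgt => /andP[d0 v0'].
      split=> //; apply/eqP; rewrite eq_le v0' /=.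
      by move: idet; rewrite /vint (negbTE d0).
    have -> : gact h (\prod_i pX i ^+ r i) = red (actO Hm (mono O r (fun=> 0%N))).
      rewrite (red_actO _ KH) /Kact redH red_mono; congr gact.
      by apply: eq_bigr => i _; rewrite expr0 mulr1.
    have rX : Vpoly r (mono O r (fun=> 0%N)) by apply: Vpoly_mono => i; rewrite addn0.
    rewrite Phi_red //; last exact: actO_Vpoly.
    by rewrite /Psi -brO_K //; apply: PsiX; rewrite unitmx_mul ug inK_unit.
Qed.

Lemma prQ0_Ker X : prQ r X = 0 -> lspan (@Vstar p f S r `|` @Xr p f S r)%classic X.
Proof. by move=> h; apply/lpi_eq0. Qed.

(* Peel off one coset of KZ at a time. *)
Lemma nat_map_Ker (s : seq G) n (c : 'I_n -> k) (y : 'I_n -> G -> polyE) :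
  (forall i, hIO (y i)) ->
  (forall i g, y i g != 0 -> exists2 z, z \in s & exists2 x, inKZ x & g = x *m z) ->
  (forall g, lspan (@Vstar p f S r `|` @Xr p f S r)%classic
      (\sum_i c i *: map_mpoly redE (y i g))) ->
  \sum_i c i *: tau (y i) = 0.
Proof.
elim: s y => [|z s IH] y iy sy ky.
  rewrite big1 // => i _; have -> : y i = 0; last by rewrite tau0 scaler0.
  apply: funext => g; apply/eqP; rewrite -[_ == _]negbK; apply/negP => h.
  by have [z] := sy i g h.
have [uz|nz] := boolP (z \in unitmx); last first.
  apply: IH => // i g h; have [z' zs [x KZx gE]] := sy i g h.
  move: zs; rewrite inE => /orP[/eqP z'z|zs]; last by exists z' => //; exists x.
  case/negP: h; rewrite (ind_out (iy i)) // gE z'z unitmx_mul negb_and.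
  by rewrite nz orbT.
have exP i : exists P : polyO, Vpoly r P /\ y i z = emb P.
  have /VOE_emb[P rP e] := ind_val (iy i) z.
  by exists P.
have [P hP] := choice exP.
have uz' : invmx z \in unitmx by rewrite unitmx_inv.
have rP i : Vpoly r (P i) by have [] := hP i.
have bE i : bracket act (invmx z) (y i z) = brO (invmx z) (P i).
  by rewrite /brO; have [_ ->] := hP i.
have ib i : hIO (brO (invmx z) (P i)) by apply: brO_ind.
have [y' y'E] : exists y' : 'I_n -> G -> polyE, forall i, y' i = y i - brO (invmx z) (P i).
  by exists (fun i => y i - brO (invmx z) (P i)).
have peel i g : y' i g = if `[< inKZ (g *m invmx z) >] then 0 else y i g.
  by rewrite y'E -bE; exact: (peelE p_prime g (iy i) uz).
have ysum i : y i = y' i + brO (invmx z) (P i) by rewrite y'E subrK.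
have iy' i : hIO (y' i) by rewrite y'E; apply: (indB KO).
(* Only the combination of the reductions is known to lie in the kernel, not its individual terms;
   so the coset of z is removed from all [y i] at the same time. *)
have e : \sum_i c i *: tau (y i) =
    \sum_i c i *: tau (y' i) + Phi (invmx z) (\sum_i c i *: red (P i)).
  have -> : Phi (invmx z) (\sum_i c i *: red (P i)) = \sum_i c i *: Psi (invmx z) (P i).
    have lP : linear (Phi (invmx z)) by move=> a u v; exact: Phi_lin.
    by rewrite (linear_sumE lP); apply: eq_bigr => i _; rewrite (Phi_red uz' (P := P i)).
  rewrite -big_split; apply: eq_bigr => i _ /=; rewrite -scalerDr; congr (_ *: _).
  by rewrite /Psi -(tauD (iy' i) (ib i)) -ysum.
rewrite e (Phi_Ker uz') ?addr0; last first.
  have := ky z; congr lspan; apply: eq_bigr => i _.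
  by have [_ ->] := hP i; rewrite redE_emb.
apply: IH => // [i g|g].
  rewrite peel; case: asboolP => [_|h0]; first by rewrite eqxx.
  move=> h; have [z' zs [x KZx gE]] := sy i g h.
  move: zs; rewrite inE => /orP[/eqP z'z|zs]; last by exists z' => //; exists x.
  by case: h0; rewrite gE z'z mulmxK.
have [h0|h0] := pselect (inKZ (g *m invmx z)).
  rewrite big1 => [|i _]; first exact: lspan0.
  rewrite peel (asboolT h0) -emb0 redE_emb red0p scaler0 //.
have := ky g; congr lspan; apply: eq_bigr => i _; rewrite peel.
by rewrite (asboolF h0).
Qed.

Lemma nat_map_factors_Q (x : G -> {mpoly k[f + f]}) (t : ThetaBar r ap) :
  nat_map x t -> (forall g, prQ r (x g) = 0) -> t = 0.
Proof.
move=> [n [c [y [iy xE ->]]]] kx.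
rewrite (eq_bigr (fun i => c i *: tau (y i))) => [|i _]; last exact: tens_scale.
have [sq sP] := choice (fun i => ind_supp (iy i)).
apply: (nat_map_Ker (s := flatten [seq sq i | i <- enum 'I_n])) => // [i g h|g].
- have [z zs hz] := sP i g h; exists z => //.
  by apply/flattenP; exists (sq i) => //; apply/mapP; exists i; rewrite ?mem_enum.
- have := prQ0_Ker (kx g); rewrite xE fct_sumE; congr lspan.
Qed.

End FactorThroughQ.

(** * Vanishing on the image of T *)

Lemma double_sub1_gt0 (v : rat) : 1 / 2 < v -> 0 < v *+ 2 - 1.
Proof. by move=> h; lra. Qed.

Section HeckeVanishing.
Variables (p f : nat) (S : setting p f) (r : 'I_f -> nat) (a0 : nat).
Hypothesis H : weight_data p r a0.
Local Notation q := (p ^ f)%N.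
Local Notation k := (Fpbar S).
Local Notation O := (OE S).
Local Notation G := ('M[L S]_2).
Local Notation polyO := {mpoly (OE S)[f + f]}.
Local Notation polyE := {mpoly (E S)[f + f]}.
Local Notation polyk := {mpoly k[f + f]}.
Local Notation io := (Defs.iota S).
Local Notation val_of := (@val_of p f).
Local Notation vE := (vE (s := S)).
Local Notation redE := (@redE _ _ S).
Local Notation prQ := (@prQ p f S r).
Local Notation Qact := (@Qact p f S r).
Local Notation Mset := (@Mset p f S r a0).
Local Notation NN := (@Qfil p f S r (f - 2)).
Local Notation pi := (lpi NN).
Local Notation sw := (sw H).
Local Notation act := (@actE p f S).
Local Notation actk := (Kact (gact (S := S))).
Local Notation KO := (KrepO S r).
Local Notation hIO := (ind act (VOE r)).
Local Notation ml := (@ml p f S).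
Local Notation al := (al S).
Local Notation AO := (@AO p f S).
Local Notation BO := (@BO p f S).
Let p_prime := wd_prime H.
Let f_gt1 := wd_f H.
Let f_gt0 : (0 < f)%N := ltnW f_gt1.
Let i0 : 'I_f := Ordinal f_gt0.
Let i1 : 'I_f := Ordinal f_gt1.
Variables (ap : E S) (ap_neq0 : ap != 0) (ap_gt : 1 / 2 < vE ap) (ap_lt1 : vE ap < 1).
Local Notation T := (T_minus_ap r ap).
Hypothesis r1_p : ~~ (p %| r i1)%N.
Hypothesis r0_p : a0 = 1%N -> (p %| r i0)%N.

Definition reduces_to (u : G -> polyE) (x : G -> polyk) : Prop :=
  hIO u /\ forall g, map_mpoly redE (u g) = x g.

Lemma hIO_emb u g : hIO u -> exists2 P : polyO, Vpoly r P & u g = emb P.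
Proof. by move=> iu; apply/VOE_emb; exact: (ind_val iu). Qed.

Lemma reduces_to0 : reduces_to 0 0.
Proof.
split; first exact: (ind0 KO).
by move=> g; rewrite -[LHS]/(map_mpoly redE (0 : polyE)) -(emb0 S) redE_emb red0p.
Qed.

Lemma reduces_toB u x u' x' : reduces_to u x -> reduces_to u' x' -> reduces_to (u - u') (x - x').
Proof.
move=> [iu ux] [iu' ux']; split; first exact: (indB KO).
move=> g; have [P _ uE] := hIO_emb g iu; have [P' _ uE'] := hIO_emb g iu'.
rewrite -[RHS]/(x g - x' g) -[LHS]/(map_mpoly redE (u g - u' g)) -ux -ux'.
by rewrite uE uE' -embB !redE_emb redB.
Qed.

Lemma reduces_toD u x u' x' : reduces_to u x -> reduces_to u' x' -> reduces_to (u + u') (x + x').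
Proof.
move=> h h'; have := reduces_toB h (reduces_toB reduces_to0 h').
by rewrite !sub0r !opprK.
Qed.

Lemma reduces_to_sum (I : finType) (u : I -> G -> polyE) (x : I -> G -> polyk) :
  (forall i, reduces_to (u i) (x i)) -> reduces_to (\sum_i u i) (\sum_i x i).
Proof.
move=> h; apply: (big_ind2 reduces_to) => //; first exact: reduces_to0.
by move=> *; exact: reduces_toD.
Qed.

Lemma reduces_toZ0 a u : vint vE a -> redE a = 0 -> hIO u -> reduces_to (a *: u) 0.
Proof.
move=> ia ra iu; split; first exact: hIOZ.
move=> g; have [P _ uE] := hIO_emb g iu.
rewrite -[LHS]/(map_mpoly redE (a *: u g)) uE.
have aE : a = val (insubd (0 : O) a) by rewrite insubdK.
rewrite {1}aE -embZ redE_emb redZ.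
have -> : redO (insubd (0 : O) a) = redE (val (insubd (0 : O) a)) by [].
by rewrite -aE ra scale0r.
Qed.

Lemma reduces_to_bracket g P : g \in unitmx -> Vpoly r P -> reduces_to (brO g P) (bracket actk g (red P)).
Proof.
move=> ug rP; split; first exact: (brO_ind H).
have F0 : map_mpoly redE (0 : polyE) = 0 by rewrite -(emb0 S) redE_emb red0p.
have Fa x : inK x -> map_mpoly redE (act x (emb P)) = actk x (map_mpoly redE (emb P)).
  by move=> Kx; rewrite -(emb_actO _ Kx) !redE_emb (red_actO _ Kx).
have := bracket_map p_prime (act := act) (act' := actk) g F0 Fa.
by rewrite redE_emb => e g'; rewrite -e.
Qed.

Lemma lpiT_lin a u v : lpi T (a *: u + v) = a *: lpi T u + lpi T v.
Proof. by rewrite lpiD lpiZ. Qed.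

Lemma ap_gt0 : 0 < vE ap.
Proof. by apply: lt_trans ap_gt; rewrite divr_gt0. Qed.

Lemma red_ap2 : vint vE (ap ^+ 2 / p%:R) /\ redE (ap ^+ 2 / p%:R) = 0.
Proof.
have vv := @vE_valuation _ _ S; have pn0 := pE0 S.
apply: red_pos; first by rewrite mulf_neq0 ?expf_neq0 ?invr_eq0.
rewrite vltM ?expf_neq0 ?invr_eq0 // vltV // (vEp S) vltX //.
exact: double_sub1_gt0.
Qed.

Lemma nat_map_reduces_to u x : reduces_to u x -> lpi T u = 0 -> nat_map (r := r) (ap := ap) x 0.
Proof.
move=> [iu ux] u0; exists 1%N, (fun=> 1), (fun=> u); split=> //.
  by rewrite big_ord1 scale1r; apply: funext => g; rewrite ux.
have := tau0 r ap; rewrite big_ord1 /tau u0.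
have -> : lpi T 0 = 0 by have := lpiT_lin (-1) 0 0; rewrite scaler0 addr0 scaleN1r addNr.
by move=> ->.
Qed.

(** The function provided by [lift_relation] is zero modulo T - a_p. Its correction terms have the
    coefficients a_p^2 / p and a_p, both of positive value, so it has the same reduction as T[g, W]
    / p, which is thus sent to zero. *)
Lemma lift_bracket g J (D : Fq S -> polyO) (DB : polyO) : g \in unitmx ->
  (forall l, Vpoly r (D l)) -> (forall l, AO l (WJ S r J) = p%:R * D l) ->
  Vpoly r DB -> BO (WJ S r J) = p%:R * DB ->
  nat_map (r := r) (ap := ap) (\sum_(l : Fq S) bracket actk (g *m ml l) (red (D l)) +
    bracket actk (g *m al) (red DB)) 0.
Proof.
move=> ug rD AD rDB BD.
have tq l : (- tO l) ^+ q = - tO (S := S) l by exact: (NtOq H).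
have [C hC'] := choice (fun l => AR_v0 H (tq l)).
have hC l : AO l (v0 O p r) = p%:R * C l by rewrite [LHS]hC' add0r.
have [E0 hE'] := BR_v0 O H.
set Yr := mono O (fun=> 0%N) r in hE'.
have hE : BO (v0 O p r) = Yr + p%:R * E0 by exact: hE'.
have rv : Vpoly r (v0 O p r) by apply: (v0_Vpoly H).
have rY : Vpoly r Yr by apply: Vpoly_mono.
have rC l : Vpoly r (C l) by apply: Vpoly_divp; rewrite -hC; exact: AR_Vpoly.
have rE : Vpoly r E0.
  apply: Vpoly_divp; have -> : p%:R * E0 = BO (v0 O p r) - Yr by rewrite hE addrC addKr.
  by apply: VpolyB => //; exact: BR_Vpoly.
have rW : Vpoly r (WJ S r J) by exact: Wpoly_Vpoly.
pose gn c := g *m nmx (S := S) c; pose gc c := gn c *m invmx al.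
have ugn c : gn c \in unitmx by rewrite unitmx_mul ug; exact: inK_unit (inK_nmx c).
have ugc c : gc c \in unitmx by rewrite unitmx_mul ugn unitmx_inv unit_al.
have gcE c : gc c *m al = gn c by rewrite mulmxKV ?unit_al.
pose Y := \sum_(l : Fq S) brO (g *m ml l) (D l) + brO (g *m al) DB.
pose Yc c := \sum_(l : Fq S) brO (gc c *m ml l) (C l) + brO (gn c) E0.
pose t (c : Fq S) : E S := val (tO c ^+ J).
have iYc c : hIO (Yc c).
  apply: (indD KO); last exact: (brO_ind H).
  by apply: (ind_sum KO) => l _; apply: (brO_ind H) => //; rewrite unitmx_mul ugc unit_ml.
have ugl l : g *m ml l \in unitmx by rewrite unitmx_mul ug unit_ml.
have uga : g *m al \in unitmx by rewrite unitmx_mul ug unit_al.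
have hY : hecke_bracket act (@AE p f S) (@BE p f S) g (emb (WJ S r J)) = p%:R *: Y.
  rewrite hecke_emb BD (brO_p H) /Y scalerDr scaler_sumr; congr (_ + _).
  by apply: eq_bigr => l _; rewrite AD (brO_p H).
have hYc c : hecke_bracket act (@AE p f S) (@BE p f S) (gc c) (emb (v0 O p r)) =
    p%:R *: Yc c + brO (gn c) Yr.
  rewrite hecke_emb gcE hE (brOD H) (brO_p H) /Yc scalerDr scaler_sumr.
  rewrite -addrA [X in _ + X = _]addrC; congr (_ + _).
  by apply: eq_bigr => l _; rewrite hC (brO_p H).
have FY : lpi T (p%:R *: Y) = ap *: lpi T (brO g (WJ S r J)).
  by rewrite -hY; apply: T_rel => //; exact: emb_Vpoly.
have FYc c : lpi T (p%:R *: Yc c + brO (gn c) Yr) = ap *: lpi T (brO (gc c) (v0 O p r)).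
  by rewrite -hYc; apply: T_rel => //; exact: emb_Vpoly.
(* W is a combination of the n_c Y^r with n_c in K, and [g, n_c Y^r] = [g n_c, Y^r]. *)
have WE : brO g (WJ S r J) = \sum_c t c *: brO (gn c) Yr.
  rewrite /WJ /Wpoly (brO_sum H); apply: eq_bigr => c _.
  by rewrite (brOZ H) (brO_K H _ _ (inK_nmx c)) actO_nmx.
have U0 := lift_relation lpiT_lin (pE0 S) FY WE FYc.
apply: nat_map_reduces_to U0.
have [i2 r2] := red_ap2; have [ia ra] := red_pos ap_neq0 ap_gt0.
have it c : vint vE (t c) by exact: OvalP.
have h1 c : reduces_to ((ap ^+ 2 / p%:R) *: (t c *: brO (gc c) (v0 O p r))) 0.
  exact: (reduces_toZ0 i2 r2 (hIOZ (it c) (brO_ind H (ugc c) rv))).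
have h2 c : reduces_to (ap *: (t c *: Yc c)) 0.
  exact: (reduces_toZ0 ia ra (hIOZ (it c) (iYc c))).
have h3 := reduces_to_sum (fun c => reduces_toB (h1 c) (h2 c)).
have h4 : reduces_to Y (\sum_(l : Fq S) bracket actk (g *m ml l) (red (D l)) +
    bracket actk (g *m al) (red DB)).
  apply: reduces_toD; last by apply: reduces_to_bracket.
  by apply: reduces_to_sum => l; apply: reduces_to_bracket.
have z : \sum_(c : Fq S) ((0 : G -> polyk) - 0) = 0 by rewrite big1 // => c _; rewrite subrr.
by rewrite z in h3; have := reduces_toB h4 h3; rewrite subr0.
Qed.

(** A stronger form of [gr_map y 0]: y lifts to ind V_r, and the image of the lift is zero in
    [ThetaBar] itself, not merely in F_(f-2). *)
Definition lifts_to_zero (y : G -> Qgr_amb S r (f - 2)) : Prop := exists x : G -> polyk,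
  [/\ ind actk (Vpoly r) x, nat_map (r := r) (ap := ap) x 0, forall g, Mset 1 (prQ (x g))
    & y = fun g => pi (prQ (x g))].

Lemma lifts_to_zero_gr_map y : lifts_to_zero y -> gr_map (ap := ap) y 0.
Proof.
move=> [x [ix nx Mx ->]]; exists (prQ \o x), 0; split=> //.
- have p0 : prQ 0 = 0 by exact: prQ0.
  have pa z v : inK z -> Vpoly r v -> prQ (actk z v) = Kact Qact z (prQ v).
    by move=> Kz _; rewrite /Kact (Qact_pr H _ (inK_red Kz)).
  have [_ h2 h3 h4 h5] := ind_map (M' := setT) p0 (fun _ _ => I) pa ix.
  by split=> // g; apply/(NN1_Mset H); exact: Mx.
- by exists x.
- by apply/esym/lpi_eq0; exact: lspan0.
Qed.
Lemma nat_map_lin c x t x' t' : nat_map (r := r) (ap := ap) x t ->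
  nat_map (r := r) (ap := ap) x' t' ->
  nat_map (r := r) (ap := ap) (c *: x + x') (c *: t + t').
Proof.
move=> [m [d [y [iy -> ->]]]] [n [d' [y' [iy' -> ->]]]].
exists (m + n)%N,
  (fun i => match fintype.split i with inl j => c * d j | inr j => d' j end),
  (fun i => match fintype.split i with inl j => y j | inr j => y' j end); split.
- by move=> i; case: fintype.split.
- rewrite big_split_ord /= scaler_sumr; congr (_ + _); apply: eq_bigr => i _.
    by rewrite -/(unsplit (inl i)) unsplitK scalerA.
  by rewrite -/(unsplit (inr i)) unsplitK.
- rewrite big_split_ord /= scaler_sumr; congr (_ + _); apply: eq_bigr => i _.
    by rewrite -/(unsplit (inl i)) unsplitK tens_scale [in RHS]tens_scale -scalerA.
  by rewrite -/(unsplit (inr i)) unsplitK.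
Qed.

Definition grQ (v : polyk) : Qgr_amb S r (f - 2) := pi (prQ v).

Lemma grQ_lin c u v : grQ (c *: u + v) = c *: grQ u + grQ v.
Proof. by rewrite /grQ prQ_lin lpiD lpiZ. Qed.
Lemma grQD u v : grQ (u + v) = grQ u + grQ v.
Proof. by have := grQ_lin 1 u v; rewrite !scale1r. Qed.
Lemma grQ0 : grQ 0 = 0.
Proof. by have := grQ_lin (-1) 0 0; rewrite scaler0 addr0 scaleN1r addNr. Qed.

Lemma grQ_bracket g v g' : grQ (bracket actk g v g') = grbracket g (grQ v) g'.
Proof.
rewrite /grbracket !bracketE; case: asboolP => h; last exact: grQ0.
have Kx := inK_red (Kpart_inK p_prime h).
by rewrite /grQ /Kact (Qga_pi H _ Kx) (Qact_pr H _ Kx).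
Qed.

Lemma Mset_bracket g v g' : Mset 1 (prQ v) -> Mset 1 (prQ (bracket actk g v g')).
Proof.
move=> Mv; rewrite bracketE; case: asboolP => h; last by rewrite prQ0; exact: (Mset0 S H).
have Kx := inK_red (Kpart_inK p_prime h).
by rewrite /Kact -(Qact_pr H _ Kx); apply: (Mset_act H).
Qed.

Lemma Mset_prD u v : Mset 1 (prQ u) -> Mset 1 (prQ v) -> Mset 1 (prQ (u + v)).
Proof. by move=> Mu Mv; rewrite -[u]scale1r prQ_lin; apply: (Mset_lin H). Qed.

Lemma lifts_to_zero_lin c y y' : lifts_to_zero y -> lifts_to_zero y' -> lifts_to_zero (c *: y + y').
Proof.
move=> [x [ix nx Mx ->]] [x' [ix' nx' Mx' ->]]; exists (c *: x + x'); split.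
- apply: (indD (Krepk S H)) => //.
  apply: (ind_map (F := fun v : polyk => c *: v) _ _ _ ix) => [|v rv|z v _ _].
  + exact: scaler0.
  + exact: VpolyZ.
  + apply: esym; rewrite /Kact; exact: linearZ.
- by have := nat_map_lin c nx nx'; rewrite scaler0 addr0.
- move=> g; rewrite -[(c *: x + x') g]/(c *: x g + x' g) prQ_lin.
  by apply: (Mset_lin H).
- apply: funext => g; rewrite -[RHS]/(grQ (c *: x g + x' g)) grQ_lin.
  by [].
Qed.

Lemma lifts_to_zero0 : lifts_to_zero 0.
Proof.
exists 0; split.
- exact: (ind0 (Krepk S H)).
- apply: nat_map_reduces_to reduces_to0 _.
  by have := lpiT_lin (-1) 0 0; rewrite scaler0 addr0 scaleN1r addNr.
- by move=> g; rewrite prQ0; exact: (Mset0 S H).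
- by apply: funext => g; rewrite -[RHS]/(grQ 0) grQ0.
Qed.

Lemma lifts_to_zeroZ c y : lifts_to_zero y -> lifts_to_zero (c *: y).
Proof. by move=> Zy; rewrite -[c *: y]addr0; apply: lifts_to_zero_lin => //; exact: lifts_to_zero0. Qed.

Lemma lifts_to_zero_sum (I : finType) (y : I -> G -> Qgr_amb S r (f - 2)) :
  (forall i, lifts_to_zero (y i)) -> lifts_to_zero (\sum_i y i).
Proof.
move=> h; apply: (big_ind lifts_to_zero) => //; first exact: lifts_to_zero0.
by move=> u v Zu Zv; rewrite -[u]scale1r; exact: lifts_to_zero_lin.
Qed.

Lemma lifts_to_zero_brackets g (b : 'I_f -> nat) : g \in unitmx -> (forall j, b j <= sw j)%N ->
  lifts_to_zero (\sum_(l : Fq S) grbracket (g *m ml l)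
       ((- ((r i1)%:R * Bb S H b) * (- io l) ^+ (val_of sw - val_of b)) *:
          pi (eQ S r (q.-1 + a0 - p))) +
     grbracket (g *m al) ((- (r i1)%:R * (val_of b == 0)%N%:R) *: pi (eQ S r p))).
Proof.
move=> ug bs.
have [D hD] := choice (@hecke_lift_A p f S r a0 H r0_p b bs).
have [DB [rB BE MB piB]] := @hecke_lift_B p f S r a0 H b bs.
have rD l : Vpoly r (D l) by have [] := hD l.
have MD l : Mset 1 (prQ (red (D l))) by have [] := hD l.
have ugl l : g *m ml l \in unitmx by rewrite unitmx_mul ug unit_ml.
have uga : g *m al \in unitmx by rewrite unitmx_mul ug unit_al.
exists (\sum_(l : Fq S) bracket actk (g *m ml l) (red (D l)) +
    bracket actk (g *m al) (red DB)); split.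
- apply: (indD (Krepk S H)).
    apply: (ind_sum (Krepk S H)) => l _.
    by apply: (bracket_ind p_prime (Krepk S H)) => //; exact: red_Vpoly.
  by apply: (bracket_ind p_prime (Krepk S H)) => //; exact: red_Vpoly.
- by apply: (lift_bracket ug rD _ rB BE) => l; have [] := hD l.
- move=> g'; set X := \sum_(l : Fq S) _.
  rewrite -[(X + _) g']/(X g' + bracket actk (g *m al) (red DB) g').
  apply: Mset_prD; last exact: Mset_bracket.
  rewrite /X fct_sumE; apply: (big_ind (fun v => Mset 1 (prQ v))).
  + by rewrite prQ0; exact: (Mset0 S H).
  + exact: Mset_prD.
  + by move=> l _; exact: Mset_bracket.
- apply: funext => g'; set X := \sum_(l : Fq S) bracket actk _ _.
  rewrite -[RHS]/(grQ (X g' + bracket actk (g *m al) (red DB) g')) grQD grQ_bracket.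
  set X' := \sum_(l : Fq S) grbracket _ _; rewrite -[LHS]/(X' g' + grbracket (g *m al) _ g').
  congr (_ + _); last by rewrite /grQ piB.
  rewrite /X /X' !fct_sumE (big_morph grQ grQD grQ0); apply: eq_bigr => l _.
  by rewrite grQ_bracket /grQ; have [_ _ _ ->] := hD l.
Qed.

Variables (m : nat) (phi : {linear polyk -> Qgr_amb S r (f - 2)}).
Hypothesis iso : weight_iso sw m phi.
Local Notation hw := (hecke_bracket (Kact (wact m)) (@Aw p f S) (@Bw p f S)).

Definition phi_T g (v : polyk) :=
  \sum_(l : Fq S) grbracket (r := r) (g *m ml l) (phi (Aw l v)) + grbracket (g *m al) (phi (Bw v)).

Lemma phi_br g v g' : Vpoly sw v ->
  phi (bracket (Kact (wact m)) g v g') = grbracket g (phi v) g'.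
Proof.
move=> sv; rewrite /grbracket !bracketE; case: asboolP => h; last exact: linear0.
have Kx := inK_red (Kpart_inK p_prime h).
by rewrite /Kact (ph_equiv iso Kx sv).
Qed.

Lemma Aw_Vpoly s l (v : polyk) : Vpoly s v -> Vpoly s (Aw (S := S) l v).
Proof.
by apply: Vpoly_psubst => i; [exact: Vpoly_pX|apply: VpolyZ; exact: Vpoly_pX].
Qed.
Lemma Bw_Vpoly s (v : polyk) : Vpoly s v -> Vpoly s (Bw (S := S) v).
Proof. by apply: Vpoly_psubst => i; [exact: Vpoly0|exact: Vpoly_pY]. Qed.

Lemma phi_hecke g v : Vpoly sw v -> phi \o hw g v = phi_T g v.
Proof.
move=> sv; apply: funext => g'.
rewrite (@hecke_bracketE p f S _ (Kact (wact m)) _ _ g v (fun l => Aw l v) (Bw v) (fun=> erefl) erefl) /=.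
set X := \sum_(l : Fq S) _; set X' := bracket _ _ _.
rewrite -[(X + X') g']/(X g' + X' g') linearD /X' (phi_br _ _ (Bw_Vpoly sv)) /phi_T.
set Y := \sum_(l : Fq S) _; rewrite -[RHS]/(Y g' + grbracket (g *m al) (phi (Bw v)) g').
congr (_ + _); rewrite /X /Y !fct_sumE linear_sum; apply: eq_bigr => l _.
by rewrite (phi_br _ _ (Aw_Vpoly sv)).
Qed.

Lemma phi_T_lin g c u v : phi_T g (c *: u + v) = c *: phi_T g u + phi_T g v.
Proof.
rewrite /phi_T Bw_lin linearP (grbracket_lin H) scalerDr scaler_sumr addrACA -big_split.
congr (_ + _); apply: eq_bigr => l _; by rewrite Aw_lin linearP (grbracket_lin H).
Qed.

(** The scalar -C / (r_1 B), where B is [Bb], matches the sum over l. The remaining term occurs only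
    for val b = 0, where B = -1; there the same scalar gives the coefficient -C of e_p, in agreement
    with the image of Y^s. *)
Lemma lifts_to_zero_mono C g b : g \in unitmx -> (forall j, b j <= sw j)%N ->
  phi (mono k sw (fun=> 0%N)) = C *: pi (eQ S r (q.-1 + a0 - p)) ->
  phi (mono k (fun=> 0%N) sw) = - C *: pi (eQ S r p) ->
  lifts_to_zero (phi_T g (mono k b (fun i => sw i - b i)%N)).
Proof.
move=> ug bs pX pY; have r1n := r1_neq0 S r1_p; have Bn := Bb_neq0 S bs.
have := lifts_to_zeroZ (- C / ((r i1)%:R * Bb S H b)) (lifts_to_zero_brackets ug bs); congr lifts_to_zero.
rewrite /phi_T (Bw_mono S H bs) phZ pY scalerDr scaler_sumr; congr (_ + _).
  apply: eq_bigr => l _; rewrite (Aw_mono _ bs) phZ pX -!(grbracketZ H) !scalerA.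
  congr (grbracket _ (_ *: _)); move: (_ ^+ _) ((r i1)%:R : k) (Bb S H b) r1n Bn => t R1 B R1n Bn'.
  by field; rewrite R1n Bn'.
rewrite -(grbracketZ H) !scalerA; congr (grbracket _ (_ *: _)).
have [b0|_] := eqVneq (val_of b) 0%N; last by rewrite !mulr0 mul0r.
by rewrite (Bb0 S H b0) mulrN1 invrN mulrNN mul1r mulr1 mulrN divfK.
Qed.

Lemma lifts_to_zero_hecke C g v : g \in unitmx -> Vpoly sw v ->
  phi (mono k sw (fun=> 0%N)) = C *: pi (eQ S r (q.-1 + a0 - p)) ->
  phi (mono k (fun=> 0%N) sw) = - C *: pi (eQ S r p) ->
  lifts_to_zero (phi \o hw g v).
Proof.
move=> ug sv pX pY; rewrite phi_hecke //; move: v sv; apply: Vpoly_ind => [|c P Q ZP ZQ|a ar].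
- have -> : phi_T g 0 = 0; last exact: lifts_to_zero0.
  by have := phi_T_lin g (-1) 0 0; rewrite scaler0 addr0 scaleN1r addNr.
- by rewrite phi_T_lin; exact: lifts_to_zero_lin.
- exact: lifts_to_zero_mono pX pY.
Qed.
End HeckeVanishing.

Theorem theorem10p1 (p f : nat) (S : setting p f)
  (p_prime : prime p) (p_gt2 : (2 < p)%N) (f_gt1 : (1 < f)%N)
  (k r : 'I_f -> nat)
  (r_k : forall i, k i = (r i + 2)%N)
  (r_ge_q : forall i, (p ^ f <= r i)%N)
  (a0 : nat) (a0_ge1 : (1 <= a0)%N) (a0_le : (a0 <= p.-1)%N)
  (r_mod : (\sum_(i < f) r i * p ^ i = a0 %[mod (p ^ f).-1])%N)
  (r1_p : ~~ (p %| r (Ordinal f_gt1))%N)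
  (r0_p : a0 = 1%N -> (p %| r (Ordinal (ltnW f_gt1)))%N)
  (ap : E S) (ap_neq0 : ap != 0)
  (ap_gt : (1 / 2 : rat) < vE ap) (ap_lt : vE ap < 1) :
  [/\ (* the natural map ind V_r -> ThetaBar factors through ind Q *)
      forall (x : 'M[L S]_2 -> {mpoly (Fpbar S)[f + f]}) (t : ThetaBar r ap),
        ind (Kact (gact (S := S))) (Vpoly r) x -> nat_map x t ->
        (forall g, prQ r (x g) = 0) -> t = 0,
      (* Q_{f-1} / Q_{f-2} is a weight, so T is defined on its induction *)
      exists (s : 'I_f -> nat) (m : nat)
        (phi : {linear {mpoly (Fpbar S)[f + f]} -> Qgr_amb S r (f - 2)}),
        weight_iso s m phi
    & (* the map ind (Q_{f-1} / Q_{f-2}) -> F_{f-1} / F_{f-2} kills the image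
         of T *)
      forall (s : 'I_f -> nat) (m : nat)
        (phi : {linear {mpoly (Fpbar S)[f + f]} -> Qgr_amb S r (f - 2)}),
        weight_iso s m phi ->
        forall h Th : 'M[L S]_2 -> {mpoly (Fpbar S)[f + f]},
        hecke_weight s m h Th ->
        gr_map (ap := ap) (i := f - 2) (phi \o Th) 0].

Proof.
have H : weight_data p r a0.
  by exact: (WeightData p_prime p_gt2 f_gt1 r_ge_q a0_ge1 a0_le r_mod).
have r1_p' : ~~ (p %| r (Ordinal (wd_f H)))%N.
  by rewrite (_ : Ordinal (wd_f H) = Ordinal f_gt1) //; exact: val_inj.
have r0_p' : a0 = 1%N -> (p %| r (Ordinal (ltnW (wd_f H))))%N.
  by rewrite (_ : Ordinal (ltnW (wd_f H)) = Ordinal (ltnW f_gt1)) //; exact: val_inj.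
split.
- move=> x t _; exact: (nat_map_factors_Q H ap_neq0 (ap_gt0 ap_gt) ap_lt).
- exact: (graded_piece_weight S H).
move=> s m phi iso h Th [n [g [v [gv _ ->]]]].
(* The given isomorphism is arbitrary; these two values are all that has to be known of it besides
   equivariance. *)
have [sE [C [_ pX pY]]] := weight_iso_extremal H iso.
have {sE} sE : s = sw H by apply: funext.
rewrite {}sE in iso gv pX pY.
apply: (lifts_to_zero_gr_map H).
have -> : phi \o (\sum_i hecke_bracket (Kact (wact m)) (@Aw p f S) (@Bw p f S) (g i) (v i)) =
    \sum_i (phi \o hecke_bracket (Kact (wact m)) (@Aw p f S) (@Bw p f S) (g i) (v i)).
  by rewrite funeqE => g'; rewrite /= !fct_sumE linear_sum.
apply: (lifts_to_zero_sum H) => i; have [ug sv] := gv i.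
exact: (lifts_to_zero_hecke ap_neq0 ap_gt r1_p' r0_p' iso ug sv pX pY).
Qed.
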